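(* Let $d\in\{1,2,3\}$ and let $\alpha$ be a positive integer. Let $X,X_1,X_2,\dots$ be i.i.d. $\mathbb{Z}^d$-valued random variables which are genuinely $d$-dimensional, let $S_0=0$, $S_n=\sum_{j=1}^nX_j$, and let $L_n(\alpha)$ be its $\alpha$-fold self-intersection local time. If $$\liminf_{n\to\infty}\frac{\operatorname{Var}(L_n(\alpha))}{v_{d,\alpha}(n)}>0,$$ where $v_{1,\alpha}(n)=n^{1+\alpha}$, $v_{2,\alpha}(n)=n^2\log(n)^{2\alpha-4}$, $v_{3,\alpha}(n)=n\log n$, then $\mathbb{E}|X|^2<\infty$ and $\mathbb{E}X=0$.
   Context: The local time at $x\in\mathbb{Z}^d$ is $l(n,x)=\sum_{j=1}^n \mathbf{1}(S_j=x)$, and the $\alpha$-fold self-intersection local time is $L_n(\alpha)=\sum_{x\in\mathbb{Z}^d} l(n,x)^\alpha$. The i.i.d. increments are called genuinely $d$-dimensional if the support of $X_1-X_2$ linearly generates $\mathbb{R}^d$. *)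

(* Defs.v *)
From HB Require Import structures.
From mathcomp Require Import all_boot all_order all_algebra.
From mathcomp Require Import all_classical all_reals all_analysis.
Set Implicit Arguments. Unset Strict Implicit. Unset Printing Implicit Defensive.
Import Order.TTheory GRing.Theory Num.Theory.
Local Open Scope classical_set_scope.
Local Open Scope ring_scope.

(* A Z^d-valued (discrete) random variable is measurable: every level set
   is an event (equivalently, measurable for the discrete sigma-algebra). *)
Definition discrete_rv {dT} {T : measurableType dT} {d : nat}
  (Y : T -> 'rV[int]_d) : Prop :=
  forall z : 'rV[int]_d, measurable (Y @^-1` [set z]).

Definition mutually_independent {dT} {T : measurableType dT} {R : realType}
  (P : probability T R) {d : nat} (X : nat -> T -> 'rV[int]_d) : Prop :=
  forall (F : seq nat) (A : nat -> set 'rV[int]_d), uniq F ->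
    P (\bigcap_(i in [set` F]) (X i @^-1` A i)) =
    (\prod_(i <- F) P (X i @^-1` A i))%E.

Definition identically_distributed {dT} {T : measurableType dT} {R : realType}
  (P : probability T R) {d : nat} (X : nat -> T -> 'rV[int]_d) : Prop :=
  forall (i : nat) (A : set 'rV[int]_d), P (X i @^-1` A) = P (X 0%N @^-1` A).

Definition iid {dT} {T : measurableType dT} {R : realType}
  (P : probability T R) {d : nat} (X : nat -> T -> 'rV[int]_d) : Prop :=
  (forall i, discrete_rv (X i)) /\ mutually_independent P X /\
  identically_distributed P X.

Definition support {dT} {T : measurableType dT} {R : realType}
  (P : probability T R) {d : nat} (Y : T -> 'rV[int]_d) : set 'rV[int]_d :=
  [set z | (0 < P (Y @^-1` [set z]))%E].

Definition toR {R : realType} {d : nat} (z : 'rV[int]_d) : 'rV[R]_d :=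
  map_mx (fun k : int => k%:~R) z.

Definition linearly_generates (R : realType) {d : nat} (G : set 'rV[int]_d) :
  Prop :=
  forall v : 'rV[R]_d, exists (s : seq 'rV[int]_d) (c : seq R),
    (forall z, z \in s -> G z) /\
    v = \sum_(i < size s) c`_i *: toR (nth 0 s i).

Definition genuinely_d_dim {dT} {T : measurableType dT} {R : realType}
  (P : probability T R) {d : nat} (X : nat -> T -> 'rV[int]_d) : Prop :=
  linearly_generates R (support P (fun w => X 1%N w - X 2%N w)).

Definition walk {T : Type} {d : nat} (X : nat -> T -> 'rV[int]_d)
  (n : nat) (w : T) : 'rV[int]_d :=
  \sum_(1 <= j < n.+1) X j w.

Definition local_time {T : Type} {d : nat} (X : nat -> T -> 'rV[int]_d)
  (n : nat) (x : 'rV[int]_d) (w : T) : nat :=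
  \sum_(1 <= j < n.+1) (walk X j w == x : nat).

(* L_n(alpha) = sum_{x in Z^d} l(n,x)^alpha.  Only the finitely many x
   visited by S_1..S_n have nonzero local time, and alpha > 0, so the sum
   over Z^d is the sum over the visited sites. *)
Definition self_intersection_lt {R : realType} {T : Type} {d : nat}
  (X : nat -> T -> 'rV[int]_d) (alpha n : nat) (w : T) : R :=
  (\sum_(x <- undup [seq walk X j w | j <- iota 1 n])
     (local_time X n x w) ^ alpha)%N%:R.

Definition vnorm {R : realType} (d alpha n : nat) : R :=
  if d == 1%N then (n%:R) ^+ (1 + alpha)
  else if d == 2%N then (n%:R) ^+ 2 * (ln (n%:R)) ^ (2 * alpha%:Z - 4)
  else (n%:R) * ln (n%:R).

Definition sqnorm {R : realType} {d : nat} (z : 'rV[int]_d) : R :=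
  \sum_(i < d) ((z ord0 i)%:~R) ^+ 2.

(* Main.v *)
Require Import Defs.
From HB Require Import structures.
From mathcomp Require Import all_boot all_order all_algebra.
From mathcomp Require Import all_classical all_reals all_analysis.
From mathcomp Require Import measurable_realfun.
From mathcomp Require Import ring lra zify.
Set Implicit Arguments. Unset Strict Implicit. Unset Printing Implicit Defensive.
Import Order.TTheory GRing.Theory Num.Theory.
Local Open Scope classical_set_scope.
Local Open Scope ring_scope.

(** Write [u m] for the return probability P(S_m = 0) and let [Q m] bound
    sup_x P(S_m = x).  Expanding [l ^ alpha] in binomial coefficients turns
    L_n(alpha) into a sum over increasing chains of times at which the walk sits
    at a single site, and its variance into covariances of pairs of chains.  If
    one chain lies in a gap of the other, the covariance is a difference of values
    of [u] that summation by parts controls; otherwise the chains interleave and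
    the joint probability alone is small.  Both cases give
      Var L_n(alpha) <= K n (sum_{m <= n} Q m)^(2 alpha - 4)
                          sum_{a <= n, m <= 2n} (1 + min(a, m)) (Q a) (u m).
    Genuine d-dimensionality gives [Q m = C m^(-d/2)] through Nash's inequality, and
    then the right-hand side is O(eps v(n)) as soon as [u m <= eps m^(-d/2)] for all
    large [m].  This holds for every [eps > 0] when E|X|^2 is infinite, because the
    long steps improve the constant in Nash's inequality without limit, and also
    when E|X|^2 is finite but E X <> 0, because a walk back at the origin has one
    half moving against its drift, which costs a factor O(1/m) by Chebyshev.  Hence
    either failure contradicts the lower bound on the variance.

    The estimates are made for the projected walk on the torus (Z/(N+2))^d, where
    every sum is finite; for fixed [n] the variance on Z^d is the limit [N -> oo]. *)

(** * Chains of times *)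

(** The step law may be heavy-tailed, periodic and asymmetric, so there is no regularity of [u] to
    rely on, and only upper bounds on [u] and [Q] enter. For an inner chain of length B in a gap of
    length m the covariance carries u(m - B) - u(m). The inner chain has (m - 1 - B)_+ positions in
    the gap, and after a shift of m by B the two sums cancel up to u(m) min(m, B); this uses only
    that the weight of the rest of the outer chain grows with the time left to it. Interleaved
    chains sit at two sites x and y and visit them in an order containing x y x y. The three moves
    give Green factors at z, -z and z, where z = y - x; bounding one of the factors at z by [Q]
    leaves a sum over z that is a return probability. Hence [u] appears exactly once in the final
    bound, and a better constant for returns to the origin is enough even where [Q] does not
    improve. Constants must not depend on the torus, since for each [n] the torus is chosen last. *)

Lemma ler_of_eq (R : numDomainType) (x y : R) : x = y -> x <= y.
Proof. by move->. Qed.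

Section IncreasingLists.

(* The lists [a < t_1 < ... < t_k <= b]. *)
Fixpoint incs (k a b : nat) : seq (seq nat) :=
  if k is k'.+1 then
    flatten [seq [seq t :: l | l <- incs k' t b] | t <- index_iota a.+1 b.+1]
  else [:: [::]].

Lemma mem_incs k a b i :
  (i \in incs k a b) =
  [&& size i == k, path ltn a i & all (fun t => t <= b)%N i].
Proof.
elim: k a i => [|k IH] a [|t i] //=.
  by apply/negP => /flattenP[s /mapP[t _ ->]] /mapP[].
apply/flattenP/idP => [[s /mapP[t' ht' ->]] /mapP[l hl [-> ->]]|].
  move: hl ht'; rewrite IH mem_index_iota => /and3P[/eqP -> -> ->].
  by rewrite eqxx !ltnS => /andP[-> ->].
case/and3P => hs /andP[hat hp] /andP[htb hall].
exists [seq t :: l | l <- incs k t b].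
  by apply/mapP; exists t => //; rewrite mem_index_iota ltnS hat.
by apply/mapP; exists i => //; rewrite IH hp hall -eqSS hs.
Qed.

Lemma incs_uniq k a b : uniq (incs k a b).
Proof.
elim: k a => [//|k IH] a /=.
have : uniq (index_iota a.+1 b.+1) by apply: iota_uniq.
elim: (index_iota _ _) => [//|t r IHr] /= /andP[ht hr].
rewrite cat_uniq map_inj_uniq ?IH ?IHr ?andbT //=; last by move=> x y [].
apply/hasPn => l /flattenP[s /mapP[t' ht' ->]] /mapP[l' _ ->].
by apply/negP => /mapP[l'' _ [e _]]; move: ht; rewrite -e ht'.
Qed.

Variable (R : realFieldType).
Implicit Types F : seq nat -> R.

Lemma sum_incs0 a b F : \sum_(i <- incs 0 a b) F i = F [::].
Proof. by rewrite /= big_seq1. Qed.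

Lemma sum_incsS k a b F : \sum_(i <- incs k.+1 a b) F i =
  \sum_(a.+1 <= t < b.+1) \sum_(l <- incs k t b) F (t :: l).
Proof.
rewrite /= big_flatten big_map; apply: eq_bigr => t _.
by rewrite big_map.
Qed.

Lemma sum_incs_cat s r a b F : \sum_(i <- incs (s + r) a b) F i =
  \sum_(i <- incs s a b) \sum_(i2 <- incs r (last a i) b) F (i ++ i2).
Proof.
elim: s a F => [|s IH] a F; first by rewrite add0n sum_incs0.
rewrite addSn !sum_incsS; apply: eq_bigr => t _.
by rewrite IH.
Qed.

Lemma sum_incs_addr k a b c F : \sum_(i <- incs k (a + c) (b + c)) F i =
  \sum_(i <- incs k a b) F (map (addn^~ c) i).
Proof.
elim: k a F => [|k IH] a F; first by rewrite !sum_incs0.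
rewrite !sum_incsS -!addSn big_addn addnK; apply: eq_bigr => t _.
by rewrite IH.
Qed.

Lemma incs_last k a b e : e \in incs k a b -> (a <= last a e)%N.
Proof.
rewrite mem_incs => /and3P[_ h _]; elim: e a h => //= t e IH a /andP[h /IH].
by apply: leq_trans; apply: ltnW.
Qed.

Lemma sum_incs_trunc k a c n F : (a <= c <= n)%N ->
  \sum_(i <- incs k a c) F i =
  \sum_(i <- incs k a n) (last a i <= c)%:R * F i.
Proof.
elim: k a F => [|k IH] a F /andP[ac cn]; first by rewrite !sum_incs0 /= ac mul1r.
rewrite !sum_incsS (big_cat_nat (n := c.+1) (p := n.+1)) //=.
rewrite [X in _ = _ + X](_ : _ = 0) ?addr0; last first.
  rewrite big_nat_cond big1 // => t /andP[/andP[ct tn] _].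
  rewrite big_seq big1 // => l hl.
  by rewrite leqNgt (leq_trans ct (incs_last hl)) mul0r.
apply: eq_big_nat => t /andP[lat ltc]; rewrite IH // cn andbT -ltnS //.
Qed.

Lemma ler_sum_incs k a b b' F : (b <= b')%N -> (forall i, 0 <= F i) ->
  \sum_(i <- incs k a b) F i <= \sum_(i <- incs k a b') F i.
Proof.
move=> hb; elim: k a F => [|k IH] a F hF; first by rewrite !sum_incs0.
rewrite !sum_incsS; case: (leqP a b) => hab.
  rewrite [leRHS](big_cat_nat (n := b.+1)) //= -[leLHS]addr0 lerD //.
    by apply: ler_sum => t _; apply: IH => i; apply: hF.
  by apply: sumr_ge0 => t _; apply: sumr_ge0 => l _; apply: hF.
rewrite big_geq ?ltnS //; first by apply: sumr_ge0 => t _; apply: sumr_ge0 => l _; apply: hF.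
exact: ltnW.
Qed.

End IncreasingLists.

Arguments incs : simpl never.

(** * Random walks on a finite abelian group *)

Section WalkOnGroup.
Variables (R : realFieldType) (G : finZmodType) (p : G -> R).
Hypotheses (p_ge0 : forall g, 0 <= p g) (p_sum1 : \sum_g p g = 1).

(* [Ex n] is the expectation over [n] independent steps of law [p]; [pn p m] is the
   law of the sum of [m] steps. *)
Fixpoint Ex n (f : seq G -> R) : R :=
  if n is n'.+1 then \sum_g p g * Ex n' (fun s => f (g :: s)) else f [::].

Fixpoint pn m (x : G) : R :=
  if m is m'.+1 then \sum_g p g * pn m' (x - g) else (x == 0)%:R.

Definition pos (y : G) (s : seq G) (t : nat) : G := y + \sum_(g <- take t s) g.

Lemma pos0 y s : pos y s 0 = y.
Proof. by rewrite /pos take0 big_nil addr0. Qed.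

Lemma pos_cons y g s t : pos y (g :: s) t.+1 = pos (y + g) s t.
Proof. by rewrite /pos /= big_cons addrA. Qed.

Lemma eq_Ex n f1 f2 : (forall s, size s = n -> f1 s = f2 s) -> Ex n f1 = Ex n f2.
Proof.
elim: n f1 f2 => [|n IH] f1 f2 h /=; first exact: h.
by apply: eq_bigr => g _; congr (_ * _); apply: IH => s hs; apply: h => /=; rewrite hs.
Qed.

Lemma Ex_sum n I (r : seq I) (P : pred I) (f : I -> seq G -> R) :
  Ex n (fun s => \sum_(i <- r | P i) f i s) = \sum_(i <- r | P i) Ex n (f i).
Proof.
elim: n f => [//|n IH] f /=.
under eq_bigr do rewrite IH big_distrr /=.
by rewrite exchange_big.
Qed.

Lemma ExZ n c f : Ex n (fun s => c * f s) = c * Ex n f.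
Proof.
elim: n f => [//|n IH] f /=; rewrite big_distrr /=.
by apply: eq_bigr => g _; rewrite IH mulrCA.
Qed.

Lemma ExD n f1 f2 : Ex n (fun s => f1 s + f2 s) = Ex n f1 + Ex n f2.
Proof.
elim: n f1 f2 => [//|n IH] f1 f2 /=; rewrite -big_split /=.
by apply: eq_bigr => g _; rewrite IH mulrDr.
Qed.

Lemma Ex_cst n c : Ex n (fun=> c) = c.
Proof.
elim: n => [//|n IH] /=.
by under eq_bigr do rewrite IH; rewrite -big_distrl /= p_sum1 mul1r.
Qed.

Lemma ler_Ex n f1 f2 : (forall s, size s = n -> f1 s <= f2 s) -> Ex n f1 <= Ex n f2.
Proof.
elim: n f1 f2 => [|n IH] f1 f2 h /=; first exact: h.
apply: ler_sum => g _; apply: ler_wpM2l => //; apply: IH => s hs; apply: h.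
by rewrite /= hs.
Qed.

Lemma Ex_cat m n f :
  Ex (m + n) f = Ex m (fun s1 => Ex n (fun s2 => f (s1 ++ s2))).
Proof. by elim: m f => [//|m IH] f /=; apply: eq_bigr => g _; rewrite IH. Qed.

Lemma pn_ge0 m x : 0 <= pn m x.
Proof.
elim: m x => [|m IH] x /=; first by rewrite ler0n.
by apply: sumr_ge0 => g _; rewrite mulr_ge0.
Qed.

Lemma sum_pn m : \sum_x pn m x = 1.
Proof.
elim: m => [|m IH] /=.
  rewrite (bigD1 0) //= eqxx big1 ?addr0 // => x /negbTE -> //.
rewrite exchange_big /= -[RHS]p_sum1; apply: eq_bigr => g _.
by rewrite -big_distrr /= (reindex_inj (addIr g)) /=
  (eq_bigr (pn m)) ?IH ?mulr1 // => x _; rewrite addrK.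
Qed.

Lemma pnD m n x : pn (m + n) x = \sum_y pn m y * pn n (x - y).
Proof.
elim: m x => [|m IH] x /=.
  rewrite (bigD1 0) //= eqxx mul1r subr0 big1 ?addr0 // => y /negbTE ->.
  by rewrite mul0r.
under [RHS]eq_bigr do rewrite big_distrl /=.
rewrite exchange_big /=; apply: eq_bigr => g _.
rewrite IH big_distrr /= [RHS](reindex_inj (addIr g)) /=.
by apply: eq_bigr => y _; rewrite addrK mulrA opprD addrA addrAC.
Qed.

(** The finite-dimensional distributions given the site [x0] at time [t0], as products of transition
    probabilities. *)
Fixpoint fdd (t0 : nat) (x0 : G) (tx : seq (nat * G)) : R :=
  if tx is (t, x) :: r then pn (t - t0) (x - x0) * fdd t x r else 1.

(** Induction on [n] consumes one step of the walk per unit of time. A repeated time leaves a factor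
    [pn p 0], which checks that the two prescribed sites agree, so the times need only increase
    weakly; the embeddings with ties rely on this. *)
Lemma Ex_fdd n y t0 tx : path leq t0 (map fst tx) ->
  all (fun q => q.1 <= t0 + n)%N tx ->
  Ex n (fun s => \prod_(q <- tx) (pos y s (q.1 - t0) == q.2)%:R) = fdd t0 y tx.
Proof.
elim: n y t0 tx => [|n IH] y t0 tx.
  elim: tx => [|[t x] r IHr] /=; first by rewrite big_nil.
  move=> /andP[h1 h2] /andP[h3 h4].
  have et : t = t0 by move: h1 h3; lia.
  rewrite et in h2 *; rewrite subnn big_cons subnn pos0 /=.
  rewrite subr_eq0 [x == y]eq_sym; case: (eqVneq y x) => [<-|]; last by rewrite !mul0r.
  by rewrite !mul1r -IHr.
elim: tx => [|[t x] r IHr]; first by move=> _ _; rewrite (eq_Ex (f2 := fun=> 1)) ?Ex_cst // => s _; rewrite big_nil.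
move=> hp ha;
have [h1 h2] : (t0 <= t)%N /\ path leq t (map fst r) by apply/andP; exact: hp.
have [h3 h4] : (t <= t0 + n.+1)%N /\ all (fun q => q.1 <= t0 + n.+1)%N r.
  by apply/andP; exact: ha.
case: (eqVneq t t0) => [et|nt].
  rewrite et in h2 *; rewrite /fdd -/fdd subnn [pn 0 _]/= subr_eq0 [x == y]eq_sym.
  rewrite (eq_Ex (f2 := fun s => (y == x)%:R *
      \prod_(q <- r) (pos y s (q.1 - t0) == q.2)%:R)); last first.
    by move=> s _; rewrite big_cons subnn pos0.
  rewrite ExZ; case: (eqVneq y x) => [<-|]; last by rewrite !mul0r.
  by rewrite !mul1r IHr.
have lt : (t0 < t)%N by rewrite ltn_neqAle eq_sym nt.
have E : (t - t0 = (t - t0.+1).+1)%N by rewrite subnS prednK ?subn_gt0.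
rewrite /fdd -/fdd E /= big_distrl /=; apply: eq_bigr => g _.
rewrite -mulrA; congr (_ * _).
have all_lt : all (fun q : nat * G => t0 < q.1)%N ((t, x) :: r).
  rewrite /= lt /=; move: h2; rewrite path_sortedE; last exact: leq_trans.
  case/andP => /allP h _; apply/allP => q hq.
  by apply: (leq_trans lt); apply: h; rewrite map_f.
transitivity (fdd t0.+1 (y + g) ((t, x) :: r)); last by rewrite /= opprD addrA.
rewrite -IH /=.
- apply: eq_Ex => s _; apply: eq_big_seq => q hq.
  move: (allP all_lt q hq) => lq.
  by rewrite -(pos_cons y g s) -subSn // subSS.
- by rewrite lt h2.
- by rewrite addSnnS h3.
Qed.

End WalkOnGroup.

Arguments pn : simpl never.
Arguments Ex : simpl never.

(** * Weights of chains and sums over nested chains *)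

Section ChainWeights.
Variables (R : realFieldType) (u : nat -> R).
Hypothesis u_ge0 : forall m, 0 <= u m.

(** With [u] the return probabilities, this is the probability that the walk is at all times of [r]
    where it was at time [t0]. A chain costs one return per gap, and its first time is free. *)
Fixpoint chain_weight (t0 : nat) (r : seq nat) : R :=
  if r is t :: r' then u (t - t0) * chain_weight t r' else 1.

Lemma chain_weight_ge0 t0 r : 0 <= chain_weight t0 r.
Proof. by elim: r t0 => [|t r IH] t0 //=; rewrite mulr_ge0. Qed.

Lemma chain_weight_addr c t0 r :
  chain_weight (t0 + c) (map (addn^~ c) r) = chain_weight t0 r.
Proof. by elim: r t0 => [|t r IH] t0 //=; rewrite subnDr IH. Qed.

Lemma chain_weight_cat t0 r c r' : chain_weight t0 (r ++ c :: r') =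
  chain_weight t0 r * u (c - last t0 r) * chain_weight c r'.
Proof. by elim: r t0 => [|t r IH] t0 /=; rewrite ?mul1r // IH !mulrA. Qed.

Variables (n : nat) (g : R).
Hypothesis u_sum : \sum_(1 <= m < n.+1) u m <= g.

Let g_ge0 : 0 <= g.
Proof. by apply: le_trans u_sum; apply: sumr_ge0. Qed.

Lemma sum_shift_le (F : nat -> R) a b : (b <= n)%N -> (forall m, 0 <= F m) ->
  \sum_(a.+1 <= t < b.+1) F (t - a)%N <= \sum_(1 <= m < n.+1) F m.
Proof.
move=> bn hF; rewrite -add1n big_addn; case: (leqP a b) => ab; last first.
  rewrite big_geq; first by apply: sumr_ge0.
  by move: ab; clear; lia.
rewrite [leRHS](big_cat_nat (n := (b.+1 - a)%N)) /=; [|lia|lia].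
rewrite -[leLHS]addr0 lerD ?sumr_ge0 //; apply: ler_of_eq.
by apply: eq_bigr => t _; rewrite addnK.
Qed.

Lemma sum_chain_weight_le k a b : (b <= n)%N ->
  \sum_(e <- incs k a b) chain_weight a e <= g ^+ k.
Proof.
move=> bn; elim: k a => [|k IH] a; first by rewrite sum_incs0 expr0.
rewrite sum_incsS exprS.
apply: (@le_trans _ _ (\sum_(a.+1 <= t < b.+1) u (t - a) * g ^+ k)).
  by apply: ler_sum => t _ /=; rewrite -big_distrr /= ler_wpM2l.
rewrite -big_distrl /= ler_wpM2r ?exprn_ge0 //.
by apply: le_trans u_sum; apply: sum_shift_le.
Qed.

(** The function [min(m, .)] is subadditive and splits over the gaps of the chain. The gap that
    carries it contributes the sum on the right, each of the [k.-1] others at most [g], and there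
    are [k] choices. *)
Lemma sum_chain_weight_min k a b m : (b <= n)%N ->
  \sum_(e <- incs k a b) chain_weight a e * (minn m (last a e - a))%:R <=
  k%:R * g ^+ k.-1 * \sum_(1 <= c < n.+1) u c * (minn m c)%:R.
Proof.
set c_ := \sum_(1 <= c < n.+1) _ => bn.
have c0 : 0 <= c_ by apply: sumr_ge0 => i _; rewrite mulr_ge0.
elim: k a => [|k IH] a; first by rewrite sum_incs0 /= subnn minn0 mulr0 !mul0r.
rewrite sum_incsS /=.
apply: (@le_trans _ _ (\sum_(a.+1 <= t < b.+1) (u (t - a) * (minn m (t - a))%:R * g ^+ k
   + u (t - a) * (k%:R * g ^+ k.-1 * c_)))).
  apply: ler_sum_nat => t /andP[h1 h2].
  apply: (@le_trans _ _ (\sum_(l <- incs k t b) (u (t - a) * (minn m (t - a))%:R * chain_weight t l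
     + u (t - a) * (chain_weight t l * (minn m (last t l - t))%:R)))).
    rewrite big_seq [leRHS]big_seq; apply: ler_sum => l hl.
    have h : (minn m (last t l - a) <= minn m (t - a) + minn m (last t l - t))%N.
      by move: (incs_last hl); lia.
    have : ((minn m (last t l - a))%:R <= (minn m (t - a))%:R + (minn m (last t l - t))%:R :> R).
      by rewrite -natrD ler_nat.
    move=> /(ler_wpM2l (mulr_ge0 (u_ge0 (t - a)) (chain_weight_ge0 t l))) /le_trans; apply.
    by apply: ler_of_eq; ring.
  rewrite big_split /= -!big_distrr /= lerD // ler_wpM2l ?mulr_ge0 //.
  exact: sum_chain_weight_le.
rewrite big_split /= -!big_distrl /=.
have h1 : \sum_(a.+1 <= t < b.+1) u (t - a) * (minn m (t - a))%:R <= c_.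
  by apply: (@sum_shift_le (fun c => u c * (minn m c)%:R)) => // i; rewrite mulr_ge0.
have h2 : \sum_(a.+1 <= t < b.+1) u (t - a) <= g.
  by apply: le_trans u_sum; apply: sum_shift_le.
apply: (@le_trans _ _ (c_ * g ^+ k + g * (k%:R * g ^+ k.-1 * c_))).
  by rewrite lerD // ler_wpM2r ?mulr_ge0 ?exprn_ge0.
case: k {IH} => [|k] /=; first by rewrite !mul0r mulr0 addr0 !expr0 mulr1 !mul1r.
by rewrite -[in leRHS]natr1 exprS; apply: ler_of_eq; ring.
Qed.

(* Summation by parts; only an upper bound is needed, so no regularity of [u] enters. *)
Lemma abel_le (th : nat -> R) B N :
  (forall m, 0 <= th m) -> {homo th : a b / (a <= b)%N >-> a <= b} ->
  \sum_(1 <= m < N.+1) th (N - m)%N * (m.-1 - B)%:R * (u (m - B) - u m) <=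
  \sum_(1 <= m < N.+1) th (N - m)%N * u m * (minn m B)%:R.
Proof.
move=> th0 thmono.
(* With m + B in place of m, the weight [m.-1 - B] becomes [m.-1] and [th] is taken at a smaller
   argument. What remains is [u m] with the factor [m.-1 - (m.-1 - B)], at most [min(m, B)]. *)
have H : \sum_(1 <= m < N.+1) th (N - m)%N * (m.-1 - B)%:R * u (m - B)%N <=
         \sum_(1 <= m < N.+1) th (N - m)%N * (m.-1)%:R * u m.
  have term0 m : 0 <= th (N - m)%N * (m.-1)%:R * u m by rewrite !mulr_ge0.
  case: (leqP N B) => NB.
    rewrite big_nat_cond big1 ?sumr_ge0 // => m /andP[/andP[m1 mN] _].
    by rewrite (_ : (m.-1 - B)%N = 0%N) ?mulr0 ?mul0r //; lia.
  rewrite (big_cat_nat (n := B.+1)) /=; [|lia|lia].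
  rewrite big_nat_cond big1 ?add0r => [|m /andP[/andP[m1 mN] _]]; last first.
    by rewrite (_ : (m.-1 - B)%N = 0%N) ?mulr0 ?mul0r //; lia.
  rewrite -{1}[B]add0n -addSn big_addn subSn ?(ltnW NB) //.
  rewrite [leRHS](big_cat_nat (n := (N - B).+1)) /=; [|lia|lia].
  rewrite -[leLHS]addr0 lerD ?sumr_ge0 //; apply: ler_sum_nat => m /andP[m1 m2].
  rewrite addnK (_ : ((m + B).-1 - B = m.-1)%N); last lia.
  by rewrite !ler_wpM2r // thmono //; lia.
rewrite (eq_bigr (fun m => th (N - m)%N * (m.-1 - B)%:R * u (m - B)%N -
    th (N - m)%N * (m.-1 - B)%:R * u m)); last by move=> m _; rewrite mulrBr.
rewrite sumrB; apply: (le_trans (lerB H (lexx _))).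
rewrite -sumrB; apply: ler_sum_nat => m /andP[m1 m2].
rewrite -mulrBl -mulrBr -!mulrA ler_wpM2l // mulrC ler_wpM2l // lerBlDr -natrD ler_nat.
lia.
Qed.

Lemma sum_nat_geq B L : \sum_(0 <= c < L) (B <= c)%:R = (L - B)%:R :> R.
Proof.
elim: L => [|L IH]; first by rewrite big_geq.
rewrite big_nat_recr //= IH -natrD; congr _%:R; case: leqP; lia.
Qed.

(** By translation the inner chain is a shape starting at time 0. A shape of length B has
    [(m2 - M).-1 - B] translates strictly between [M] and [m2], and truncated subtraction covers the
    case where it does not fit. *)
Lemma sum_inner_chains k M m2 (phi : nat -> R) : (M < m2)%N -> (m2 <= n)%N ->
  \sum_(M.+1 <= f < m2) \sum_(e <- incs k f m2.-1)
     chain_weight f e * phi (last f e - f)%N =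
  \sum_(e <- incs k 0 n) chain_weight 0 e * ((m2 - M).-1 - last 0%N e)%:R * phi (last 0%N e).
Proof.
move=> Mm mn.
transitivity (\sum_(M.+1 <= f < m2) \sum_(e <- incs k 0 n)
    ((last 0%N e <= m2.-1 - f)%:R * (chain_weight 0 e * phi (last 0%N e)))).
  apply: eq_big_nat => f /andP[h1 h2].
  rewrite -sum_incs_trunc; last lia.
  rewrite -{1}[f]add0n -[X in incs _ _ X](@subnK f); last lia.
  rewrite sum_incs_addr; apply: eq_bigr => e _.
  rewrite -{1}[f]add0n chain_weight_addr; congr (_ * phi _).
  by rewrite -{1}[f]add0n (last_map (addn^~ f)) addnK.
rewrite exchange_big /=; apply: eq_bigr => e _.
rewrite -big_distrl /= [RHS]mulrAC [RHS]mulrC; congr (_ * _).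
rewrite -sum_nat_geq big_nat_rev /=.
rewrite -[M.+1]add0n big_addn; rewrite (_ : (m2 - M.+1 = (m2 - M).-1)%N); last lia.
apply: eq_big_nat => c /andP[h1 h2]; congr (nat_of_bool _)%:R.
by congr (_ <= _)%N; lia.
Qed.

(** Here [M] and [m2] bound the gap, [e] completes the inner chain started at [f], and [q] is the
    outer chain after the gap. For a fixed inner shape the sum over gap lengths is that of
    [abel_le], with [th] the total weight of the tails that fit into the remaining time; summing
    [min(m, B)] over the shapes is [sum_chain_weight_min]. *)
Lemma nested_sum_le r k M : (M <= n)%N ->
  \sum_(M.+1 <= m2 < n.+1) \sum_(q <- incs r m2 n) chain_weight m2 q *
    \sum_(M.+1 <= f < m2) \sum_(e <- incs k f m2.-1)
      chain_weight f e * (u ((f - M) + (m2 - last f e)) - u (m2 - M)) <=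
  k%:R * g ^+ (r + k.-1) *
  \sum_(1 <= m < n.+1) u m * \sum_(1 <= b < n.+1) u b * (minn m b)%:R.
Proof.
move=> Mn.
pose th c := \sum_(q <- incs r 0 c) chain_weight 0 q.
have th0 c : 0 <= th c by apply: sumr_ge0 => q _; apply: chain_weight_ge0.
have thg c : (c <= n)%N -> th c <= g ^+ r by apply: sum_chain_weight_le.
have thmono : {homo th : a b / (a <= b)%N >-> a <= b}.
  by move=> a b ab; apply: ler_sum_incs => // i; apply: chain_weight_ge0.
pose N := (n - M)%N.
have -> : \sum_(M.+1 <= m2 < n.+1) \sum_(q <- incs r m2 n) chain_weight m2 q *
    \sum_(M.+1 <= f < m2) \sum_(e <- incs k f m2.-1)
      chain_weight f e * (u ((f - M) + (m2 - last f e)) - u (m2 - M)) =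
  \sum_(e <- incs k 0 n) chain_weight 0 e *
  \sum_(1 <= m < N.+1) th (N - m)%N * (m.-1 - last 0%N e)%:R * (u (m - last 0%N e) - u m).
  rewrite -add1n big_addn subSn // !add1n.
  under [RHS]eq_bigr do rewrite big_distrr /=.
  rewrite [RHS]exchange_big /=; apply: eq_big_nat => m /andP[m1 m2].
  rewrite -big_distrl /=.
  have -> : \sum_(i <- incs r (m + M) n) chain_weight (m + M) i = th (N - m)%N.
    rewrite /th -{1}[(m + M)%N]add0n -{1}(@subnK (m + M) n); last by rewrite /N in m2; lia.
    rewrite sum_incs_addr (_ : (n - (m + M) = N - m)%N); last by rewrite /N; lia.
    by apply: eq_bigr => q _; rewrite -{1}[(m + M)%N]add0n chain_weight_addr.
  rewrite (eq_big_nat _ _ (F2 := fun f => \sum_(e <- incs k f (m + M).-1)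
      chain_weight f e * (fun B => u (m - B) - u m) (last f e - f)%N)); last first.
    move=> f /andP[f1 f2]; apply: eq_big_seq => e he.
    rewrite addnK; congr (_ * (u _ - _)).
    have := incs_last he; move: he; rewrite mem_incs => /and3P[_ hp ha].
    have : (last f e <= maxn f (m + M).-1)%N.
      have := mem_last f e; rewrite inE => /orP[/eqP -> |/(allP ha) /=]; lia.
    lia.
  rewrite (@sum_inner_chains _ _ _ (fun B => u (m - B) - u m)); [|lia|by rewrite /N in m2; lia].
  rewrite addnK big_distrr /=; apply: eq_bigr => e _; ring.
apply: (@le_trans _ _ (\sum_(e <- incs k 0 n) chain_weight 0 e *
   \sum_(1 <= m < N.+1) g ^+ r * u m * (minn m (last 0%N e))%:R)).
  apply: ler_sum => e _; apply: ler_wpM2l; first exact: chain_weight_ge0.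
  apply: (le_trans (abel_le _ _ th0 thmono)); apply: ler_sum_nat => m _.
  by rewrite !ler_wpM2r // thg // /N; lia.
apply: (@le_trans _ _ (\sum_(1 <= m < N.+1) g ^+ r * u m *
    (\sum_(e <- incs k 0 n) chain_weight 0 e * (minn m (last 0%N e - 0))%:R))).
  under eq_bigr do rewrite big_distrr /=.
  rewrite exchange_big /=; apply: ler_of_eq.
  apply: eq_bigr => m _; rewrite big_distrr /=; apply: eq_bigr => e _.
  by rewrite subn0; ring.
apply: (@le_trans _ _ (\sum_(1 <= m < N.+1) g ^+ r * u m *
    (k%:R * g ^+ k.-1 * \sum_(1 <= c < n.+1) u c * (minn m c)%:R))).
  apply: ler_sum => m _; rewrite ler_wpM2l ?mulr_ge0 ?exprn_ge0 //.
  exact: sum_chain_weight_min.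
rewrite [leRHS]big_distrr /= [leRHS](big_cat_nat (n := N.+1)) /=; [|lia|by rewrite /N; lia].
rewrite -[leLHS]addr0 lerD //; last first.
  apply: sumr_ge0 => m _; rewrite !mulr_ge0 ?exprn_ge0 //.
  by apply: sumr_ge0 => c _; rewrite mulr_ge0.
apply: ler_of_eq; apply: eq_bigr => m _.
by rewrite exprD; ring.
Qed.

End ChainWeights.

(** * Joint probabilities of two chains *)

Lemma path_ltn_leq (a : nat) r : path ltn a r -> path leq a r.
Proof. by apply: sub_path => x y; apply: ltnW. Qed.

Lemma path_ltn_last (a : nat) r : path ltn a r -> (a <= last a r)%N.
Proof.
elim: r a => //= t r IH a /andP[h /IH]; apply: leq_trans; exact: ltnW.
Qed.

Section ChainExpectations.
Variables (R : realFieldType) (G : finZmodType) (p : G -> R).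
Hypotheses (p_ge0 : forall g, 0 <= p g) (p_sum1 : \sum_g p g = 1).
Local Notation u := (fun m => pn p m 0).
Local Notation cw := (chain_weight u).

(** For nonempty [i], the indicator that the walk is at a single site at all times of [i]. *)
Definition chain_ind (s : seq G) (i : seq nat) : R :=
  \sum_x \prod_(t <- i) (pos 0 s t == x)%:R.

Lemma fdd_const t (x : G) r tl :
  fdd p t x ([seq (t', x) | t' <- r] ++ tl) = cw t r * fdd p (last t r) x tl.
Proof.
by elim: r t => [|t' r IH] t /=; rewrite ?mul1r // subrr IH mulrA.
Qed.

Lemma sum_pn_shift m (x : G) : \sum_y pn p m (y - x) = 1.
Proof.
rewrite (reindex_inj (addIr x)) /= -[RHS](sum_pn p_sum1 m).
by apply: eq_bigr => y _; rewrite addrK.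
Qed.

Lemma sum_pn_return m m' (x : G) :
  \sum_y pn p m (y - x) * pn p m' (x - y) = pn p (m + m') 0.
Proof.
rewrite (reindex_inj (addIr x)) /= pnD.
by apply: eq_bigr => y _; rewrite addrK sub0r opprD addrCA subrr addr0.
Qed.

Lemma Ex_chain n a r : path ltn 0 (a :: r) -> all (fun t => t <= n)%N (a :: r) ->
  Ex p n (fun s => chain_ind s (a :: r)) = cw a r.
Proof.
move=> hp ha.
rewrite (Ex_sum p n _ _ (fun x s => \prod_(t <- a :: r) (pos 0 s t == x)%:R)).
transitivity (\sum_x pn p a x * cw a r); last first.
  by rewrite -big_distrl /= (sum_pn p_sum1) mul1r.
apply: eq_bigr => x _.
transitivity (fdd p 0 0 [seq (t, x) | t <- a :: r]); last first.
  by have := fdd_const a x r [::]; rewrite cats0 /= mulr1 subn0 subr0 => ->.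
rewrite -(@Ex_fdd _ _ _ p_sum1 n).
- by apply: eq_Ex => s _; rewrite big_map; apply: eq_bigr => t _; rewrite subn0.
- by rewrite -map_comp map_id; apply: path_ltn_leq.
- by rewrite all_map.
Qed.

(** The increment between the two chains is summed over all its values and costs nothing, so chains
    that follow each other have no covariance. *)
Lemma Ex_chain_separated n a r b rb :
  path ltn 0 ((a :: r) ++ b :: rb) -> all (fun t => t <= n)%N ((a :: r) ++ b :: rb) ->
  Ex p n (fun s => chain_ind s (a :: r) * chain_ind s (b :: rb)) = cw a r * cw b rb.
Proof.
move=> hp ha.
rewrite (eq_Ex p (f2 := fun s => \sum_x \sum_y
  \prod_(q <- [seq (t, x) | t <- a :: r] ++ [seq (t, y) | t <- b :: rb])
     (pos 0 s (q.1 - 0) == q.2)%:R)); last first.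
  move=> s _; rewrite big_distrlr; apply: eq_bigr => x _; apply: eq_bigr => y _.
  rewrite big_cat !big_map; congr (_ * _).
    by apply: eq_bigr => t _; rewrite subn0.
  by apply: eq_bigr => t _; rewrite subn0.
rewrite (Ex_sum p n _ _ (fun x s => \sum_y \prod_(q <- _ ++ _) _)).
transitivity (\sum_x pn p a x * (cw a r * cw b rb)); last first.
  by rewrite -big_distrl /= (sum_pn p_sum1) mul1r.
apply: eq_bigr => x _.
rewrite (Ex_sum p n _ _ (fun y s => \prod_(q <- _ ++ _) _)).
transitivity (\sum_y fdd p 0 0 ([seq (t, x) | t <- a :: r] ++ [seq (t, y) | t <- b :: rb])).
  apply: eq_bigr => y _; rewrite (@Ex_fdd _ _ _ p_sum1 n) //.
    by rewrite map_cat -!map_comp !map_id; apply: path_ltn_leq.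
  by rewrite all_cat !all_map -all_cat.
transitivity (\sum_y pn p a x * (cw a r * cw b rb) * pn p (b - last a r) (y - x)).
  apply: eq_bigr => y _; rewrite [LHS]/= subn0 subr0 fdd_const /=.
  by have := fdd_const b y rb [::]; rewrite cats0 /= mulr1 => ->; ring.
by rewrite -big_distrr /= sum_pn_shift mulr1.
Qed.

(** The walk goes from the outer site x to the inner site y and later comes back. Summing over y
    glues the two moves into one return, whose duration is the gap minus the span of the inner
    chain. *)
Lemma Ex_chain_nested n a r b rb c rc :
  path ltn 0 ((a :: r) ++ (b :: rb) ++ c :: rc) ->
  all (fun t => t <= n)%N ((a :: r) ++ (b :: rb) ++ c :: rc) ->
  Ex p n (fun s => chain_ind s ((a :: r) ++ c :: rc) * chain_ind s (b :: rb)) =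
  cw a r * cw c rc * cw b rb * u ((b - last a r) + (c - last b rb))%N.
Proof.
move=> hp ha.
rewrite (eq_Ex p (f2 := fun s => \sum_x \sum_y
  \prod_(q <- [seq (t, x) | t <- a :: r] ++ [seq (t, y) | t <- b :: rb] ++
              [seq (t, x) | t <- c :: rc])
     (pos 0 s (q.1 - 0) == q.2)%:R)); last first.
  move=> s _; rewrite big_distrlr; apply: eq_bigr => x _; apply: eq_bigr => y _.
  have e (z : G) l : \prod_(t <- l) (pos 0 s t == z)%:R =
     \prod_(q <- [seq (t, z) | t <- l]) (pos 0 s (q.1 - 0) == q.2)%:R :> R.
    by rewrite big_map; apply: eq_bigr => t _; rewrite subn0.
  by rewrite !e map_cat !big_cat; exact: (etrans (mulrAC _ _ _) (esym (mulrA _ _ _))).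
rewrite (Ex_sum p n _ _ (fun x s => \sum_y \prod_(q <- _ ++ _) _)).
transitivity (\sum_x pn p a x * (cw a r * cw c rc * cw b rb *
    u ((b - last a r) + (c - last b rb))%N)); last first.
  by rewrite -big_distrl /= (sum_pn p_sum1) mul1r.
apply: eq_bigr => x _.
rewrite (Ex_sum p n _ _ (fun y s => \prod_(q <- _ ++ _) _)).
transitivity (\sum_y fdd p 0 0 ([seq (t, x) | t <- a :: r] ++ [seq (t, y) | t <- b :: rb] ++
              [seq (t, x) | t <- c :: rc])).
  apply: eq_bigr => y _; rewrite (@Ex_fdd _ _ _ p_sum1 n) //.
    by rewrite !map_cat -!map_comp !map_id; apply: path_ltn_leq.
  by rewrite !all_cat !all_map -!all_cat.
transitivity (\sum_y pn p a x * (cw a r * cw c rc * cw b rb) *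
    (pn p (b - last a r) (y - x) * pn p (c - last b rb) (x - y))).
  apply: eq_bigr => y _; rewrite [LHS]/= subn0 subr0 fdd_const /= fdd_const /=.
  by have := fdd_const c x rc [::]; rewrite cats0 /= mulr1 => ->; ring.
by rewrite -big_distrr /= sum_pn_return; ring.
Qed.

End ChainExpectations.

(** * Covariances when one chain lies in a gap of the other *)

Lemma has_sum (R : pzSemiRingType) (I : eqType) (r : seq I) (P : pred I) : uniq r ->
  {in r &, forall a b, P a -> P b -> a = b} ->
  (has P r)%:R = \sum_(s <- r) (P s)%:R :> R.
Proof.
elim: r => [|a r IH] /=; first by rewrite big_nil.
move=> /andP[ar ur] h; rewrite big_cons.
case: (boolP (P a)) => Pa /=.
  rewrite big_seq big1 ?addr0 // => b br.
  case: (boolP (P b)) => // Pb.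
  by move: ar; rewrite (h a b) ?inE ?eqxx ?br ?orbT.
rewrite add0r; apply: IH => // b c hb hc; apply: h; by rewrite inE ?hb ?hc orbT.
Qed.

Lemma path_ltn_le_last (a : nat) r : path ltn a r -> all (fun t => t <= last a r)%N r.
Proof.
elim: r a => //= t r IH a /andP[h hp]; rewrite (IH _ hp) andbT.
exact: path_ltn_last.
Qed.

Section CovarianceSplit.
Variables (R : realFieldType) (G : finZmodType) (p : G -> R).
Hypotheses (p_ge0 : forall g, 0 <= p g) (p_sum1 : \sum_g p g = 1).
Local Notation u := (fun m => pn p m 0).
Local Notation cw := (chain_weight u).
Variable n : nat.

Definition wt (i : seq nat) : R := if i is a :: r then cw a r else 1.

Lemma wt_ge0 i : 0 <= wt i.
Proof. by case: i => [|a r] //=; apply: chain_weight_ge0 => m; apply: pn_ge0. Qed.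

Definition joint (i j : seq nat) : R :=
  Ex p n (fun s => chain_ind R s i * chain_ind R s j).

(* [s] ranges over [1, ..., size i]: the default [n.+1] makes the times after the
   last element of [i] a gap as well. *)
Definition in_gap (i j : seq nat) (s : nat) : bool :=
  (nth 0%N i s.-1 < head 0%N j)%N && (last 0%N j < nth n.+1 i s)%N.

Definition gapped (i j : seq nat) : bool := has (in_gap i j) (iota 1 (size i)).

Lemma sum_in_gap (M c k : nat) (F : seq nat -> R) : (c <= n)%N ->
  \sum_(j <- incs k.+1 0 n) ((M < head 0%N j)%N && (last 0%N j < c)%N)%:R * F j =
  \sum_(j <- incs k.+1 M c.-1) F j.
Proof.
move=> cn.
rewrite (eq_bigr (fun j => if ((M < head 0%N j)%N && (last 0%N j < c)%N) then F j else 0)); last first.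
  by move=> j _; case: ifP => _; rewrite ?mul1r ?mul0r.
rewrite -big_mkcond -big_filter; apply: perm_big; apply: uniq_perm.
- exact/filter_uniq/incs_uniq.
- exact: incs_uniq.
move=> j; rewrite mem_filter !mem_incs.
case: j => [|b rb]; first by rewrite andbF.
apply/andP/and3P => [[/andP[h1 h2] /and3P[h3 h4 h5]]|[h3 h4 h5]].
  split => //.
    by move: h4 h1 => /= /andP[_ ->] ->.
  apply/allP => t ht; move: (path_ltn_le_last h4) => /allP /(_ t ht) /=.
  by move: h2 => /=; lia.
move: h4 => /= /andP[Mb hp].
have hl : (@last nat b rb <= c.-1)%N by apply: (allP h5); exact: (mem_last b rb).
have hc : (@last nat b rb < c)%N by move: (path_ltn_last hp) Mb hl; lia.
have ha : all (fun t => t <= n)%N (b :: rb) by apply/allP => t /(allP h5) /=; lia.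
rewrite Mb hc; split=> //; apply/and3P; split => //.
  by rewrite /= hp andbT; lia.
Qed.

Variable g : R.
Hypothesis u_sum : \sum_(1 <= m < n.+1) u m <= g.

Let g_ge0 : 0 <= g.
Proof. by apply: le_trans u_sum; apply: sumr_ge0 => m _; apply: pn_ge0. Qed.

Definition overlap : R :=
  \sum_(1 <= m < n.+1) u m * \sum_(1 <= b < n.+1) u b * (minn m b)%:R.

Lemma overlap_ge0 : 0 <= overlap.
Proof.
apply: sumr_ge0 => m _; rewrite mulr_ge0 ?pn_ge0 //.
by apply: sumr_ge0 => b _; rewrite mulr_ge0 ?pn_ge0.
Qed.

(** The outer chain [i1 ++ i2] is cut at the gap. The first time of [i1] is free and each of its [s]
    gaps sums to at most [g], which gives [n%:R * g ^+ s]; the remaining sum is that of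
    [nested_sum_le]. *)
Lemma nested_pairs_le s r k :
  \sum_(i1 <- incs s.+1 0 n) \sum_(i2 <- incs r.+1 (last 0%N i1) n)
    \sum_(j <- incs k.+1 0 n)
     ((last 0 i1 < head 0 j)%N && (last 0 j < head n.+1 i2)%N)%:R *
       (joint (i1 ++ i2) j - wt (i1 ++ i2) * wt j) <=
  n%:R * g ^+ s * (k%:R * g ^+ (r + k.-1) * overlap).
Proof.
rewrite sum_incsS.
apply: (@le_trans _ _ (\sum_(1 <= a < n.+1) \sum_(r1 <- incs s a n) cw a r1 *
   (k%:R * g ^+ (r + k.-1) * overlap))); last first.
  under eq_bigr do rewrite -big_distrl /=.
  rewrite -big_distrl /= ler_wpM2r ?mulr_ge0 ?exprn_ge0 ?overlap_ge0 //.
  apply: (@le_trans _ _ (\sum_(1 <= a < n.+1) g ^+ s)).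
    apply: ler_sum => a _; apply: (@sum_chain_weight_le _ _ _ n) => //.
    by move=> m; apply: pn_ge0.
  by rewrite big_const_nat iter_addr addr0 subn1 /= mulr_natl.
apply: ler_sum_nat => a /andP[a1 an]; rewrite big_seq [leRHS]big_seq.
apply: ler_sum => r1 hr1; set M := last a r1.
have Mn : (M <= n)%N.
  move: hr1; rewrite mem_incs /M => /and3P[_ _ /allP h].
  by have := mem_last a r1; rewrite inE => /orP[/eqP ->|/h //]; lia.
have hp1 : path ltn 0 (a :: r1).
  by move: hr1; rewrite mem_incs /= => /and3P[_ -> _]; rewrite a1.
have ha1 : all (fun t => t <= n)%N (a :: r1).
  by move: hr1; rewrite mem_incs /= => /and3P[_ _ ->]; rewrite -ltnS an.
have := @nested_sum_le _ _ (fun m => pn_ge0 p_ge0 m 0) n g u_sum r k M Mn.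
rewrite -/overlap => /(ler_wpM2l (@chain_weight_ge0 _ _ (fun m => pn_ge0 p_ge0 m 0) a r1)).
apply: le_trans; rewrite sum_incsS big_distrr /=; apply: ler_of_eq.
apply: eq_big_nat => c /andP[c1 cn]; rewrite big_distrr /=.
apply: eq_big_seq => rc hrc.
rewrite sum_in_gap // sum_incsS mulrA !big_distrr /=.
have -> : c.-1.+1 = c by lia.
apply: eq_big_nat => b /andP[b1 bc].
rewrite big_distrr /=; apply: eq_big_seq => rb hrb.
have hp : path ltn 0 ((a :: r1) ++ (b :: rb) ++ c :: rc).
  rewrite cat_path hp1 /= -/M b1 /= cat_path /=.
  move: hrb hrc; rewrite !mem_incs => /and3P[_ -> hall] /and3P[_ -> _].
  rewrite andbT /=; have := mem_last b rb; rewrite inE => /orP[/eqP -> //|/(allP hall) /=].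
  lia.
have ha : all (fun t => t <= n)%N ((a :: r1) ++ (b :: rb) ++ c :: rc).
  rewrite all_cat ha1 /= all_cat /=.
  move: hrb hrc; rewrite !mem_incs => /and3P[_ _ hall] /and3P[_ _ ->].
  rewrite andbT; apply/and3P; split; [lia| |lia].
  apply/allP => t /(allP hall) /=; lia.
have := Ex_chain_nested p_sum1 hp ha; rewrite /joint /= => ->.
by rewrite chain_weight_cat -/M; ring.
Qed.

Lemma in_gap_sum_le (k s : nat) : (0 < s <= k.+2)%N ->
  \sum_(i <- incs k.+2 0 n) \sum_(j <- incs k.+2 0 n)
    (in_gap i j s)%:R * (joint i j - wt i * wt j) <=
  n%:R * (k.+1%:R * g ^+ (2 * k) * overlap).
Proof.
move=> /andP[s0 sk].
have eqs : (k.+2 = s.-1.+1 + (k.+2 - s))%N by lia.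
have E : incs k.+2 0 n = incs (s.-1.+1 + (k.+2 - s)) 0 n by rewrite -eqs.
rewrite {1}E sum_incs_cat.
rewrite (_ : \sum_(i1 <- _) _ = \sum_(i1 <- incs s.-1.+1 0 n)
    \sum_(i2 <- incs (k.+2 - s) (last 0%N i1) n) \sum_(j <- incs k.+2 0 n)
     ((last 0 i1 < head 0 j)%N && (last 0 j < head n.+1 i2)%N)%:R *
       (joint (i1 ++ i2) j - wt (i1 ++ i2) * wt j)); last first.
  apply: eq_big_seq => i1.
  rewrite mem_incs => /and3P[/eqP hs _ _]; apply: eq_bigr => i2 _; apply: eq_bigr => j _.
  congr (_ * _); congr (nat_of_bool _)%:R; congr (_ && _).
    by rewrite nth_cat hs ltnSn -nth_last hs.
  by rewrite nth_cat hs prednK // ltnn subnn nth0.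
(* In the gap after the last time of [i] the chain [j] starts when [i] is over, and the covariance
   is zero. *)
case: (ltnP s k.+2) => hsk; last first.
  rewrite big_seq big1 => [|i1]; first by rewrite !mulr_ge0 ?exprn_ge0 ?overlap_ge0.
  rewrite mem_incs => /and3P[/eqP hs hp ha].
  rewrite (_ : (k.+2 - s)%N = 0%N) ?sum_incs0; last lia.
  rewrite big_seq big1 // => j; rewrite mem_incs => /and3P[/eqP hs' hp' ha'].
  case: ltnP => h /=; rewrite ?mul0r //; case: ltnP => h2; rewrite ?mul0r // mul1r cats0.
  case: i1 j hs hp ha hs' hp' ha' h h2 => [|a r1] [|b rb] //= _ /andP[a0 hp] /andP[an ha]
    _ /andP[b0 hp'] /andP[bn ha'] h h2.
  rewrite /joint (Ex_chain_separated p_sum1) ?subrr //=.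
    by rewrite a0 cat_path hp /= h.
  by rewrite an all_cat ha /= bn.
have -> : (k.+2 - s = (k.+1 - s).+1)%N by lia.
apply: (le_trans (nested_pairs_le _ _ _)).
apply: ler_of_eq.
rewrite (_ : (2 * k = s.-1 + (k.+1 - s + k))%N); last lia.
by rewrite [in RHS]exprD /=; ring.
Qed.

Lemma gapped_sum_le k :
  \sum_(i <- incs k.+2 0 n) \sum_(j <- incs k.+2 0 n)
    (gapped i j)%:R * (joint i j - wt i * wt j) <=
  k.+2%:R * (n%:R * (k.+1%:R * g ^+ (2 * k) * overlap)).
Proof.
rewrite (_ : \sum_(i <- _) _ = \sum_(s <- iota 1 k.+2) \sum_(i <- incs k.+2 0 n)
    \sum_(j <- incs k.+2 0 n) (in_gap i j s)%:R * (joint i j - wt i * wt j)).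
  apply: (@le_trans _ _ (\sum_(s <- iota 1 k.+2) n%:R * (k.+1%:R * g ^+ (2 * k) * overlap))).
    rewrite big_seq [leRHS]big_seq; apply: ler_sum => s; rewrite mem_iota => hs.
    by apply: in_gap_sum_le; lia.
  by rewrite big_const_seq count_predT size_iota iter_addr addr0 [leRHS]mulr_natl.
rewrite [RHS]exchange_big /=; apply: eq_big_seq => i hi.
rewrite [RHS]exchange_big /=; apply: eq_big_seq => j hj.
rewrite -big_distrl /=; congr (_ * _); rewrite /gapped.
move: hi; rewrite mem_incs => /and3P[/eqP hs hp _]; rewrite hs.
apply: has_sum; first exact: iota_uniq.
have hj1 : (head 0 j <= last 0 j)%N.
  move: hj; rewrite mem_incs; case: j => [//|b rb] /and3P[_ /= /andP[_ hpb] _].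
  exact: path_ltn_last.
have hsort : sorted ltn i by apply: path_sorted hp.
(* Two different gaps of [i] are separated by an element of [i], so [j] lies in at most one of them
   and [gapped] is a sum over gaps. *)
have key a b : (0 < a)%N -> (b <= k.+2)%N -> (a < b)%N -> in_gap i j a -> in_gap i j b -> False.
  move=> ha hb ab /andP[_ h1] /andP[h2 _].
  have : (nth 0%N i a <= nth 0%N i b.-1)%N.
    case: (eqVneq a b.-1) => [->//|nab]; apply: ltnW.
    by apply: (@sorted_ltn_nth _ ltn ltn_trans 0%N i) => //; rewrite ?inE /= ?hs; lia.
  rewrite (set_nth_default 0%N) in h1; last by rewrite hs; lia.
  by move: h1 h2 hj1; lia.
move=> a b; rewrite !mem_iota => ha hb Pa Pb.
case: (ltngtP a b) => // ab; exfalso.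
  by apply: (key a b) => //; lia.
by apply: (key b a) => //; lia.
Qed.

Definition chain_count k (s : seq G) : R := \sum_(i <- incs k 0 n) chain_ind R s i.

(** The factor 2 counts which chain lies in a gap of the other; the two cases exclude each other
    because the outer chain starts strictly earlier. For all other pairs the product of the means is
    simply dropped. *)
Lemma chain_count_var_le k :
  Ex p n (fun s => chain_count k.+2 s ^+ 2) - Ex p n (chain_count k.+2) ^+ 2 <=
  2 * (k.+2%:R * (n%:R * (k.+1%:R * g ^+ (2 * k) * overlap))) +
  \sum_(i <- incs k.+2 0 n) \sum_(j <- incs k.+2 0 n)
     (~~ gapped i j && ~~ gapped j i)%:R * joint i j.
Proof.
have E1 : Ex p n (chain_count k.+2) = \sum_(i <- incs k.+2 0 n) wt i.
  rewrite (Ex_sum p n _ _ (fun i s => chain_ind R s i)).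
  apply: eq_big_seq => i; rewrite mem_incs; case: i => [//|a r] /and3P[_ h1 h2].
  by rewrite (Ex_chain p_sum1).
have E2 : Ex p n (fun s => chain_count k.+2 s ^+ 2) =
   \sum_(i <- incs k.+2 0 n) \sum_(j <- incs k.+2 0 n) joint i j.
  rewrite (eq_Ex p (f2 := fun s => \sum_(i <- incs k.+2 0 n) \sum_(j <- incs k.+2 0 n)
      (chain_ind R s i * chain_ind R s j))); last by move=> s _; rewrite expr2 big_distrlr.
  rewrite (Ex_sum p n _ _ (fun i s => \sum_(j <- incs k.+2 0 n) _)); apply: eq_bigr => i _.
  exact: (Ex_sum p n _ _ (fun j s => _)).
rewrite E1 E2 [X in _ - X]expr2 big_distrlr /= -sumrB.
rewrite (eq_bigr (fun i => \sum_(j <- incs k.+2 0 n) (joint i j - wt i * wt j))); last first.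
  by move=> i _; rewrite sumrB.
apply: (@le_trans _ _ (\sum_(i <- incs k.+2 0 n) \sum_(j <- incs k.+2 0 n)
   ((gapped i j)%:R * (joint i j - wt i * wt j) +
    (gapped j i)%:R * (joint j i - wt j * wt i) +
    (~~ gapped i j && ~~ gapped j i)%:R * joint i j))).
  rewrite big_seq [leRHS]big_seq; apply: ler_sum => i hi.
  rewrite big_seq [leRHS]big_seq; apply: ler_sum => j hj.
  have jC : joint j i = joint i j by apply: eq_Ex => s _; rewrite mulrC.
  have excl a b : a \in incs k.+2 0 n -> gapped a b -> (head 0 a < head 0 b)%N.
    rewrite mem_incs => /and3P[/eqP sa pa _] /hasP[s]; rewrite mem_iota sa => hs /andP[h _].
    apply: leq_ltn_trans h; rewrite -nth0; case: (eqVneq s.-1 0%N) => [->//|hs0].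
    have sorta := path_sorted pa.
    by apply: ltnW; apply: (@sorted_ltn_nth _ ltn ltn_trans 0%N a) => //; rewrite ?inE /= ?sa; lia.
  case: (boolP (gapped i j)) => h1; case: (boolP (gapped j i)) => h2 /=.
  - by move: (excl _ _ hi h1) (excl _ _ hj h2); lia.
  - by rewrite !mul0r !addr0 mul1r.
  - by rewrite !mul0r addr0 add0r mul1r jC (mulrC (wt j)).
  - by rewrite !mul0r !add0r mul1r gerBl mulr_ge0 ?wt_ge0.
rewrite (eq_bigr (fun i => \sum_(j <- incs k.+2 0 n) (gapped i j)%:R * (joint i j - wt i * wt j) +
    \sum_(j <- incs k.+2 0 n) (gapped j i)%:R * (joint j i - wt j * wt i) +
    \sum_(j <- incs k.+2 0 n) (~~ gapped i j && ~~ gapped j i)%:R * joint i j)); last first.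
  by move=> i _; rewrite !big_split.
rewrite !big_split /= lerD2r [X in _ + X]exchange_big /= mulr2n mulrDl !mul1r.
by rewrite lerD // gapped_sum_le.
Qed.

End CovarianceSplit.

(** * Interleaved chains *)

Section Embeddings.
Variables (R : realFieldType) (G : eqType) (n : nat) (f : nat -> G).

Definition visits (x : G) : R := \sum_(1 <= t < n.+1) (f t == x)%:R.

Lemma visits_ge0 x : 0 <= visits x.
Proof. by apply: sumr_ge0 => t _; rewrite ler0n. Qed.

(* The number of weakly increasing time lists in [a, n] along which [f] visits [xs]. *)
Fixpoint emb (a : nat) (xs : seq G) : R :=
  if xs is x :: xs' then \sum_(a <= t < n.+1) (f t == x)%:R * emb t xs' else 1.

Lemma emb_ge0 a xs : 0 <= emb a xs.
Proof.
elim: xs a => [|x xs IH] a //=; apply: sumr_ge0 => t _.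
by rewrite mulr_ge0 ?ler0n.
Qed.

Fixpoint insertions (T : Type) (y : T) (xs : seq T) : seq (seq T) :=
  if xs is x :: xs' then (y :: xs) :: [seq x :: zs | zs <- insertions y xs']
  else [:: [:: y]].

(** An additional visit to [y] is placed in front if its time is at most the first time of the list,
    and is passed on to the rest if it is at least that time. Ties are counted twice, which an upper
    bound allows. *)
Lemma emb_mul_visits y xs a :
  emb a xs * \sum_(a <= t < n.+1) (f t == y)%:R <=
  \sum_(zs <- insertions y xs) emb a zs.
Proof.
elim: xs a => [|x xs IH] a /=.
  by rewrite big_seq1 mul1r /=; under [leRHS]eq_bigr do rewrite mulr1.
rewrite big_cons big_map /= big_distrl /=.
apply: (@le_trans _ _ (\sum_(a <= t < n.+1)
   ((f t == x)%:R * emb t xs * (\sum_(a <= r < n.+1) (r <= t)%:R * (f r == y)%:R) +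
    (f t == x)%:R * (emb t xs * \sum_(t <= r < n.+1) (f r == y)%:R)))).
  apply: ler_sum_nat => t /andP[at_ tn]; rewrite mulrA -mulrDr.
  apply: ler_wpM2l; first by rewrite mulr_ge0 ?ler0n ?emb_ge0.
  rewrite (big_cat_nat (n := t)) /=; [|lia|lia].
  rewrite [X in _ <= X + _](big_cat_nat (n := t)) /=; [|lia|lia].
  rewrite -addrA lerD //.
    apply: ler_of_eq; apply: eq_big_nat => r /andP[_ rt].
    by rewrite (ltnW rt) mul1r.
  by rewrite lerDr; apply: sumr_ge0 => r _; rewrite mulr_ge0 ?ler0n.
rewrite big_split /= lerD //.
  under eq_bigr do rewrite big_distrr /=.
  rewrite exchange_big /=; apply: ler_of_eq.
  apply: eq_big_nat => r /andP[ar rn].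
  rewrite [in LHS](big_cat_nat (n := r)) /=; [|lia|lia].
  rewrite [X in X + _](_ : _ = 0) ?add0r; last first.
    rewrite big_nat_cond big1 // => t /andP[/andP[_ tr] _].
    by rewrite leqNgt tr mul0r mulr0.
  rewrite big_distrr /=; apply: eq_big_nat => t /andP[rt _].
  by rewrite rt mul1r; ring.
under [leRHS]eq_bigr do rewrite /=.
rewrite [leRHS]exchange_big /=; apply: ler_sum_nat => t _.
by rewrite -big_distrr /= ler_wpM2l ?ler0n.
Qed.

Definition at_all (x : G) (i : seq nat) : R := \prod_(t <- i) (f t == x)%:R.

Lemma at_all_cons x t i : at_all x (t :: i) = (f t == x)%:R * at_all x i.
Proof. by rewrite /at_all big_cons. Qed.

Lemma at_all_ge0 x i : 0 <= at_all x i.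
Proof. by apply: prodr_ge0 => t _; rewrite ler0n. Qed.

Lemma sum_window_le (F : nat -> R) a : (forall t, 0 <= F t) ->
  \sum_(a.+1 <= t < n.+1) F t <= \sum_(1 <= t < n.+1) F t.
Proof.
move=> F0; case: (leqP a n) => an; last by rewrite big_geq ?sumr_ge0 //; lia.
rewrite [leRHS](big_cat_nat (n := a.+1)) //= lerDr; exact: sumr_ge0.
Qed.

Lemma sum_at_all_le x k a : \sum_(i <- incs k a n) at_all x i <= visits x ^+ k.
Proof.
elim: k a => [|k IH] a; first by rewrite sum_incs0 /at_all big_nil expr0.
rewrite sum_incsS exprS.
apply: (@le_trans _ _ (\sum_(a.+1 <= t < n.+1) (f t == x)%:R * visits x ^+ k)).
  apply: ler_sum => t _; under eq_bigr do rewrite at_all_cons.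
  by rewrite -big_distrr /= ler_wpM2l ?ler0n.
rewrite -big_distrl /= ler_wpM2r ?exprn_ge0 ?visits_ge0 //.
by apply: sum_window_le => t; rewrite ler0n.
Qed.

Lemma sum_nat_pick_le1 t r : \sum_(r <= t' < n.+1) (t' == t)%:R <= 1 :> R.
Proof.
case: (boolP (t \in index_iota r n.+1)) => h.
  by rewrite (bigD1_seq t) ?iota_uniq //= eqxx big1 ?addr0 // => t' /negbTE ->.
rewrite big_seq big1 ?ler01 // => t' ht; case: eqP => // e.
by move: h; rewrite -e ht.
Qed.

Lemma pick_one_le x k a t1 : \sum_(i <- incs k.+1 a n) (t1 \in i)%:R * at_all x i <=
  k.+1%:R * (f t1 == x)%:R * visits x ^+ k.
Proof.
elim: k a => [|k IH] a.
  rewrite sum_incsS expr0 mulr1 mul1r.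
  apply: (@le_trans _ _ (\sum_(a.+1 <= t < n.+1) (t == t1)%:R * (f t1 == x)%:R)).
    apply: ler_sum => t _; rewrite sum_incs0 at_all_cons /at_all big_nil mulr1 inE eq_sym.
    by case: eqP => [->|]; rewrite ?mul1r ?mul0r.
  by rewrite -big_distrl /= ler_piMl ?ler0n ?sum_nat_pick_le1.
rewrite sum_incsS.
apply: (@le_trans _ _ (\sum_(a.+1 <= t < n.+1)
   ((t == t1)%:R * ((f t1 == x)%:R * visits x ^+ k.+1) +
    (f t == x)%:R * (k.+1%:R * (f t1 == x)%:R * visits x ^+ k)))).
  apply: ler_sum => t _.
  apply: (@le_trans _ _ (\sum_(l <- incs k.+1 t n)
     ((t == t1)%:R * (f t1 == x)%:R * at_all x l +
      (f t == x)%:R * ((t1 \in l)%:R * at_all x l)))).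
    apply: ler_sum => l _; rewrite at_all_cons inE eq_sym.
    have := at_all_ge0 x l; case: eqP => [->|_] /= h.
      rewrite !mul1r lerDl !mulr_ge0 ?ler0n //.
    by rewrite !mul0r add0r mulrCA.
  rewrite big_split /= -!big_distrr /= lerD //.
    by rewrite -mulrA !ler_wpM2l ?ler0n ?sum_at_all_le.
  by rewrite ler_wpM2l ?ler0n.
rewrite big_split /= -!big_distrl /=.
have V0 := visits_ge0 x.
apply: (@le_trans _ _ ((f t1 == x)%:R * visits x ^+ k.+1 +
    visits x * (k.+1%:R * (f t1 == x)%:R * visits x ^+ k))).
  rewrite lerD //.
    by rewrite ler_piMl ?mulr_ge0 ?ler0n ?exprn_ge0 ?sum_nat_pick_le1.
  rewrite ler_wpM2r ?mulr_ge0 ?ler0n ?exprn_ge0 //.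
  by apply: sum_window_le => t; rewrite ler0n.
by rewrite -[in leRHS]natr1 exprS; apply: ler_of_eq; ring.
Qed.

(** The two prescribed times occupy one of [k.+2 * k.+1] ordered pairs of positions, and each of the
    [k] other times is some visit to [x]. *)
Lemma pick_two_le x k a t1 t2 : t1 != t2 ->
  \sum_(i <- incs k.+2 a n) (t1 \in i)%:R * (t2 \in i)%:R * at_all x i <=
  (k.+2 * k.+1)%:R * ((f t1 == x)%:R * (f t2 == x)%:R) * visits x ^+ k.
Proof.
move=> t12.
have V0 := visits_ge0 x.
pose A := (f t1 == x)%:R * (f t2 == x)%:R : R.
have A0 : 0 <= A by rewrite mulr_ge0 ?ler0n.
(* The first time of the chain is [t1], or [t2], or neither. The first two cases leave one
   prescribed time for the tail, the third is the recursion. *)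
have step m b : \sum_(i <- incs m.+2 b n) (t1 \in i)%:R * (t2 \in i)%:R * at_all x i <=
   2 * (m.+1%:R * A * visits x ^+ m) + \sum_(b.+1 <= t < n.+1) (f t == x)%:R *
   \sum_(i <- incs m.+1 t n) (t1 \in i)%:R * (t2 \in i)%:R * at_all x i.
  rewrite sum_incsS.
  apply: (@le_trans _ _ (\sum_(b.+1 <= t < n.+1) ((t == t1)%:R * (m.+1%:R * A * visits x ^+ m)
     + (t == t2)%:R * (m.+1%:R * A * visits x ^+ m) +
     (f t == x)%:R *
   \sum_(i <- incs m.+1 t n) (t1 \in i)%:R * (t2 \in i)%:R * at_all x i))).
    apply: ler_sum => t _.
    apply: (@le_trans _ _ (\sum_(l <- incs m.+1 t n)
      ((t == t1)%:R * (f t1 == x)%:R * ((t2 \in l)%:R * at_all x l) +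
       (t == t2)%:R * (f t2 == x)%:R * ((t1 \in l)%:R * at_all x l) +
       (f t == x)%:R * ((t1 \in l)%:R * (t2 \in l)%:R * at_all x l)))).
      apply: ler_sum => l _; rewrite at_all_cons !inE (eq_sym t1) (eq_sym t2).
      have h := at_all_ge0 x l; case: (eqVneq t t1) => [e1|n1] /=.
        rewrite e1 (negbTE t12) /= !mul0r addr0 !mul1r.
        by rewrite mulrCA lerDl !mulr_ge0 ?ler0n.
      case: (eqVneq t t2) => [e2|n2] /=.
        by rewrite e2 !mul0r add0r mulr1 !mul1r mulrCA lerDl !mulr_ge0 ?ler0n.
      by rewrite !mul0r !add0r mulrCA.
    rewrite !big_split /= -!big_distrr /= lerD // lerD //.
      apply: le_trans (ler_wpM2l _ (pick_one_le x m t t2)) _; first by rewrite mulr_ge0 ?ler0n.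
      by rewrite /A; apply: ler_of_eq; ring.
    apply: le_trans (ler_wpM2l _ (pick_one_le x m t t1)) _; first by rewrite mulr_ge0 ?ler0n.
    by rewrite /A; apply: ler_of_eq; ring.
  rewrite !big_split /= -!big_distrl /= lerD2r mulr2n mulrDl !mul1r.
  have C0 : 0 <= m.+1%:R * A * visits x ^+ m by rewrite !mulr_ge0 ?ler0n ?exprn_ge0.
  by rewrite lerD // ler_piMl ?sum_nat_pick_le1.
elim: k a => [|k IH] a.
  apply: (le_trans (step _ _)); rewrite -/A expr0 !mulr1.
  rewrite [X in _ + X]big1 ?addr0 ?mul1r // => t _.
  rewrite sum_incsS big1 ?mulr0 // => t' _; rewrite sum_incs0 !inE.
  case: eqP => [<-|]; last by rewrite !mul0r.
  by rewrite eq_sym (negbTE t12) mulr0 mul0r.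
apply: (le_trans (step _ _)).
apply: (@le_trans _ _ (2 * (k.+2%:R * A * visits x ^+ k.+1) +
   visits x * ((k.+2 * k.+1)%:R * A * visits x ^+ k))).
  rewrite lerD2l.
  apply: (@le_trans _ _ (\sum_(a.+1 <= t < n.+1) (f t == x)%:R * ((k.+2 * k.+1)%:R * A * visits x ^+ k))).
    by apply: ler_sum => t _; rewrite ler_wpM2l ?ler0n.
  rewrite -big_distrl /= ler_wpM2r ?mulr_ge0 ?ler0n ?exprn_ge0 //.
  by apply: sum_window_le => t; rewrite ler0n.
rewrite exprS (_ : (k.+3 * k.+2 = 2 * k.+2 + k.+2 * k.+1)%N); last lia.
by rewrite natrD natrM -/A; apply: ler_of_eq; ring.
Qed.

End Embeddings.

(** The chains may share times, so the order between them is weak and distinctness is asked only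
    within each chain. *)
Definition interleaved (i j : seq nat) (t1 t2 t3 t4 : nat) : bool :=
  [&& t1 \in i, t3 \in i, t1 != t3, t2 \in j, t4 \in j & t2 != t4] &&
  [&& t1 <= t2, t2 <= t3 & t3 <= t4]%N.

(* The first index of [i] lying at or beyond the head of [j] locates the interleaving. *)
Lemma interleaved_or_gapped n k i j : i \in incs k.+2 0 n -> j \in incs k.+2 0 n ->
  (head 0 i <= head 0 j)%N -> ~~ gapped n i j ->
  exists t1 t2 t3 t4, interleaved i j t1 t2 t3 t4 || interleaved j i t1 t2 t3 t4.
Proof.
rewrite !mem_incs => /and3P[/eqP si pi ai] /and3P[/eqP sj pj aj] hij ng.
have sorti := path_sorted pi; have sortj := path_sorted pj.
have li a b : (a < b < k.+2)%N -> (nth 0%N i a < nth 0%N i b)%N.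
  by move=> h; apply: (@sorted_ltn_nth _ ltn ltn_trans 0%N i) => //; rewrite ?inE /= ?si; lia.
have lj a b : (a < b < k.+2)%N -> (nth 0%N j a < nth 0%N j b)%N.
  by move=> h; apply: (@sorted_ltn_nth _ ltn ltn_trans 0%N j) => //; rewrite ?inE /= ?sj; lia.
have mi a : (a < k.+2)%N -> nth 0%N i a \in i by move=> h; rewrite mem_nth ?si.
have mj a : (a < k.+2)%N -> nth 0%N j a \in j by move=> h; rewrite mem_nth ?sj.
rewrite -!nth0 in hij.
pose P := fun t => (nth 0%N j 0 <= t)%N.
have hfind : (find P i <= k.+2)%N by rewrite -si find_size.
have before a : (a < find P i)%N -> (nth 0%N i a < nth 0%N j 0)%N.
  by move=> h; rewrite ltnNge; apply/negP => h'; have := before_find 0%N h; rewrite /P h'.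
case: (posnP (find P i)) => [f0|fpos].
  have hP : P (nth 0%N i 0).
    by rewrite -[X in nth _ _ X]f0; apply: nth_find; rewrite has_find f0 si.
  have e : nth 0%N i 0 = nth 0%N j 0 by apply/eqP; rewrite eqn_leq hij.
  have l1 := li 0%N 1%N isT; have l2 := lj 0%N 1%N isT.
  case: (leqP (nth 0%N i 1) (nth 0%N j 1)) => h.
    exists (nth 0%N i 0), (nth 0%N j 0), (nth 0%N i 1), (nth 0%N j 1).
    by apply/orP; left; rewrite /interleaved !mi ?mj //=; lia.
  exists (nth 0%N j 0), (nth 0%N i 0), (nth 0%N j 1), (nth 0%N i 1).
  by apply/orP; right; rewrite /interleaved !mi ?mj //=; lia.
pose s := find P i.
have hb : (nth 0%N i s.-1 < nth 0%N j 0)%N by apply: before; rewrite /s; lia.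
have ngs : ~~ in_gap n i j s.
  apply: contra ng => h; apply/hasP; exists s => //; rewrite mem_iota si /s; lia.
move: ngs; rewrite /in_gap -(nth0 0%N j) hb /= -leqNgt => hl.
have hlast : last 0%N j = nth 0%N j k.+1 by rewrite -nth_last sj.
have hn : (last 0%N j <= n)%N.
  by rewrite hlast; apply: (allP aj); apply: mj.
have sk : (s < k.+2)%N.
  rewrite ltnNge; apply/negP => h; move: hl; rewrite nth_default ?si //; lia.
rewrite (set_nth_default 0%N) ?si // hlast in hl.
have hs : (nth 0%N j 0 <= nth 0%N i s)%N.
  by apply: (@nth_find _ 0%N P); rewrite has_find si.
exists (nth 0%N i s.-1), (nth 0%N j 0), (nth 0%N i s), (nth 0%N j k.+1).
have l1 : (nth 0%N i s.-1 < nth 0%N i s)%N by apply: li; rewrite /s in fpos sk *; lia.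
have l2 := lj 0%N k.+1 (ltnSn _).
apply/orP; left; rewrite /interleaved !mi ?mj //=; last by lia.
by lia.
Qed.

Lemma crossing_pair n k i j : i \in incs k.+2 0 n -> j \in incs k.+2 0 n ->
  ~~ gapped n i j -> ~~ gapped n j i ->
  exists t1 t2 t3 t4, interleaved i j t1 t2 t3 t4 || interleaved j i t1 t2 t3 t4.
Proof.
move=> hi hj g1 g2; case: (leqP (head 0%N i) (head 0%N j)) => h.
  exact: (interleaved_or_gapped hi hj).
have [t1 [t2 [t3 [t4 h']]]] := interleaved_or_gapped hj hi (ltnW h) g2.
by exists t1, t2, t3, t4; rewrite orbC.
Qed.

(** * Words of two sites and their weights *)

Section Words.
Variables (R : realFieldType) (tr : bool -> bool -> R) (g : R).
Hypotheses (tr_ge0 : forall b c, 0 <= tr b c) (tr_le : forall b c, tr b c <= g).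

Fixpoint word_weight (b : bool) (w : seq bool) : R :=
  if w is c :: w' then tr b c * word_weight c w' else 1.

Fixpoint alternating (m : nat) (c : bool) : seq bool :=
  if m is m'.+1 then c :: alternating m' (~~ c) else [::].

Fixpoint alternating_weight (m : nat) (b : bool) : R :=
  if m is m'.+1 then tr b (~~ b) * alternating_weight m' (~~ b) else 1.

Lemma word_weight_ge0 b w : 0 <= word_weight b w.
Proof. by elim: w b => //= c w IH b; rewrite mulr_ge0. Qed.

Lemma size_alternating m c : size (alternating m c) = m.
Proof. by elim: m c => //= m IH c; rewrite IH. Qed.

(** Read from the left, a letter either performs the next required change of site and pays
    [tr b (~~ b)], or repeats the current site, which costs at most [g] and leaves the required
    pattern intact. Once the pattern is used up every letter costs at most [g]. *)
Lemma word_weight_le m b w : subseq (alternating m (~~ b)) w ->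
  word_weight b w <= g ^+ (size w - m) * alternating_weight m b.
Proof.
have g0 : 0 <= g by apply: le_trans (tr_le true true).
elim: w m b => [|c w IH] m b.
  by move=> h; have := size_subseq h; rewrite size_alternating leqn0 => /eqP -> /=; rewrite mulr1.
case: m => [|m] hsub /=.
  rewrite mulr1 subn0 exprS ler_pM ?word_weight_ge0 //.
  by have := IH 0%N c; rewrite /= mulr1 subn0; apply; exact: sub0seq.
move: hsub => /=; case: (eqVneq (~~ b) c) => [<- hsub|hbc hsub].
  rewrite subSS (mulrCA (g ^+ _)) ler_wpM2l //.
  exact: IH.
have cb : c = b by case: b c hbc {hsub} => [] [].
have hs : (m < size w)%N by have := size_subseq hsub; rewrite /= size_alternating.
rewrite cb subSn // exprS -mulrA ler_pM ?word_weight_ge0 //.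
exact: (IH m.+1 b).
Qed.

(** A word that starts at the first site of the pattern changes site at least three times. One that
    starts at the other site changes at least four times, and the first change is given up for a
    factor [g]. *)
Lemma word_weight_crossing c w : subseq [:: true; false; true; false] (c :: w) ->
  word_weight c w <= g ^+ (size w - 3) * alternating_weight 3 true.
Proof.
have g0 : 0 <= g by apply: le_trans (tr_le true true).
case: c => /= h; first exact: (@word_weight_le 3 true).
have := @word_weight_le 4 false w h; move=> /le_trans; apply.
have hs : (3 < size w)%N by have := size_subseq h.
rewrite (_ : (size w - 3 = (size w - 4).+1)%N); last lia.
rewrite exprSr -!mulrA ler_wpM2l ?exprn_ge0 //=.
by rewrite ler_wpM2r // !mulr_ge0.
Qed.

End Words.

Definition insert_all (b : bool) (ws : seq (seq bool)) : seq (seq bool) :=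
  flatten [seq insertions b w | w <- ws].

(* The orders in which two interleaved chains of [k.+2] times can visit their sites:
   the alternating pattern with [k] further visits of each inserted. *)
Definition crossing_words (k : nat) : seq (seq bool) :=
  iter k (insert_all false) (iter k (insert_all true) [:: [:: true; false; true; false]]).

Lemma insertions_subseq (T : eqType) (b : T) w w' : w' \in insertions b w ->
  size w' = (size w).+1 /\ subseq w w'.
Proof.
elim: w w' => [|c w IH] w' /=; first by rewrite inE => /eqP ->.
rewrite inE => /orP[/eqP -> | /mapP[w2 /IH [e s] ->]] /=.
  by split=> //; rewrite -/(subseq (c :: w) (b :: c :: w)) subseq_cons.
by rewrite e eqxx.
Qed.

Lemma crossing_wordsP k w : w \in crossing_words k ->
  size w = (4 + (k + k))%N /\ subseq [:: true; false; true; false] w.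
Proof.
have H b m ws w0 N : (forall w, w \in ws -> size w = N /\ subseq w0 w) ->
  forall w, w \in iter m (insert_all b) ws -> size w = (N + m)%N /\ subseq w0 w.
  move=> h; elim: m => [|m IH] w' /=; first by rewrite addn0; apply: h.
  move=> /flattenP[l /mapP[w1 /IH [e1 s1] ->]] /insertions_subseq [e2 s2].
  by rewrite e2 e1 addnS; split=> //; apply: subseq_trans s2.
move=> h.
have := H false k _ [:: true; false; true; false] (4 + k)%N _ w h.
rewrite addnA; apply.
apply: (H true k) => w1; rewrite inE => /eqP -> //.
Qed.

Lemma insertions_map (T1 T2 : Type) (h : T1 -> T2) y xs :
  insertions (h y) (map h xs) = map (map h) (insertions y xs).
Proof. by elim: xs => [|x xs IH] //=; rewrite IH -!map_comp. Qed.

Lemma emb_words (R : realFieldType) (G : eqType) n (f : nat -> G) x y k :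
  emb R n f 1 [:: x; y; x; y] * visits R n f x ^+ k * visits R n f y ^+ k <=
  \sum_(w <- crossing_words k) emb R n f 1 [seq if b then x else y | b <- w].
Proof.
pose l b := if b then x else y.
have H (b : bool) m ws : (\sum_(w <- ws) emb R n f 1 (map l w)) * visits R n f (l b) ^+ m <=
    \sum_(w <- iter m (insert_all b) ws) emb R n f 1 (map l w).
  elim: m => [|m IH]; first by rewrite expr0 mulr1.
  rewrite exprSr mulrA /=.
  apply: (le_trans (ler_wpM2r (visits_ge0 _ _ _ _) IH)).
  rewrite big_flatten big_map big_distrl /=; apply: ler_sum => w _.
  by have := emb_mul_visits R n f (l b) (map l w) 1; rewrite insertions_map big_map.
have h1 := H true k [:: [:: true; false; true; false]].
have h2 := H false k (iter k (insert_all true) [:: [:: true; false; true; false]]).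
apply: le_trans h2; rewrite ler_wpM2r ?exprn_ge0 ?visits_ge0 //.
by apply: le_trans h1; rewrite big_seq1.
Qed.

Lemma sum_nat_ge_le (R : realFieldType) n a (F : nat -> R) : (0 < a)%N -> (a <= n.+1)%N ->
  \sum_(1 <= t < n.+1) (a <= t)%:R * F t = \sum_(a <= t < n.+1) F t.
Proof.
move=> a0 an; rewrite (big_cat_nat (n := a)) //=.
rewrite [X in X + _](_ : _ = 0) ?add0r.
  by apply: eq_big_nat => t /andP[-> _]; rewrite mul1r.
rewrite big_nat_cond big1 // => t /andP[/andP[_ ta] _].
by rewrite leqNgt ta mul0r.
Qed.

(** By [crossing_pair] every pair counted on the left has four interleaved times. With these four
    fixed, [pick_two_le] counts the chains through two of them; what is left is an embedding of x y
    x y and [k] free visits to each site. The factor 2 is for the chain that comes first. *)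
Lemma crossing_pointwise (R : realFieldType) (G : finType) n (f : nat -> G) k :
  \sum_(i <- incs k.+2 0 n) \sum_(j <- incs k.+2 0 n)
     (~~ gapped n i j && ~~ gapped n j i)%:R *
     ((\sum_x at_all R f x i) * (\sum_x at_all R f x j)) <=
  2 * (k.+2 * k.+1)%:R ^+ 2 * \sum_x \sum_y
     emb R n f 1 [:: x; y; x; y] * visits R n f x ^+ k * visits R n f y ^+ k.
Proof.
set W := incs k.+2 0 n; pose A x i := at_all R f x i.
pose S F : R := \sum_(1 <= t1 < n.+1) \sum_(1 <= t2 < n.+1)
  \sum_(1 <= t3 < n.+1) \sum_(1 <= t4 < n.+1) F t1 t2 t3 t4.
pose X i j : R := S (fun t1 t2 t3 t4 => (interleaved i j t1 t2 t3 t4)%:R).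
pose Y x y : R := \sum_(i <- W) \sum_(j <- W) X i j * (A x i * A y j).
have A0 x i : 0 <= A x i by apply: at_all_ge0.
have X0 i j : 0 <= X i j by do 4! (apply: sumr_ge0 => ? _).
have X1 i j t1 t2 t3 t4 : i \in W -> j \in W -> interleaved i j t1 t2 t3 t4 -> 1 <= X i j.
  have inW l t : l \in W -> t \in l -> t \in index_iota 1 n.+1.
    rewrite mem_incs => /and3P[_ h1 h2] tl; rewrite mem_index_iota ltnS (allP h2) // andbT.
    by move: h1; rewrite path_sortedE => [/andP[/allP/(_ t tl)]//|]; exact: ltn_trans.
  move=> hi hj h; have /andP[/and5P[a1 a3 _ a2 /andP[a4 _]] _] := h.
  rewrite /X /S (bigD1_seq t1) ?iota_uniq ?(inW i) //=.
  rewrite (bigD1_seq t2) ?iota_uniq ?(inW j) //=.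
  rewrite (bigD1_seq t3) ?iota_uniq ?(inW i) //=.
  rewrite (bigD1_seq t4) ?iota_uniq ?(inW j) //= h -!addrA lerDl.
  rewrite !addr_ge0 //; do ?(apply: sumr_ge0 => ? _); by rewrite ?ler0n.
have Yle x y : Y x y <= (k.+2 * k.+1)%:R ^+ 2 *
    (emb R n f 1 [:: x; y; x; y] * visits R n f x ^+ k * visits R n f y ^+ k).
  set Cx := visits R n f x ^+ k; set Cy := visits R n f y ^+ k.
  have Cx0 : 0 <= Cx by rewrite exprn_ge0 ?visits_ge0.
  have Cy0 : 0 <= Cy by rewrite exprn_ge0 ?visits_ge0.
  set c := (k.+2 * k.+1)%:R.
  have -> : Y x y = S (fun t1 t2 t3 t4 => \sum_(i <- W) \sum_(j <- W)
      (interleaved i j t1 t2 t3 t4)%:R * (A x i * A y j)).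
    rewrite /Y /S.
    under eq_bigr => i _ do under eq_bigr => j _ do rewrite /X /S.
    have e i j : X i j * (A x i * A y j) =
      S (fun t1 t2 t3 t4 => (interleaved i j t1 t2 t3 t4)%:R * (A x i * A y j)).
      rewrite /X /S.
      do 4! (rewrite big_distrl /=; apply: eq_bigr => ? _).
      by [].
    rewrite (eq_bigr (fun i => \sum_(j <- W) S (fun t1 t2 t3 t4 =>
      (interleaved i j t1 t2 t3 t4)%:R * (A x i * A y j)))); last first.
      by move=> i _; apply: eq_bigr => j _; apply: e.
    rewrite /S.
    under eq_bigr do rewrite exchange_big /=.
    rewrite exchange_big /=; apply: eq_bigr => t1 _.
    under eq_bigr do rewrite exchange_big /=.
    rewrite exchange_big /=; apply: eq_bigr => t2 _.
    under eq_bigr do rewrite exchange_big /=.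
    rewrite exchange_big /=; apply: eq_bigr => t3 _.
    under eq_bigr do rewrite exchange_big /=.
    by rewrite exchange_big.
  apply: (@le_trans _ _ (S (fun t1 t2 t3 t4 =>
     (c ^+ 2 * Cx * Cy) * ((f t1 == x)%:R * ((t1 <= t2)%:R * ((f t2 == y)%:R *
       ((t2 <= t3)%:R * ((f t3 == x)%:R * ((t3 <= t4)%:R * (f t4 == y)%:R)))))))%R)).
    apply: ler_sum => t1 _; apply: ler_sum => t2 _; apply: ler_sum => t3 _; apply: ler_sum => t4 _.
    case: (boolP ((t1 != t3) && (t2 != t4))) => [/andP[n13 n24]|deg]; last first.
      rewrite big1 => [|i _]; first by rewrite !mulr_ge0 ?ler0n ?sqr_ge0.
      rewrite big1 // => j _; rewrite (_ : interleaved _ _ _ _ _ _ = false) ?mul0r //.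
      apply/negP => /andP[/and5P[_ _ h13 _ /andP[_ h24]] _].
      by rewrite h13 h24 in deg.
    pose o : R := (t1 <= t2)%:R * ((t2 <= t3)%:R * (t3 <= t4)%:R).
    have o0 : 0 <= o by rewrite !mulr_ge0 ?ler0n.
    have -> : \sum_(i <- W) \sum_(j <- W) (interleaved i j t1 t2 t3 t4)%:R * (A x i * A y j) =
       o * ((\sum_(i <- W) (t1 \in i)%:R * (t3 \in i)%:R * A x i) *
            (\sum_(j <- W) (t2 \in j)%:R * (t4 \in j)%:R * A y j)).
      rewrite big_distrlr big_distrr /=; apply: eq_bigr => i _.
      rewrite big_distrr /=; apply: eq_bigr => j _.
      rewrite /interleaved n13 n24 andbT /= -!mulnb !natrM /o; ring.
    have P1 : \sum_(i <- W) (t1 \in i)%:R * (t3 \in i)%:R * A x i <=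
       c * ((f t1 == x)%:R * (f t3 == x)%:R) * Cx by apply: pick_two_le.
    have P2 : \sum_(j <- W) (t2 \in j)%:R * (t4 \in j)%:R * A y j <=
       c * ((f t2 == y)%:R * (f t4 == y)%:R) * Cy by apply: pick_two_le.
    apply: le_trans (ler_wpM2l o0 (ler_pM _ _ P1 P2)) _.
    - by apply: sumr_ge0 => i _; rewrite !mulr_ge0 ?ler0n ?A0.
    - by apply: sumr_ge0 => i _; rewrite !mulr_ge0 ?ler0n ?A0.
    - by rewrite /o; apply: ler_of_eq; ring.
  apply: ler_of_eq.
  transitivity (c ^+ 2 * Cx * Cy * emb R n f 1 [:: x; y; x; y]); last by ring.
  rewrite /S big_distrr /=; apply: eq_big_nat => t1 /andP[t10 t1n].
  rewrite -(sum_nat_ge_le _ t10 (ltnW t1n)) !big_distrr /=.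
  apply: eq_big_nat => t2 /andP[t20 t2n].
  rewrite -(sum_nat_ge_le _ t20 (ltnW t2n)) !big_distrr /=.
  apply: eq_big_nat => t3 /andP[t30 t3n].
  rewrite -(sum_nat_ge_le _ t30 (ltnW t3n)) !big_distrr /=.
  by apply: eq_big_nat => t4 _; ring.
apply: (@le_trans _ _ (\sum_(i <- W) \sum_(j <- W)
   (X i j + X j i) * ((\sum_x A x i) * (\sum_x A x j)))).
  rewrite big_seq [leRHS]big_seq; apply: ler_sum => i hi.
  rewrite big_seq [leRHS]big_seq; apply: ler_sum => j hj.
  apply: ler_wpM2r; first by rewrite mulr_ge0 // sumr_ge0.
  case: (boolP (gapped n i j)) => g1 /=; first by rewrite addr_ge0.
  case: (boolP (gapped n j i)) => g2 /=; first by rewrite addr_ge0.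
  have [t1 [t2 [t3 [t4 /orP[h|h]]]]] := crossing_pair hi hj g1 g2.
    by apply: (le_trans (X1 _ _ _ _ _ _ hi hj h)); rewrite lerDl.
  by apply: (le_trans (X1 _ _ _ _ _ _ hj hi h)); rewrite lerDr.
have YE : \sum_(i <- W) \sum_(j <- W) X i j * ((\sum_x A x i) * (\sum_x A x j)) =
   \sum_x \sum_y Y x y.
  rewrite /Y.
  rewrite [RHS](eq_bigr (fun x => \sum_(i <- W) \sum_y \sum_(j <- W) X i j * (A x i * A y j))); last first.
    by move=> x _; rewrite exchange_big.
  rewrite [RHS]exchange_big /=; apply: eq_bigr => i _.
  rewrite [RHS](eq_bigr (fun x => \sum_(j <- W) \sum_y X i j * (A x i * A y j))); last first.
    by move=> x _; rewrite exchange_big.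
  rewrite [RHS]exchange_big /=; apply: eq_bigr => j _.
  rewrite big_distrlr big_distrr /=; apply: eq_bigr => x _.
  by rewrite big_distrr.
have -> : \sum_(i <- W) \sum_(j <- W) (X i j + X j i) * ((\sum_x A x i) * (\sum_x A x j)) =
   2 * \sum_x \sum_y Y x y.
  rewrite -YE mulr2n mulrDl !mul1r.
  rewrite [X in _ = _ + X]exchange_big /= -big_split /=; apply: eq_bigr => i _.
  rewrite -big_split /=; apply: eq_bigr => j _.
  by rewrite mulrDl (mulrC (\sum_x A x j)).
rewrite -mulrA ler_pM2l ?ltr0n // big_distrr /=; apply: ler_sum => x _.
by rewrite big_distrr /=; apply: ler_sum => y _; apply: Yle.
Qed.

(** * Green functions and the expected number of crossings *)

Section CrossingExpectation.
Variables (R : realFieldType) (G : finZmodType) (p : G -> R).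
Hypotheses (p_ge0 : forall g, 0 <= p g) (p_sum1 : \sum_g p g = 1).
Variable n : nat.

Definition green (z : G) : R := \sum_(0 <= m < n.+1) pn p m z.

Lemma green_ge0 z : 0 <= green z.
Proof. by apply: sumr_ge0 => m _; apply: pn_ge0. Qed.

Fixpoint green_weight (x : G) (xs : seq G) : R :=
  if xs is y :: ys then green (y - x) * green_weight y ys else 1.

Lemma green_weight_ge0 x xs : 0 <= green_weight x xs.
Proof. by elim: xs x => //= y ys IH x; rewrite mulr_ge0 ?green_ge0. Qed.

Lemma fdd_rcons t0 (x0 : G) tx t x : fdd p t0 x0 (rcons tx (t, x)) =
  fdd p t0 x0 tx * pn p (t - last t0 (map fst tx)) (x - last x0 (map snd tx)).
Proof.
by elim: tx t0 x0 => [|[t1 x1] tx IH] t0 x0 /=; rewrite ?mulr1 ?mul1r // IH mulrA.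
Qed.

Lemma fdd_ge0 t0 (x0 : G) tx : 0 <= fdd p t0 x0 tx.
Proof. by elim: tx t0 x0 => [|[t x] tx IH] t0 x0 //=; rewrite mulr_ge0 ?pn_ge0. Qed.

(** The sites of [xs] are attached one by one to the prescribed positions [tx]. Each costs a
    transition probability, and the sum over the time elapsed is at most a Green function. *)
Lemma Ex_emb tx xs : path leq 0 (map fst tx) -> all (fun q => q.1 <= n)%N tx ->
  Ex p n (fun s => (\prod_(q <- tx) (pos 0 s q.1 == q.2)%:R) *
      emb R n (pos 0 s) (last 0%N (map fst tx)) xs) <=
  fdd p 0 0 tx * green_weight (last 0 (map snd tx)) xs.
Proof.
elim: xs tx => [|x xs IH] tx hp ha.
  rewrite /= mulr1 -(Ex_fdd (n := n) p_sum1) //; apply: ler_of_eq.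
  apply: eq_Ex => s _; rewrite mulr1; apply: eq_bigr => q _; by rewrite subn0.
set T := last 0%N (map fst tx); set X := last 0 (map snd tx).
have Tn : (T <= n)%N.
  rewrite /T (last_map fst tx (0%N, 0 : G)).
  have := mem_last (0%N, 0 : G) tx; rewrite inE => /orP[/eqP -> //|]; exact: (allP ha).
rewrite (eq_Ex p (f2 := fun s => \sum_(T <= t < n.+1)
   (\prod_(q <- rcons tx (t, x)) (pos 0 s q.1 == q.2)%:R) * emb R n (pos 0 s) t xs)); last first.
  move=> s _; rewrite /= big_distrr /=; apply: eq_bigr => t _.
  by rewrite -cats1 big_cat big_seq1 /= mulrA.
rewrite (Ex_sum p n _ _ (fun t s => _ * emb R n (pos 0 s) t xs)).
apply: (@le_trans _ _ (\sum_(T <= t < n.+1) fdd p 0 0 tx * pn p (t - T) (x - X) * green_weight x xs)).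
  apply: ler_sum_nat => t /andP[Tt tn].
  have := IH (rcons tx (t, x)); rewrite !map_rcons !last_rcons fdd_rcons /=; apply.
    by rewrite rcons_path hp.
  by rewrite all_rcons ha andbT.
rewrite -big_distrl -big_distrr /= mulrA ler_wpM2r ?green_weight_ge0 // ler_wpM2l ?fdd_ge0 //.
rewrite /green -{1}[T]add0n big_addn.
rewrite [leRHS](big_cat_nat (n := (n.+1 - T)%N)) //=; last by lia.
rewrite (eq_bigr (fun m => pn p m (x - X))); last by move=> m _; rewrite addnK.
by rewrite lerDl; apply: sumr_ge0 => m _; apply: pn_ge0.
Qed.

Lemma Ex_emb_start x xs : Ex p n (fun s => emb R n (pos 0 s) 1 (x :: xs)) <=
  (\sum_(1 <= t < n.+1) pn p t x) * green_weight x xs.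
Proof.
rewrite (Ex_sum p n _ _ (fun t s => (pos 0 s t == x)%:R * emb R n (pos 0 s) t xs)).
rewrite big_distrl /=; apply: ler_sum_nat => t /andP[t1 tn].
have := @Ex_emb [:: (t, x)] xs; rewrite /= subn0 subr0 mulr1.
under eq_Ex do rewrite big_seq1 /=.
by apply; rewrite // andbT; lia.
Qed.

(** The weight of the three moves in x y x y, with z = y - x. *)
Definition crossing_energy : R := \sum_z green z * (green (- z) * green z).

Variable g : R.
Hypothesis green_le : forall z, green z <= g.

Let g_ge0 : 0 <= g.
Proof. by apply: le_trans (green_le 0); apply: green_ge0. Qed.

(** A word has [2 * k + 3] moves. Three moves that alternate between the sites are kept, the others
    are bounded by [g]. By translation the energy does not depend on the starting site, whose
    occupation sums to [n]. *)
Lemma word_expectation_le k w : w \in crossing_words k ->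
  \sum_x \sum_y Ex p n (fun s => emb R n (pos 0 s) 1 [seq if b then x else y | b <- w]) <=
  n%:R * (g ^+ (2 * k) * crossing_energy).
Proof.
move=> /crossing_wordsP []; case: w => [//|c w] sw sub.
pose V (x : G) := \sum_(1 <= t < n.+1) pn p t x.
have V0 x : 0 <= V x by apply: sumr_ge0 => t _; apply: pn_ge0.
have VS : \sum_x V x = n%:R.
  rewrite exchange_big /= (eq_bigr (fun=> 1)); last by move=> t _; rewrite sum_pn.
  by rewrite big_const_nat iter_addr addr0 subn1.
pose K z := green z * (green (- z) * green z).
have K0 z : 0 <= K z by rewrite !mulr_ge0 ?green_ge0.
apply: (@le_trans _ _ (\sum_x \sum_y V (if c then x else y) * (g ^+ (2 * k) * K (y - x)))).
  apply: ler_sum => x _; apply: ler_sum => y _.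
  pose l (b : bool) := if b then x else y.
  pose tr (b b' : bool) := green (l b' - l b).
  apply: (le_trans (Ex_emb_start _ _)); rewrite ler_wpM2l //; first exact: V0.
  have -> : green_weight (l c) (map l w) = word_weight tr c w.
    by elim: (w) (c) => [|b' w' IH] b //=; rewrite IH.
  have := @word_weight_crossing _ tr g (fun b b' => green_ge0 _) (fun b b' => green_le _) c w sub.
  rewrite (_ : (size w - 3 = 2 * k)%N); last by move: sw => /=; lia.
  move=> /le_trans; apply.
  by rewrite /= /tr /l mulr1 /K opprB.
rewrite -VS big_distrl /crossing_energy -/K; case: c {sw sub}.
  rewrite /=; apply: ler_of_eq; apply: eq_bigr => x _.
  rewrite -big_distrr /= -big_distrr /=; congr (_ * (_ * _)).
  by rewrite (reindex_inj (addIr x)) /=; apply: eq_bigr => y _; rewrite addrK.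
rewrite exchange_big /=; apply: ler_of_eq; apply: eq_bigr => y _.
rewrite -big_distrr /= -big_distrr /=; congr (_ * (_ * _)).
rewrite (reindex_inj (subrI y)) /=; apply: eq_bigr => x _.
by rewrite opprB addrCA subrr addr0.
Qed.

Lemma crossing_sum_le k :
  \sum_(i <- incs k.+2 0 n) \sum_(j <- incs k.+2 0 n)
     (~~ gapped n i j && ~~ gapped n j i)%:R * joint p n i j <=
  2 * (k.+2 * k.+1)%:R ^+ 2 * ((size (crossing_words k))%:R *
    (n%:R * (g ^+ (2 * k) * crossing_energy))).
Proof.
pose W := incs k.+2 0 n.
pose F (s : seq G) : R := \sum_(i <- W) \sum_(j <- W)
     (~~ gapped n i j && ~~ gapped n j i)%:R *
     ((\sum_x at_all R (pos 0 s) x i) * (\sum_x at_all R (pos 0 s) x j)).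
have -> : \sum_(i <- incs k.+2 0 n) \sum_(j <- incs k.+2 0 n)
     (~~ gapped n i j && ~~ gapped n j i)%:R * joint p n i j = Ex p n F.
  rewrite (Ex_sum p n _ _ (fun i s => \sum_(j <- W) _)); apply: eq_bigr => i _.
  rewrite (Ex_sum p n _ _ (fun j s => _)); apply: eq_bigr => j _.
  by rewrite ExZ.
apply: (@le_trans _ _ (Ex p n (fun s => 2 * (k.+2 * k.+1)%:R ^+ 2 *
   \sum_x \sum_y \sum_(w <- crossing_words k)
     emb R n (pos 0 s) 1 [seq if b then x else y | b <- w]))).
  apply: ler_Ex => // s _; apply: (le_trans (crossing_pointwise _ _ _ _)).
  rewrite ler_wpM2l ?mulr_ge0 ?exprn_ge0 ?ler0n //.
  apply: ler_sum => x _; apply: ler_sum => y _; exact: emb_words.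
rewrite ExZ ler_wpM2l ?mulr_ge0 ?exprn_ge0 ?ler0n //.
rewrite (Ex_sum p n _ _ (fun x s => \sum_y _)).
rewrite (eq_bigr (fun x => \sum_y \sum_(w <- crossing_words k)
    Ex p n (fun s => emb R n (pos 0 s) 1 [seq if b then x else y | b <- w]))); last first.
  move=> x _; rewrite (Ex_sum p n _ _ (fun y s => _)); apply: eq_bigr => y _.
  by rewrite (Ex_sum p n _ _ (fun w s => _)).
rewrite (eq_bigr (fun x => \sum_(w <- crossing_words k) \sum_y
    Ex p n (fun s => emb R n (pos 0 s) 1 [seq if b then x else y | b <- w]))); last first.
  by move=> x _; rewrite exchange_big.
rewrite exchange_big /=.
apply: (@le_trans _ _ (\sum_(w <- crossing_words k) n%:R * (g ^+ (2 * k) * crossing_energy))).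
  rewrite big_seq [leRHS]big_seq; apply: ler_sum => w hw; exact: word_expectation_le.
by rewrite big_const_seq count_predT iter_addr addr0 [leRHS]mulr_natl.
Qed.

End CrossingExpectation.

(** * The variance on a finite group *)

Lemma sqr_sum_le (R : realFieldType) N (a : 'I_N -> R) :
  (\sum_i a i) ^+ 2 <= N%:R * \sum_i a i ^+ 2.
Proof.
rewrite expr2 big_distrlr /=.
apply: (@le_trans _ _ (\sum_(i < N) \sum_(j < N) (a i ^+ 2 / 2 + a j ^+ 2 / 2))).
  apply: ler_sum => i _; apply: ler_sum => j _.
  have := sqr_ge0 (a i - a j); rewrite !expr2; lra.
rewrite (eq_bigr (fun i => N%:R * (a i ^+ 2 / 2) + (\sum_(j < N) a j ^+ 2) / 2)); last first.
  by move=> i _; rewrite big_split /= sumr_const card_ord mulr_natl mulr_suml.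
rewrite big_split /= -big_distrr -mulr_suml /= sumr_const card_ord -[_ *+ N]mulr_natl.
by apply: ler_of_eq; field.
Qed.

(** Multiplication by l acts on the binomials through l C(l, k+1) = (k+2) C(l, k+2) + (k+1) C(l,
    k+1). There is no constant term, so only nonempty chains arise. *)
Lemma power_binomial_basis (R : realFieldType) al :
  {c : nat -> R | forall l, l%:R ^+ al.+1 = \sum_(k < al.+1) c k * 'C(l, k.+1)%:R}.
Proof.
elim: al => [|al [c hc]].
  by exists (fun=> 1) => l; rewrite big_ord1 mul1r bin1 expr1.
exists (fun k => k.+1%:R * (if (k < al.+1)%N then c k else 0) +
   (if k is j.+1 then k.+1%:R * c j else 0)) => l.
rewrite exprS hc big_distrr /=.
under [RHS]eq_bigr do rewrite mulrDl.
rewrite [RHS]big_split /= [X in _ = X + _]big_ord_recr /= ltnn mulr0 mul0r addr0.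
rewrite [X in _ = _ + X]big_ord_recl /= mul0r add0r -big_split /=.
apply: eq_bigr => k _; rewrite ltn_ord /bump /= add1n.
have : (l * 'C(l, k.+1) = k.+2 * 'C(l, k.+2) + k.+1 * 'C(l, k.+1))%N.
  have := mul_bin_left l k.+1; case: (leqP k.+1 l) => h e.
    by rewrite e -mulnDl subnK.
  by rewrite !bin_small ?muln0 //; lia.
move=> /(congr1 (fun m => m%:R : R)); rewrite natrM natrD !natrM => e.
by rewrite mulrCA e; ring.
Qed.

Section LocalTimePowers.
Variables (R : realFieldType) (G : finType) (n : nat) (f : nat -> G).

(** A chain of [k] visits to [x] is a [k]-element subset of the times spent at [x]. *)
Lemma sum_at_all_bin x k a : \sum_(i <- incs k a n) at_all R f x i =
  'C(\sum_(a.+1 <= t < n.+1) (f t == x), k)%:R.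
Proof.
elim: k a => [|k IH] a; first by rewrite sum_incs0 /at_all big_nil bin0.
rewrite sum_incsS.
rewrite (eq_bigr (fun t => (f t == x)%:R * 'C(\sum_(t.+1 <= r < n.+1) (f r == x), k)%:R)); last first.
  by move=> t _; rewrite -IH big_distrr /=; apply: eq_bigr => l _; rewrite at_all_cons.
case: (leqP a n) => an; last by rewrite !big_geq ?bin0n //; lia.
have e : (a = n - (n - a))%N by rewrite subKn.
rewrite {}e; elim: (n - a)%N => [|m IHm]; first by rewrite subn0 !big_geq ?bin0n.
case: (leqP n m) => nm.
  have e0 m' : (n <= m')%N -> (n - m' = 0)%N by lia.
  by move: IHm; rewrite !e0 //; lia.
have es : (n - m.+1).+1 = (n - m)%N by lia.
rewrite !(@big_ltn _ _ _ (n - m.+1).+1) ?ltnS ?leq_subr //; [|lia|lia].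
rewrite es IHm; case: eqP => _; last by rewrite mul0r add0r add0n.
by rewrite mul1r add1n binS -natrD addnC.
Qed.

Lemma visits_natE x : visits R n f x = (\sum_(1 <= t < n.+1) (f t == x))%:R.
Proof. by rewrite /visits natr_sum. Qed.

Lemma sum_visits : \sum_x visits R n f x = n%:R.
Proof.
rewrite /visits exchange_big /= (eq_bigr (fun=> 1)); last first.
  move=> t _; rewrite (bigD1 (f t)) //= eqxx big1 ?addr0 // => x.
  by rewrite eq_sym => /negbTE ->.
by rewrite big_const_nat iter_addr addr0 subn1.
Qed.

End LocalTimePowers.

Section FiniteVariance.
Variables (R : realFieldType) (G : finZmodType) (p : G -> R).
Hypotheses (p_ge0 : forall g, 0 <= p g) (p_sum1 : \sum_g p g = 1).
Variable n : nat.

Definition VarG (f : seq G -> R) : R := Ex p n (fun s => f s ^+ 2) - Ex p n f ^+ 2.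

Lemma VarGE f : VarG f = Ex p n (fun s => (f s - Ex p n f) ^+ 2).
Proof.
set m := Ex p n f.
rewrite (eq_Ex p (f2 := fun s => f s ^+ 2 + ((- 2 * m) * f s + m ^+ 2))); last first.
  by move=> s _; ring.
by rewrite !ExD ExZ Ex_cst // -/m /VarG -/m; ring.
Qed.

Lemma VarG_sum_le N (c : 'I_N -> R) (f : 'I_N -> seq G -> R) :
  VarG (fun s => \sum_k c k * f k s) <= N%:R * \sum_k c k ^+ 2 * VarG (f k).
Proof.
rewrite VarGE.
have -> : Ex p n (fun s => \sum_k c k * f k s) = \sum_k c k * Ex p n (f k).
  by rewrite (Ex_sum p n _ _ (fun k s => c k * f k s)); apply: eq_bigr => k _; rewrite ExZ.
apply: (@le_trans _ _ (Ex p n (fun s => N%:R * \sum_k c k ^+ 2 * (f k s - Ex p n (f k)) ^+ 2))).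
  apply: ler_Ex => // s _.
  have := sqr_sum_le (fun k => c k * (f k s - Ex p n (f k))).
  rewrite (eq_bigr (fun k => c k * f k s - c k * Ex p n (f k))); last by move=> k _; rewrite mulrBr.
  by rewrite sumrB => /le_trans; apply; under eq_bigr do rewrite exprMn.
rewrite ExZ (Ex_sum p n _ _ (fun k s => _)) ler_wpM2l ?ler0n //.
by apply: ler_sum => k _; rewrite ExZ VarGE.
Qed.

Variable Q : nat -> R.
Hypothesis pn_le : forall m x, (m <= n)%N -> pn p m x <= Q m.
Local Notation u := (fun m => pn p m 0).

Definition mass : R := \sum_(0 <= m < n.+1) Q m.
Definition energy : R :=
  \sum_(0 <= a < n.+1) \sum_(0 <= m < (2 * n).+1) (minn a m).+1%:R * (Q a * u m).

Let Q_ge0 m : (m <= n)%N -> 0 <= Q m.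
Proof. by move=> h; apply: le_trans (pn_le 0 h); apply: pn_ge0. Qed.

Let u_ge0 m : 0 <= u m := pn_ge0 p_ge0 m 0.

Lemma energy_ge0 : 0 <= energy.
Proof.
rewrite /energy big_nat; apply: sumr_ge0 => a an; apply: sumr_ge0 => m _.
by rewrite !mulr_ge0 ?ler0n ?Q_ge0 //; lia.
Qed.

Lemma mass_ge1 : 1 <= mass.
Proof.
rewrite /mass big_nat_recl //=; have := pn_le 0 (leq0n n); rewrite /pn eqxx.
move=> h; apply: (le_trans h); rewrite lerDl big_nat; apply: sumr_ge0 => m hm.
by apply: Q_ge0; lia.
Qed.

Lemma overlap_le_energy : overlap p n <= energy.
Proof.
rewrite /overlap /energy.
apply: (@le_trans _ _ (\sum_(1 <= a < n.+1) \sum_(0 <= m < (2 * n).+1) (minn a m).+1%:R * (Q a * u m))).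
  apply: ler_sum_nat => a /andP[a1 an].
  rewrite big_distrr [leRHS](big_cat_nat (n := 1)) //= -[leLHS]add0r lerD //.
    by rewrite big_nat; apply: sumr_ge0 => m hm; rewrite !mulr_ge0 ?ler0n ?Q_ge0 //; lia.
  rewrite [leRHS](big_cat_nat (n := n.+1)) //=; last by lia.
  rewrite -[leLHS]addr0 lerD //; last first.
    by apply: sumr_ge0 => m hm; rewrite !mulr_ge0 ?ler0n ?Q_ge0 //; lia.
  apply: ler_sum => m _; rewrite mulrA mulrC ler_pM ?mulr_ge0 ?ler0n //.
    by rewrite ler_nat; lia.
  by rewrite ler_wpM2r ?u_ge0 // pn_le //; lia.
rewrite [leRHS]big_nat_recl //= big_add1 /= lerDr.
by apply: sumr_ge0 => m hm; rewrite !mulr_ge0 ?ler0n ?Q_ge0 //; lia.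
Qed.

Lemma sum_return_le (c : nat) :
  \sum_(0 <= a < n.+1) \sum_(0 <= b < n.+1) (a <= c)%:R * u (a + b)%N <=
  \sum_(0 <= m < (2 * n).+1) (minn c m).+1%:R * u m.
Proof.
apply: (@le_trans _ _ (\sum_(0 <= a < n.+1) \sum_(0 <= m < (2 * n).+1)
   (a <= minn c m)%:R * u m)).
  apply: ler_sum_nat => a /andP[_ an].
  rewrite [leRHS](big_cat_nat (n := a)) //=; last by lia.
  rewrite -[leLHS]add0r lerD //; first by apply: sumr_ge0 => m _; rewrite mulr_ge0 ?ler0n.
  have -> : \sum_(a <= m < (2 * n).+1) (a <= minn c m)%:R * u m =
      \sum_(0 <= b < (2 * n).+1 - a) (a <= minn c (b + a))%:R * u (b + a)%N.
    by rewrite -{1}[a]add0n big_addn.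
  rewrite [leRHS](big_cat_nat (n := n.+1)) //=; last by lia.
  rewrite -[leLHS]addr0 lerD //; last by apply: sumr_ge0 => m _; rewrite mulr_ge0 ?ler0n.
  apply: ler_sum => b _; rewrite leq_min [(b + a)%N]addnC leq_addr andbT //.
rewrite exchange_big /=; apply: ler_sum => m _; rewrite -big_distrl /= ler_wpM2r //.
have H N M : \sum_(0 <= a < N) (a < M)%N%:R <= M%:R :> R.
  rewrite -natr_sum ler_nat; elim: N => [|N IH]; first by rewrite big_geq.
  case: (ltnP N M) => h; rewrite big_nat_recr //=; last by rewrite ltnNge h addn0.
  rewrite h addn1; apply: (leq_trans _ h); rewrite ltnS.
  apply: (@leq_trans (\sum_(0 <= a < N) 1)); first by apply: leq_sum => ? _; apply: leq_b1.
  by rewrite sum_nat_const_nat subn0 muln1.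
exact: (H n.+1 (minn c m).+1).
Qed.

(** For the durations a, b, c of the three moves, either min(a, b) <= c and the third factor is
    bounded by [Q c], or min(c, b) <= a and the first is bounded by [Q a]. A move out and a move
    back remain, and they sum over z to a return probability; the middle factor is never the one
    bounded, since two moves in the same direction do not make a return. At most 2 (min(c, m) + 1)
    pairs with sum m have minimum at most c, so each case gives twice [energy]. *)
Lemma crossing_energy_le : crossing_energy p n <= 4 * energy.
Proof.
have E : crossing_energy p n =
  \sum_(0 <= a < n.+1) \sum_(0 <= b < n.+1) \sum_(0 <= c < n.+1)
    \sum_z pn p a z * (pn p b (- z) * pn p c z).
  rewrite /crossing_energy /green.
  rewrite (eq_bigr (fun z => \sum_(0 <= a < n.+1) \sum_(0 <= b < n.+1) \sum_(0 <= c < n.+1)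
    pn p a z * (pn p b (- z) * pn p c z))); last first.
    move=> z _; rewrite big_distrl /=; apply: eq_bigr => a _.
    rewrite big_distrlr big_distrr /=; apply: eq_bigr => b _.
    by rewrite big_distrr.
  rewrite exchange_big /=; apply: eq_bigr => a _.
  rewrite exchange_big /=; apply: eq_bigr => b _.
  by rewrite exchange_big.
have ret a b : \sum_z pn p a z * pn p b (- z) = u (a + b)%N.
  by rewrite pnD; apply: eq_bigr => z _; rewrite sub0r.
have T a b c : (a <= n)%N -> (b <= n)%N -> (c <= n)%N ->
    \sum_z pn p a z * (pn p b (- z) * pn p c z) <=
    (minn a b <= c)%:R * (Q c * u (a + b)%N) + (minn c b <= a)%:R * (Q a * u (c + b)%N).
  move=> an bn cn.
  have B1 : \sum_z pn p a z * (pn p b (- z) * pn p c z) <= Q c * u (a + b)%N.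
    rewrite -ret big_distrr /=; apply: ler_sum => z _.
    rewrite mulrA [leRHS]mulrC ler_wpM2l ?mulr_ge0 ?pn_ge0 //; exact: pn_le.
  have B2 : \sum_z pn p a z * (pn p b (- z) * pn p c z) <= Q a * u (c + b)%N.
    rewrite -ret big_distrr /=; apply: ler_sum => z _.
    rewrite [pn p c z * _]mulrC ler_wpM2r ?mulr_ge0 ?pn_ge0 //; exact: pn_le.
  have P1 : 0 <= Q c * u (a + b)%N by rewrite mulr_ge0 ?Q_ge0.
  have P2 : 0 <= Q a * u (c + b)%N by rewrite mulr_ge0 ?Q_ge0.
  case: (leqP (minn a b) c) => h; first by rewrite mul1r (le_trans B1) // lerDl mulr_ge0 ?ler0n.
  by rewrite (_ : (minn c b <= a)%N) ?mul0r ?add0r ?mul1r //; lia.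
have half : \sum_(0 <= c < n.+1) Q c * \sum_(0 <= a < n.+1) \sum_(0 <= b < n.+1)
     (minn a b <= c)%:R * u (a + b)%N <= 2 * energy.
  rewrite /energy big_distrr /=; apply: ler_sum_nat => c /andP[_ cn].
  rewrite (_ : 2 * _ = Q c * (2 * \sum_(0 <= m < (2 * n).+1) (minn c m).+1%:R * u m)); last first.
    by rewrite mulrCA; congr (_ * _); rewrite big_distrr /=; apply: eq_bigr => m _; ring.
  rewrite ler_wpM2l ?Q_ge0 //.
  apply: (@le_trans _ _ (\sum_(0 <= a < n.+1) \sum_(0 <= b < n.+1) (a <= c)%:R * u (a + b)%N +
     \sum_(0 <= a < n.+1) \sum_(0 <= b < n.+1) (b <= c)%:R * u (a + b)%N)).
    rewrite -big_split /=; apply: ler_sum => a _; rewrite -big_split /=; apply: ler_sum => b _.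
    rewrite -mulrDl ler_wpM2r // -natrD ler_nat; case: (leqP a c); case: (leqP b c); lia.
  rewrite [X in _ + X]exchange_big /= mulr2n mulrDl !mul1r lerD ?sum_return_le //.
  apply: le_trans (sum_return_le c); apply: ler_sum => a _; apply: ler_sum => b _.
  by rewrite addnC.
rewrite E.
apply: (@le_trans _ _ (\sum_(0 <= a < n.+1) \sum_(0 <= b < n.+1) \sum_(0 <= c < n.+1)
   ((minn a b <= c)%:R * (Q c * u (a + b)%N) + (minn c b <= a)%:R * (Q a * u (c + b)%N)))).
  apply: ler_sum_nat => a /andP[_ an]; apply: ler_sum_nat => b /andP[_ bn].
  by apply: ler_sum_nat => c /andP[_ cn]; apply: T.
rewrite (eq_bigr (fun a => \sum_(0 <= b < n.+1) \sum_(0 <= c < n.+1) (minn a b <= c)%:R * (Q c * u (a + b)%N) +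
   \sum_(0 <= b < n.+1) \sum_(0 <= c < n.+1) (minn c b <= a)%:R * (Q a * u (c + b)%N))); last first.
  by move=> a _; rewrite -big_split /=; apply: eq_bigr => b _; rewrite big_split.
rewrite big_split /= (_ : 4 = 2 + 2 :> R); last by ring.
rewrite mulrDl lerD //.
  apply: le_trans half; apply: ler_of_eq.
  rewrite (eq_bigr (fun a => \sum_(0 <= c < n.+1) \sum_(0 <= b < n.+1)
     (minn a b <= c)%:R * (Q c * u (a + b)%N))); last by move=> a _; rewrite exchange_big.
  rewrite exchange_big /=; apply: eq_bigr => c _; rewrite big_distrr /=; apply: eq_bigr => a _.
  by rewrite big_distrr /=; apply: eq_bigr => b _; rewrite mulrCA.
apply: le_trans half; apply: ler_of_eq.
apply: eq_bigr => a _; rewrite exchange_big /= big_distrr /=; apply: eq_bigr => c _.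
by rewrite big_distrr /=; apply: eq_bigr => b _; rewrite mulrCA.
Qed.

Lemma green_le_mass z : green p n z <= mass.
Proof. by apply: ler_sum_nat => m /andP[_ h]; apply: pn_le. Qed.

Definition chain_const (k : nat) : R :=
  2 * k.+2%:R * k.+1%:R + 2 * (k.+2 * k.+1)%:R ^+ 2 * (size (crossing_words k))%:R * 4.

Lemma chain_const_ge0 k : 0 <= chain_const k.
Proof. by rewrite addr_ge0 // !mulr_ge0 ?ler0n ?exprn_ge0. Qed.

Lemma VarG_chain_count_le k :
  VarG (chain_count R n k.+2) <= chain_const k * (n%:R * (mass ^+ (2 * k) * energy)).
Proof.
have m0 : 0 <= mass by apply: le_trans mass_ge1.
have us : \sum_(1 <= m < n.+1) u m <= mass.
  rewrite /mass [leRHS]big_nat_recl //= big_add1 /= -[leLHS]add0r lerD ?Q_ge0 //.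
  by apply: ler_sum_nat => m /andP[_ mn]; apply: pn_le.
apply: le_trans (chain_count_var_le p_ge0 p_sum1 us k) _.
rewrite /chain_const [leRHS]mulrDl lerD //.
  rewrite -!mulrA ler_pM2l ?ltr0n // ler_pM2l ?ltr0n //.
  rewrite mulrCA ler_pM2l ?ltr0n // !ler_wpM2l ?ler0n ?exprn_ge0 //.
  exact: overlap_le_energy.
apply: le_trans (crossing_sum_le p_ge0 p_sum1 green_le_mass k) _.
rewrite -[leRHS]mulrA [4 * _](_ : _ = n%:R * (mass ^+ (2 * k) * (4 * energy))); last by ring.
rewrite -!mulrA !ler_wpM2l ?ler0n ?exprn_ge0 //.
exact: crossing_energy_le.
Qed.

Definition LG (al : nat) (s : seq G) : R := \sum_x visits R n (pos 0 s) x ^+ al.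

Lemma VarG_LG1 : VarG (LG 1) = 0.
Proof.
rewrite VarGE (eq_Ex p (f2 := fun=> 0)) ?Ex_cst // => s _.
have e s' : LG 1 s' = n%:R by rewrite /LG; under eq_bigr do rewrite expr1; rewrite sum_visits.
rewrite (eq_Ex p (f2 := fun=> n%:R)) ?Ex_cst // e subrr expr2 mulr0 //.
Qed.

End FiniteVariance.

(** The constant precedes the group, the law and [n], so it survives the passage to Z^d. Chains of a
    single time are [n] in number at every outcome and have no variance; for longer ones [mass >= 1]
    raises all exponents to the largest. *)
Lemma VarG_LG_le (R : realFieldType) (al : nat) : exists C : R, 0 <= C /\
  forall (G : finZmodType) (p : G -> R) (n : nat) (Q : nat -> R),
  (forall g, 0 <= p g) -> \sum_g p g = 1 ->
  (forall m x, (m <= n)%N -> pn p m x <= Q m) ->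
  VarG p n (LG R n al.+2) <= C * (n%:R * (mass n Q ^+ (2 * al) * energy p n Q)).
Proof.
have [c hc] := power_binomial_basis R al.+1.
exists (al.+2%:R * \sum_(k < al.+1) c k.+1 ^+ 2 * chain_const R k); split.
  rewrite mulr_ge0 ?ler0n // sumr_ge0 // => k _.
  by rewrite mulr_ge0 ?sqr_ge0 ?chain_const_ge0.
move=> G p n Q p0 p1 pQ.
have eL s : LG R n al.+2 s = \sum_(k < al.+2) c k * chain_count R n k.+1 s.
  rewrite /LG (eq_bigr (fun x => \sum_(k < al.+2) c k *
     \sum_(i <- incs k.+1 0 n) at_all R (pos 0 s) x i)); last first.
    move=> x _; rewrite visits_natE hc; apply: eq_bigr => k _.
    by rewrite sum_at_all_bin.
  rewrite exchange_big /=; apply: eq_bigr => k _.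
  rewrite -big_distrr /=; congr (_ * _); rewrite exchange_big /=.
  by apply: eq_bigr => i _.
have -> : VarG p n (LG R n al.+2) = VarG p n (fun s => \sum_(k < al.+2) c k * chain_count R n k.+1 s).
  by rewrite /VarG; congr (_ - _ ^+ 2); apply: eq_Ex => s _; rewrite eL.
apply: le_trans (VarG_sum_le _ _ _ _ _) _ => //.
rewrite -mulrA ler_wpM2l ?ler0n // big_ord_recl /=.
have -> : VarG p n (chain_count R n 1) = 0.
  rewrite -[RHS](VarG_LG1 p1 n) /VarG; congr (_ - _ ^+ 2); apply: eq_Ex => s _.
    congr (_ ^+ 2); rewrite /LG /chain_count exchange_big /=; apply: eq_bigr => x _.
    by rewrite (sum_at_all_bin R n (pos 0 s) x 1 0) bin1 visits_natE expr1.
  rewrite /LG /chain_count exchange_big /=; apply: eq_bigr => x _.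
  by rewrite (sum_at_all_bin R n (pos 0 s) x 1 0) bin1 visits_natE expr1.
rewrite mulr0 add0r big_distrl /=; apply: ler_sum => k _.
rewrite -mulrA ler_wpM2l ?sqr_ge0 //.
apply: le_trans (VarG_chain_count_le p0 p1 pQ k) _.
rewrite ler_wpM2l ?chain_const_ge0 // ler_wpM2l ?ler0n // ler_wpM2r ?energy_ge0 //.
apply: ler_weXn2l; first exact: (mass_ge1 p0 pQ).
by have := ltn_ord k; lia.
Qed.

(** * Nash's inequality and the decay of return probabilities *)

Section BoxPoints.
Variable (V : zmodType).

(** A generalized arithmetic progression, listed with repetitions; [uniq (box hs)] says that it is
    proper. *)
Fixpoint box (hs : seq (V * nat)) : seq V :=
  if hs is (h, c) :: r then [seq h *+ k + z | k <- iota 0 c, z <- box r] else [:: 0].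

Lemma size_box hs : size (box hs) = \prod_(q <- hs) q.2.
Proof.
elim: hs => [|[h c] r IH] /=; first by rewrite big_nil.
by rewrite size_allpairs size_iota IH big_cons.
Qed.

Lemma box_cons_uniq h c r : uniq (box r) ->
  (forall k k' w w', w \in box r -> w' \in box r ->
     h *+ k + w = h *+ k' + w' -> k = k') ->
  uniq (box ((h, c) :: r)).
Proof.
move=> ur H /=; apply: allpairs_uniq => //; first exact: iota_uniq.
move=> [k w] [k' w'] /= /allpairsP[[a b] [/= _ hb [-> ->]]] /allpairsP[[a' b'] [/= _ hb' [-> ->]]] e.
have ek := H _ _ _ _ hb hb' e; subst a'.
by move/addrI: e => ->.
Qed.

End BoxPoints.

Lemma map_box (U V : zmodType) (phi : {additive U -> V}) hs :
  map phi (box hs) = box [seq (phi q.1, q.2) | q <- hs].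
Proof.
elim: hs => [|[h c] r IH] /=; first by rewrite raddf0.
rewrite map_allpairs -IH; elim: (iota 0 c) => [//|k s IHs] /=.
rewrite IHs -map_comp; congr (_ ++ _).
by apply: eq_map => z /=; rewrite raddfD raddfMn.
Qed.

Section Nash.
Variables (R : realFieldType) (G : finZmodType).
Implicit Types (f : G -> R).

Definition N2 f : R := \sum_y f y ^+ 2.
Definition Dh f (h : G) : R := \sum_y (f (y + h) - f y) ^+ 2.

Lemma N2_ge0 f : 0 <= N2 f.
Proof. by apply: sumr_ge0 => y _; rewrite sqr_ge0. Qed.

Lemma Dh_ge0 f h : 0 <= Dh f h.
Proof. by apply: sumr_ge0 => y _; rewrite sqr_ge0. Qed.

Lemma N2_shift f h : \sum_y f (y + h) ^+ 2 = N2 f.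
Proof. by rewrite /N2 [RHS](reindex_inj (addIr h)). Qed.

Lemma N2_split f h : N2 f = Dh f h / 2 + \sum_y f y * f (y + h).
Proof.
have -> : Dh f h = \sum_y f (y + h) ^+ 2 + \sum_y f y ^+ 2 - 2 * \sum_y f y * f (y + h).
  rewrite big_distrr /= -big_split -sumrB /=; apply: eq_bigr => y _; ring.
by rewrite N2_shift -/(N2 f); field.
Qed.

Lemma DhD f h h' : Dh f (h + h') <= 2 * Dh f h + 2 * Dh f h'.
Proof.
rewrite /Dh [X in 2 * X + _](reindex_inj (addIr h')) /= !big_distrr -big_split /=.
apply: ler_sum => y _; rewrite (addrC h) addrA.
have := sqr_ge0 (f (y + h' + h) - f (y + h') - (f (y + h') - f y)).
rewrite !expr2; nra.
Qed.

Lemma DhMn f h k : Dh f (h *+ k) <= k%:R ^+ 2 * Dh f h.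
Proof.
have step (j : nat) : \sum_y (f (y + h *+ j.+1) - f (y + h *+ j)) ^+ 2 = Dh f h.
  rewrite /Dh [RHS](reindex_inj (addIr (h *+ j))) /=; apply: eq_bigr => y _.
  by rewrite mulrSr addrA.
apply: (@le_trans _ _ (\sum_y k%:R * \sum_(j < k) (f (y + h *+ j.+1) - f (y + h *+ j)) ^+ 2)).
  apply: ler_sum => y _.
  apply: le_trans (sqr_sum_le _).
  have -> : \sum_(i < k) (f (y + h *+ i.+1) - f (y + h *+ i)) = f (y + h *+ k) - f y.
    rewrite -(big_mkord xpredT (fun i => f (y + h *+ i.+1) - f (y + h *+ i))).
    by rewrite (telescope_sumr (fun i => f (y + h *+ i))) // mulr0n addr0.
  by [].
rewrite -big_distrr exchange_big /=.
under eq_bigr do rewrite step.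
by rewrite sumr_const card_ord -[Dh f h *+ k]mulr_natl mulrA -expr2.
Qed.

Lemma Dh_box f hs z : z \in box hs ->
  Dh f z <= 2 ^+ size hs * \sum_(q <- hs) q.2%:R ^+ 2 * Dh f q.1.
Proof.
elim: hs z => [|[h c] r IH] z /=.
  rewrite inE => /eqP ->; rewrite big_nil mulr0 /Dh big1 // => y _.
  by rewrite addr0 subrr expr0n.
move=> /allpairsP[[k w] /= [hk hw ->]]; rewrite big_cons /= exprS.
apply: le_trans (DhD _ _ _) _.
rewrite -mulrA -mulrDr ler_pM2l ?ltr0n // mulrDr lerD ?IH //.
apply: le_trans (DhMn _ _ _) _.
have hk' : (k <= c)%N by move: hk; rewrite mem_iota; lia.
rewrite -[leLHS]mul1r ler_pM ?mulr_ge0 ?sqr_ge0 ?Dh_ge0 //.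
  by rewrite exprn_ege1 // ler1n.
by rewrite ler_wpM2r ?Dh_ge0 // lerXn2r ?nnegrE ?ler0n // ler_nat.
Qed.

(* Nash's inequality, from averaging [N2_split] over the box. *)
Lemma nash f hs : (forall y, 0 <= f y) -> \sum_y f y = 1 ->
  uniq (box hs) -> (0 < \prod_(q <- hs) q.2)%N ->
  N2 f <= 2 ^+ size hs * (\sum_(q <- hs) q.2%:R ^+ 2 * Dh f q.1) / 2 +
          (\prod_(q <- hs) q.2)%:R^-1.
Proof.
move=> f0 f1 ub; rewrite -size_box; set M := size (box hs) => M0.
set B := 2 ^+ _ * _.
have M0R : 0 < M%:R :> R by rewrite ltr0n.
rewrite -(ler_pM2l M0R) mulrDr mulfV ?gt_eqF //.
have -> : M%:R * N2 f = \sum_(z <- box hs) N2 f.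
  by rewrite big_const_seq count_predT iter_addr addr0 mulr_natl.
apply: (@le_trans _ _ (\sum_(z <- box hs) (B / 2 + \sum_y f y * f (y + z)))).
  rewrite big_seq [leRHS]big_seq; apply: ler_sum => z hz.
  by rewrite (N2_split f z) lerD2r ler_pM2r ?invr_gt0 ?ltr0n // Dh_box.
rewrite big_split /= lerD //.
  by rewrite big_const_seq count_predT iter_addr addr0 [leRHS]mulr_natl.
(* The points of the box are distinct, so the values of [f] at y + z sum to at most the total mass
   1. *)
rewrite exchange_big /= -[leRHS]f1; apply: ler_sum => y _.
rewrite -big_distrr /= ler_piMr //.
rewrite big_uniq //= -[leRHS]f1 [leRHS](reindex_inj (addrI y)) /=.
by rewrite [leRHS](bigID (mem (box hs))) /= lerDl sumr_ge0.
Qed.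

Variable p : G -> R.
Hypotheses (p_ge0 : forall g, 0 <= p g) (p_sum1 : \sum_g p g = 1).

(** The Dirichlet form of the symmetrized step, the difference of two independent steps of law
    [p]. *)
Definition Dform f : R := (\sum_v \sum_w p v * p w * Dh f (v - w)) / 2.

(** Squaring the convolution produces the correlations of [f] at the differences v - w, and
    [N2_split] turns each into [Dh]. Symmetrization thus comes for free, and one step dissipates
    exactly [Dform]. *)
Lemma N2_conv f : N2 (fun x => \sum_g p g * f (x - g)) = N2 f - Dform f.
Proof.
transitivity (\sum_v \sum_w p v * p w * (N2 f - Dh f (v - w) / 2)).
  transitivity (\sum_v \sum_w p v * p w * \sum_x f (x - v) * f (x - w)).
    rewrite /N2.
    rewrite (eq_bigr (fun x => \sum_v \sum_w p v * p w * (f (x - v) * f (x - w)))); last first.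
      move=> x _; rewrite expr2 big_distrlr /=; apply: eq_bigr => v _.
      by apply: eq_bigr => w _; ring.
    rewrite exchange_big /=; apply: eq_bigr => v _.
    rewrite exchange_big /=; apply: eq_bigr => w _.
    by rewrite big_distrr.
  apply: eq_bigr => v _; apply: eq_bigr => w _; congr (_ * _).
  rewrite {1}(N2_split f (v - w)) addrC addKr (reindex_inj (addIr v)) /=.
  by apply: eq_bigr => y _; rewrite addrK addrA.
transitivity (\sum_v \sum_w (p v * p w * N2 f - p v * p w * Dh f (v - w) / 2)).
  by apply: eq_bigr => v _; apply: eq_bigr => w _; ring.
rewrite (eq_bigr (fun v => p v * N2 f - (\sum_w p v * p w * Dh f (v - w)) / 2)).
  by rewrite sumrB -!mulr_suml p_sum1 mul1r.
move=> v _; rewrite sumrB -!mulr_suml -mulr_sumr p_sum1 mulr1 //.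
Qed.

Lemma Dform_ge f w0 : p w0 / 2 * \sum_v p v * Dh f (v - w0) <= Dform f.
Proof.
rewrite /Dform mulrAC ler_pM2r ?invr_gt0 ?ltr0n // mulr_sumr.
apply: ler_sum => v _; rewrite (bigD1 w0) //= mulrCA mulrA lerDl.
by apply: sumr_ge0 => w _; rewrite !mulr_ge0 ?Dh_ge0.
Qed.

Lemma Dform_ge0 f : 0 <= Dform f.
Proof.
rewrite mulr_ge0 ?invr_ge0 ?ler0n //.
by do 2! (apply: sumr_ge0 => ? _); rewrite !mulr_ge0 ?Dh_ge0.
Qed.

Lemma N2_pnS m : N2 (pn p m.+1) = N2 (pn p m) - Dform (pn p m).
Proof. exact: N2_conv. Qed.

Lemma N2_pn0 : N2 (pn p 0) = 1.
Proof.
rewrite /N2 (bigD1 0) //= /pn eqxx expr1n big1 ?addr0 // => x /negbTE ->.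
by rewrite expr0n.
Qed.

Lemma N2_pn_homo m m' : (m <= m')%N -> N2 (pn p m') <= N2 (pn p m).
Proof.
elim: m' => [|m' IH]; first by rewrite leqn0 => /eqP ->.
rewrite leq_eqVlt => /orP[/eqP -> //|]; rewrite ltnS => /IH; apply: le_trans.
by rewrite N2_pnS lerBlDr lerDl Dform_ge0.
Qed.

Lemma pn_double_le m x : pn p (m + m) x <= N2 (pn p m).
Proof.
rewrite pnD.
apply: (@le_trans _ _ (\sum_y (pn p m y ^+ 2 / 2 + pn p m (x - y) ^+ 2 / 2))).
  apply: ler_sum => y _; have := sqr_ge0 (pn p m y - pn p m (x - y)); rewrite !expr2; lra.
have e : \sum_y pn p m (x - y) ^+ 2 = N2 (pn p m).
  by rewrite /N2 [RHS](reindex_inj (subrI x)).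
by rewrite big_split /= -!mulr_suml e -/(N2 _) -splitr.
Qed.

Lemma pn_sup_homo m k q x : (forall y, pn p m y <= q) -> pn p (k + m) x <= q.
Proof.
move=> h; rewrite pnD.
apply: (@le_trans _ _ (\sum_y pn p k y * q)).
  by apply: ler_sum => y _; rewrite ler_wpM2l ?pn_ge0.
by rewrite -mulr_suml sum_pn // mul1r.
Qed.

Lemma pn_le1 m x : pn p m x <= 1.
Proof.
rewrite -(sum_pn p_sum1 m) (bigD1 x) //= lerDl.
by apply: sumr_ge0 => y _; apply: pn_ge0.
Qed.

End Nash.

Section Doubling.
Variables (R : realFieldType) (a : nat -> R) (d s : nat) (C eps : R).
Hypotheses (a_ge0 : forall m, 0 <= a m) (C_ge0 : 0 <= C) (eps_ge0 : 0 <= eps).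
Hypothesis a_homo : forall m m', (m <= m')%N -> a m' <= a m.
Hypothesis Cs : 2 ^+ d * C <= 4 ^+ s.

(* Sum the inequality over [4 ^ j <= m < 4 ^ j.+1] and use that [a] decreases. *)
Lemma doubling_step j : (s <= j)%N ->
  (forall m, a m <= C * (2 ^+ (j - s)) ^+ 2 * (a m - a m.+1) + eps / (2 ^+ (j - s)) ^+ d) ->
  a (4 ^ j.+1)%N * 2 ^+ (j.+1 * d) <=
  a (4 ^ j)%N * 2 ^+ (j * d) / 2 + eps * 2 ^+ (s.+1 * d).
Proof.
move=> sj H; pose l : R := 2 ^+ (j - s).
have {}H m : a m <= C * l ^+ 2 * (a m - a m.+1) + eps / l ^+ d := H m.
have l0 : 0 < l by rewrite exprn_gt0 ?ltr0n.
have p4 : (4 ^ j < 4 ^ j.+1)%N by rewrite ltn_exp2l.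
have S : (3 * 4 ^ j)%N%:R * a (4 ^ j.+1)%N <=
   C * l ^+ 2 * a (4 ^ j)%N + (3 * 4 ^ j)%N%:R * (eps / l ^+ d).
  apply: (@le_trans _ _ (\sum_(4 ^ j <= m < 4 ^ j.+1)
      (C * l ^+ 2 * (a m - a m.+1) + eps / l ^+ d))).
    rewrite -[(3 * 4 ^ j)%N](_ : (4 ^ j.+1 - 4 ^ j)%N = _); last by rewrite expnS; lia.
    rewrite mulr_natl -[leLHS]addr0 -iter_addr -big_const_nat.
    apply: ler_sum_nat => m /andP[_ h2]; apply: le_trans (H m).
    by apply: a_homo; apply: ltnW.
  rewrite big_split /= -mulr_sumr lerD //.
    rewrite ler_wpM2l ?mulr_ge0 ?exprn_ge0 ?(ltW l0) //.
    rewrite (eq_bigr (fun m => - (a m.+1 - a m))); last by move=> m _; rewrite opprB.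
    by rewrite sumrN telescope_sumr ?(ltnW p4) // opprB lerBlDr lerDl.
  rewrite big_const_nat iter_addr addr0 mulr_natl.
  by rewrite (_ : (4 ^ j.+1 - 4 ^ j)%N = (3 * 4 ^ j)%N) //; rewrite expnS; lia.
have l2 : l ^+ 2 * 4 ^+ s = 4 ^+ j.
  rewrite /l -exprM mulnC exprM -natrX (_ : (2 ^ 2)%N = 4%N) // -exprD; congr (_ ^+ _).
  by rewrite subnK.
have ld : l ^+ d * 2 ^+ (s * d) = 2 ^+ (j * d).
  by rewrite /l -!exprM -exprD -mulnDl subnK.
rewrite natrM natrX in S.
have t0 : 0 < (3 : R) * 4 ^+ j by rewrite mulr_gt0 ?exprn_gt0 ?ltr0n.
have lnz : l ^+ d != 0 by rewrite gt_eqF // exprn_gt0.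
have S1 : (3 * 4 ^+ j) * (a (4 ^ j.+1)%N * 2 ^+ (j.+1 * d)) <=
   (3 * 4 ^+ j) * (a (4 ^ j)%N * 2 ^+ (j * d) / 2 + eps * 2 ^+ (s.+1 * d)).
  rewrite mulrA.
  have pd0 : 0 <= (2 : R) ^+ (j.+1 * d) by rewrite exprn_ge0 ?ler0n.
  apply: le_trans (ler_wpM2r pd0 S) _.
  rewrite mulrDl mulrDr lerD //.
    have -> : C * l ^+ 2 * a (4 ^ j)%N * 2 ^+ (j.+1 * d) =
       (2 ^+ d * C) * (l ^+ 2 * a (4 ^ j)%N * 2 ^+ (j * d)).
      by rewrite mulSn exprD; ring.
    have X0 : 0 <= l ^+ 2 * a (4 ^ j)%N * 2 ^+ (j * d).
      by rewrite !mulr_ge0 ?exprn_ge0 ?(ltW l0) ?ler0n.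
    (* The choice of [s] makes [2 ^+ d * C * l ^+ 2] at most [4 ^+ j], a third of the number of
       times in the block, which is better than the factor 1/2 that is claimed. *)
    apply: le_trans (ler_wpM2r X0 Cs) _.
    have -> : 4 ^+ s * (l ^+ 2 * a (4 ^ j)%N * 2 ^+ (j * d)) =
        4 ^+ j * (a (4 ^ j)%N * 2 ^+ (j * d)) by rewrite -l2; ring.
    have Y0 : 0 <= 4 ^+ j * (a (4 ^ j)%N * 2 ^+ (j * d)).
      by rewrite !mulr_ge0 ?exprn_ge0 ?ler0n.
    have -> : 3 * 4 ^+ j * (a (4 ^ j)%N * 2 ^+ (j * d) / 2) =
       3 / 2 * (4 ^+ j * (a (4 ^ j)%N * 2 ^+ (j * d))) by field.
    by move: Y0; lra.
  have -> : 2 ^+ (j.+1 * d) = 2 ^+ d * (l ^+ d * 2 ^+ (s * d)) :> R.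
    by rewrite ld -exprD mulSn.
  rewrite mulSn exprD; apply: ler_of_eq.
  transitivity (3 * 4 ^+ j * (eps * (2 ^+ d * 2 ^+ (s * d))) * ((l ^+ d)^-1 * l ^+ d)).
    by ring.
  by rewrite mulVf // mulr1.
by rewrite -(ler_pM2l t0).
Qed.

(** Each step halves the previous value and adds a multiple of [eps], so the start is forgotten
    geometrically and [eps] alone governs the limit. Only scales below [J] occur, because a given
    torus obeys the lattice inequality only up to the scale where boxes wrap around. *)
Lemma doubling j0 J : (s <= j0)%N ->
  (forall j m, (j0 <= j < J)%N -> a m <= C * (2 ^+ (j - s)) ^+ 2 * (a m - a m.+1)
     + eps / (2 ^+ (j - s)) ^+ d) ->
  forall j, (j0 <= j <= J)%N ->
  a (4 ^ j)%N * 2 ^+ (j * d) <=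
  a (4 ^ j0)%N * 2 ^+ (j0 * d) / 2 ^+ (j - j0) + 2 * (eps * 2 ^+ (s.+1 * d)).
Proof.
move=> sj0 H.
have base : a (4 ^ j0)%N * 2 ^+ (j0 * d) <=
  a (4 ^ j0)%N * 2 ^+ (j0 * d) / 2 ^+ (j0 - j0) + 2 * (eps * 2 ^+ (s.+1 * d)).
  by rewrite subnn (expr0 2) invr1 mulr1 lerDl !mulr_ge0 ?exprn_ge0 ?ler0n.
elim=> [|j IH] /andP[h1 h2].
  have e : 0%N = j0 by lia.
  by rewrite [X in a (4 ^ X)%N * 2 ^+ (X * d) <= _]e [X in (X - j0)%N]e.
case: (eqVneq j0 j.+1) => [<- //|nj].
have hj : (j0 <= j)%N by lia.
have IH' := IH (introT andP (conj hj (ltnW h2))).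
have st := doubling_step (leq_trans sj0 hj) (fun m => H j m (introT andP (conj hj h2))).
apply: (le_trans st); rewrite subSn // exprS invfM.
set A := a (4 ^ j)%N * _ in IH' *; set B := a (4 ^ j0)%N * _ in IH' *.
set E := eps * _ in IH' *; set D := (2 ^+ (j - j0))^-1 in IH' *.
have -> : B * (2^-1 * D) = B * D / 2 by ring.
lra.
Qed.

End Doubling.

(** * The torus and Nash's inequality with lattice constants *)

Definition tproj (N d : nat) : 'rV[int]_d -> 'rV['I_N.+2]_d := map_mx intr.
HB.instance Definition _ N d :=
  GRing.Additive.copy (@tproj N d) (map_mx (intr : int -> 'I_N.+2)).

Lemma intr_Zp_eq0 N (k : int) : (k%:~R : 'I_N.+2) = 0 -> (`|k| < N.+2)%N -> k = 0.
Proof.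
have key n : (n%:R : 'I_N.+2) = 0 -> (n < N.+2)%N -> n = 0%N.
  by rewrite Zp_nat => /(congr1 val) /= + h; rewrite modn_small.
case: k => n h hn; first by rewrite (key n).
have : (n.+1%:R : 'I_N.+2) = 0 by apply/eqP; rewrite -oppr_eq0; apply/eqP.
by move/key => /(_ hn).
Qed.

Lemma tproj_eq0 N d (z : 'rV[int]_d) : tproj N z = 0 ->
  (forall i, `|z ord0 i| < N.+2)%N -> z = 0.
Proof.
move=> h hz; apply/rowP => i; rewrite mxE; apply: (@intr_Zp_eq0 N); last exact: hz.
by have /rowP/(_ i) := h; rewrite !mxE.
Qed.

Lemma tproj_inj_on d (s : seq 'rV[int]_d) :
  exists N0, forall N, (N0 <= N)%N -> {in s &, injective (@tproj N d)}.
Proof.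
exists (\sum_(z <- s) \sum_(z' <- s) \sum_i absz ((z - z')%R ord0 i))%N => N hN z z' hz hz' e.
apply/eqP; rewrite -subr_eq0; apply/eqP; apply: (@tproj_eq0 N).
  by rewrite raddfB /= e subrr.
move=> i; apply: (@leq_ltn_trans N); last lia.
apply: leq_trans hN.
rewrite (big_rem z) //= (big_rem z') //= (bigD1 i) //=.
by rewrite -!addnA leq_addr.
Qed.

Section ToReal.
Variables (R : realType) (d : nat).
Implicit Types z : 'rV[int]_d.

Lemma toRD z z' : toR (z + z') = toR z + toR z' :> 'rV[R]_d.
Proof. by apply/rowP => i; rewrite !mxE intrD. Qed.

Lemma toRN z : toR (- z) = - toR z :> 'rV[R]_d.
Proof. by apply/rowP => i; rewrite !mxE intrN. Qed.

Lemma toRB z z' : toR (z - z') = toR z - toR z' :> 'rV[R]_d.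
Proof. by rewrite toRD toRN. Qed.

Lemma toR0 : toR 0 = 0 :> 'rV[R]_d.
Proof. by apply/rowP => i; rewrite !mxE. Qed.

End ToReal.

Section NashLattice.
Variables (R : realType) (d : nat) (mu : 'rV[int]_d -> R).
Variables (x0 : 'rV[int]_d) (a : 'I_d -> 'rV[int]_d) (rmin : R).
Hypotheses (mu_ge0 : forall z, 0 <= mu z) (mu_x0 : 0 < mu x0) (rmin_gt0 : 0 < rmin).
Hypothesis mu_a : forall r, rmin <= mu (a r).

Definition basis_mx : 'M[R]_d := \matrix_r toR (a r - x0).
Hypothesis basis_unit : basis_mx \in unitmx.

(** Coordinates in the basis of differences of atoms. On a box of basis steps they are natural
    numbers, which separates its points. *)
Definition coord (z : 'rV[int]_d) (r : 'I_d) : R := (toR z *m invmx basis_mx) ord0 r.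

Lemma coordD z z' r : coord (z + z') r = coord z r + coord z' r.
Proof. by rewrite /coord toRD mulmxDl mxE. Qed.

Lemma coordMn z k r : coord (z *+ k) r = k%:R * coord z r.
Proof.
elim: k => [|k IH]; first by rewrite mulr0n mul0r /coord toR0 mul0mx mxE.
by rewrite mulrS coordD IH -[in RHS]add1n natrD mulrDl mul1r.
Qed.

Lemma coord0 r : coord 0 r = 0.
Proof. by rewrite /coord toR0 mul0mx mxE. Qed.

Lemma coord_basis r r' : coord (a r - x0) r' = (r == r')%:R.
Proof.
rewrite /coord; have -> : toR (a r - x0) = row r basis_mx by rewrite rowK.
by rewrite -row_mul mulmxV // !mxE.
Qed.

Lemma toR_coord z : toR z = (\row_r coord z r) *m basis_mx.
Proof.
have -> : \row_r coord z r = toR z *m invmx basis_mx by apply/rowP => r; rewrite mxE.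
by rewrite mulmxKV.
Qed.

Definition basis_steps (c : 'I_d -> nat) (l : seq 'I_d) := [seq (a r - x0, c r) | r <- l].

Lemma box_coord c l w r : w \in box (basis_steps c l) -> uniq l ->
  exists2 k : nat, coord w r = k%:R & (k <= (c r).-1)%N.
Proof.
elim: l w => [|r' l IH] w /=.
  by rewrite inE => /eqP -> _; exists 0%N; rewrite ?coord0.
move=> /allpairsP[[k w'] /= [hk hw ->]] /andP[r'l ul].
have [k' e' hk'] := IH _ hw ul.
rewrite coordD coordMn coord_basis e'; case: (eqVneq r' r) => [e|_]; last first.
  by exists k'; rewrite ?mulr0 ?add0r.
have -> : k' = 0%N.
  suff : coord w' r = 0 by rewrite e' => /eqP; rewrite pnatr_eq0 => /eqP.
  move: hw r'l; rewrite e; elim: (l) (w') => [|r2 l2 IH2] w2 /=.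
    by rewrite inE => /eqP ->; rewrite coord0.
  move=> /allpairsP[[k2 w3] /= [_ hw3 ->]]; rewrite inE negb_or => /andP[n2 hl2].
  by rewrite coordD coordMn coord_basis eq_sym (negbTE n2) mulr0 add0r IH2.
exists k; first by rewrite mulr1 addr0.
by move: hk; rewrite mem_iota e; lia.
Qed.

Lemma box_coord_notin c l w r : w \in box (basis_steps c l) -> r \notin l -> coord w r = 0.
Proof.
elim: l w => [|r' l IH] w /=; first by rewrite inE => /eqP -> _; rewrite coord0.
move=> /allpairsP[[k w'] /= [_ hw ->]]; rewrite inE negb_or => /andP[n1 n2].
by rewrite coordD coordMn coord_basis eq_sym (negbTE n1) mulr0 add0r IH.
Qed.

Lemma box_basis_uniq c l : uniq l -> uniq (box (basis_steps c l)).
Proof.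
elim: l => [//|r l IH] /andP[rl ul]; apply: box_cons_uniq; first exact: IH.
move=> k k' w w' hw hw' /(congr1 (fun z => coord z r)).
rewrite !coordD !coordMn coord_basis eqxx !mulr1 (box_coord_notin hw) // (box_coord_notin hw') //.
by rewrite !addr0 => /eqP; rewrite eqr_nat => /eqP.
Qed.

(** If two points with different multiples of [h] coincided, their basis parts would differ along
    [i0] by at least the coordinate of [h], while the box extends only to [(c i0).-1] in that
    direction. So any number [L] of multiples is allowed. *)
Lemma box_long_uniq c (i0 : 'I_d) (h : 'rV[int]_d) L :
  ((c i0).-1)%:R < `|coord h i0| ->
  uniq (box ((h, L) :: basis_steps c (enum 'I_d))).
Proof.
move=> hc; apply: box_cons_uniq; first exact/box_basis_uniq/enum_uniq.
move=> k k' w w' hw hw' /(congr1 (fun z => coord z i0)).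
rewrite !coordD !coordMn.
have [j -> hj] := box_coord i0 hw (enum_uniq _).
have [j' -> hj'] := box_coord i0 hw' (enum_uniq _) => e.
apply/eqP; rewrite -(eqr_nat R) -subr_eq0; apply/negPn/negP => nk.
have e2 : (k%:R - k'%:R) * coord h i0 = j'%:R - j%:R.
  by rewrite mulrBl; apply/eqP; rewrite subr_eq addrAC eq_sym subr_eq eq_sym e addrC.
have h1 : 1 <= `|k%:R - k'%:R : R|.
  have -> : k%:R - k'%:R = (k%:Z - k'%:Z)%:~R :> R by rewrite intrB.
  rewrite -intr_norm ler1z; suff : (0 < `|k%:Z - k'%:Z|)%R by [].
  by rewrite normr_gt0 -(intr_eq0 R) intrB.
have h2 : `|j'%:R - j%:R : R| <= ((c i0).-1)%:R.
  have := ler0n R j; have := ler0n R j'.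
  have : j%:R <= ((c i0).-1)%:R :> R by rewrite ler_nat.
  have : j'%:R <= ((c i0).-1)%:R :> R by rewrite ler_nat.
  by move=> q1 q2 q3 q4; rewrite ler_norml; apply/andP; split; lra.
have : `|coord h i0| <= `|k%:R - k'%:R : R| * `|coord h i0| by rewrite ler_peMl.
by rewrite -normrM e2 => /le_trans /(_ h2) /le_lt_trans /(_ hc); rewrite ltxx.
Qed.

(* [p] is at least the image of every finite part of [mu]; quantifying over finite
   lists avoids infinite sums over Z^d. *)
Definition dominates (N : nat) (p : 'rV['I_N.+2]_d -> R) : Prop :=
  forall (F : seq 'rV[int]_d) g, uniq F -> \sum_(z <- F | tproj N z == g) mu z <= p g.

(** Only the pairs of steps whose second member is [x0] are kept, so the Dirichlet form controls the
    shifts z - x0 themselves. *)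
Lemma Dform_dominated N (p : 'rV['I_N.+2]_d -> R) (f : 'rV['I_N.+2]_d -> R) F :
  (forall g, 0 <= p g) -> dominates p -> uniq F ->
  mu x0 / 2 * \sum_(z <- F) mu z * Dh f (tproj N (z - x0)) <= Dform p f.
Proof.
move=> p0 pd uF; apply: le_trans (Dform_ge p0 f (tproj N x0)).
have px0 : mu x0 <= p (tproj N x0).
  by have := pd [:: x0] (tproj N x0) isT; rewrite big_cons big_nil eqxx addr0.
have S0 : 0 <= \sum_v p v * Dh f (v - tproj N x0).
  by apply: sumr_ge0 => v _; rewrite mulr_ge0 ?Dh_ge0.
apply: (@le_trans _ _ (mu x0 / 2 * \sum_v p v * Dh f (v - tproj N x0))); last first.
  by rewrite ler_wpM2r // ler_pM2r ?invr_gt0.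
rewrite ler_wpM2l ?mulr_ge0 ?invr_ge0 ?mu_ge0 //.
apply: (@le_trans _ _ (\sum_v (\sum_(z <- F | tproj N z == v) mu z) * Dh f (v - tproj N x0))).
  rewrite (partition_big (@tproj N d) xpredT) //=; apply: ler_of_eq.
  apply: eq_bigr => v _; rewrite mulr_suml; apply: eq_bigr => z /eqP <-.
  by rewrite raddfB.
by apply: ler_sum => v _; rewrite ler_wpM2r ?Dh_ge0 ?pd.
Qed.

Definition nash_const : R := 2 ^+ d * (4 + d)%:R * 2 / (rmin * mu x0).

(* For [z] in [F] the box spanned by the basis steps and about [lam * l / |coord|]
   multiples of [z - x0] has about [lam * l ^ d] points.  Averaging Nash's inequality
   over [F] with weights [mu z * coord ^ 2] keeps the factor [lam]. *)
Lemma nash_lattice (i0 : 'I_d) (F : seq 'rV[int]_d) (lam : nat) : uniq F -> (0 < lam)%N ->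
  lam%:R ^+ 2 * rmin <= \sum_(z <- F) mu z * coord (z - x0) i0 ^+ 2 ->
  exists2 l0 : nat, (0 < l0)%N & forall l, (l0 <= l)%N -> exists N0, forall N, (N0 <= N)%N ->
    forall (p f : 'rV['I_N.+2]_d -> R), (forall g, 0 <= p g) -> dominates p ->
    (forall y, 0 <= f y) -> \sum_y f y = 1 ->
    N2 f <= nash_const * l%:R ^+ 2 * Dform p f + 2 / lam%:R / l%:R ^+ d.
Proof.
move=> uF lam0 hK.
pose c z := `|coord (z - x0) i0|.
(* This bounds [c z] by [l] for every z in [F]: the shortened side [n1 z] is then at most [l], and
   the quotient in [L1 z] is at least 1. *)
exists (\sum_(z <- F) (Num.truncn (c z)).+1).+1 => // l hl.
have lc z : z \in F -> c z <= l%:R.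
  move=> hz; apply: ltW; apply: (lt_le_trans (truncnS_gt _)); rewrite ler_nat.
  apply: leq_trans (ltnW hl); rewrite (big_rem z) //=; exact: leq_addr.
have l1 : (0 < l)%N by apply: leq_ltn_trans hl.
(* The side along [i0] is cut down to about [c z], which makes room for [L1 z] multiples of z - x0
   without collision. For nonzero [c z] the box still has at least half of [lam * l ^ d] points. *)
pose n1 z := maxn 1 (Num.truncn (c z)).
pose L1 z := (Num.truncn (lam%:R * l%:R / c z)).+1.
pose hs z := (z - x0, L1 z) :: basis_steps (fun r => if r == i0 then n1 z else l) (enum 'I_d).
have [N0 HN0] := tproj_inj_on (flatten [seq box (hs z) | z <- F]).
exists N0 => N hN p f p0 pd f0 f1.
pose D z := Dh f (tproj N (z - x0)).
pose A := \sum_r D (a r).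
have D0 z : 0 <= D z by apply: Dh_ge0.
have A0 : 0 <= A by apply: sumr_ge0 => r _.
have lR : 0 < l%:R :> R by rewrite ltr0n.
have lamR : 0 < lam%:R :> R by rewrite ltr0n.
have key z : z \in F -> c z != 0 ->
   N2 f <= 2 ^+ d * (4 * lam%:R ^+ 2 * l%:R ^+ 2 / c z ^+ 2 * D z + l%:R ^+ 2 * A)
           + 2 / lam%:R / l%:R ^+ d.
  move=> zF cz.
  have cz0 : 0 < c z by rewrite lt_def cz normr_ge0.
  have q0 : 0 <= lam%:R * l%:R / c z by rewrite !mulr_ge0 ?invr_ge0 ?ler0n ?(ltW cz0).
  have ub : uniq (box [seq (tproj N q.1, q.2) | q <- hs z]).
    rewrite -map_box map_inj_in_uniq; last first.
      move=> w w' hw hw'; apply: HN0 => //; apply/flattenP; exists (box (hs z)) => //;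
        by apply/mapP; exists z.
    apply: (@box_long_uniq _ i0); rewrite eqxx /n1 -/(c z).
    case: (leqP (Num.truncn (c z)) 1) => h //.
    apply: (@lt_le_trans _ _ (Num.truncn (c z))%:R); last by rewrite truncn_le ltW.
    by rewrite ltr_nat; case: (Num.truncn _) h.
  have prodE : (\prod_(q <- [seq (tproj N q.1, q.2) | q <- hs z]) q.2 =
      L1 z * (n1 z * l ^ d.-1))%N.
    rewrite big_map big_cons /= big_map; congr (_ * _)%N.
    rewrite big_enum /= (bigD1 i0) //= eqxx; congr (_ * _)%N.
    rewrite (eq_bigr (fun=> l)) => [|r /negbTE -> //].
    rewrite prod_nat_const; congr (_ ^ _)%N.
    by rewrite cardC1 card_ord.
  have n1p : (0 < n1 z)%N by rewrite leq_maxl.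
  have prod0 : (0 < \prod_(q <- [seq (tproj N q.1, q.2) | q <- hs z]) q.2)%N.
    by rewrite prodE !muln_gt0 n1p expn_gt0 l1.
  have := nash f0 f1 ub prod0; rewrite prodE => /le_trans; apply.
  have dpos : (0 < d)%N by apply: leq_ltn_trans (ltn_ord i0).
  have ld : l%:R ^+ d = l%:R * l%:R ^+ d.-1 :> R by rewrite -exprS prednK.
  rewrite size_map /= size_map size_enum_ord lerD //.
    rewrite exprSr mulrAC -[_ * 2 / 2]mulrA mulfV // mulr1 ler_pM2l ?exprn_gt0 //.
    rewrite big_cons /= 2!big_map big_enum /= lerD //.
      rewrite -/(D z) !mulrA ler_wpM2r // -!mulrA.
      have h1 : (L1 z)%:R <= 2 * (lam%:R * l%:R / c z).
        rewrite /L1 -natr1.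
        have : (Num.truncn (lam%:R * l%:R / c z))%:R <= lam%:R * l%:R / c z by rewrite truncn_le.
        have : 1 <= lam%:R * l%:R / c z.
          rewrite ler_pdivlMr // mul1r (le_trans (lc z zF)) // ler_peMl ?ler0n //.
          by rewrite ler1n.
        by move=> q1 q2; lra.
      have h2 : (L1 z)%:R ^+ 2 <= (2 * (lam%:R * l%:R / c z)) ^+ 2.
        by rewrite lerXn2r ?nnegrE ?ler0n ?mulr_ge0 // ?invr_ge0 ?(ltW cz0) // ?ler0n // mulr_ge0 ?ler0n.
      apply: (le_trans h2); apply: ler_of_eq.
      by rewrite !exprMn exprVn; ring.
    rewrite mulr_sumr; apply: ler_sum => r _; rewrite -/(D (a r)) ler_wpM2r //.
    rewrite lerXn2r ?nnegrE ?ler0n // ler_nat; case: ifP => // _.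
    rewrite /n1 geq_max l1 /= -(ler_nat R); apply: le_trans (lc z zF).
    by rewrite truncn_le ltW.
  have LN : lam%:R * l%:R / 2 <= (L1 z)%:R * (n1 z)%:R :> R.
    have hL : lam%:R * l%:R / c z <= (L1 z)%:R by apply: ltW; apply: truncnS_gt.
    have hn : c z / 2 <= (n1 z)%:R.
      case: (ltP (c z) 2) => h2.
        by apply: (@le_trans _ _ 1); [lra|rewrite ler1n].
      apply: (@le_trans _ _ (Num.truncn (c z))%:R); last by rewrite ler_nat leq_maxr.
      have := truncnS_gt (c z); rewrite -natr1; lra.
    have -> : lam%:R * l%:R / 2 = (lam%:R * l%:R / c z) * (c z / 2).
      by rewrite mulrA mulfVK.
    by rewrite ler_pM // mulr_ge0 ?invr_ge0 ?ler0n ?(ltW cz0).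
  have -> : 2 / lam%:R / l%:R ^+ d = (lam%:R * l%:R / 2 * l%:R ^+ d.-1)^-1 :> R.
    by rewrite ld !invfM invrK; ring.
  rewrite lef_pV2 ?posrE; last 2 first.
  - by rewrite ltr0n !muln_gt0 n1p expn_gt0 l1.
  - by rewrite !mulr_gt0 ?invr_gt0 ?exprn_gt0.
  by rewrite !natrM natrX mulrA ler_wpM2r ?exprn_ge0 ?ler0n.
pose K := \sum_(z <- F) mu z * coord (z - x0) i0 ^+ 2.
pose E := 2 ^+ d * (l%:R ^+ 2 * A) + 2 / lam%:R / l%:R ^+ d.
have E0 : 0 <= E.
  by rewrite addr_ge0 ?mulr_ge0 ?exprn_ge0 ?ler0n ?invr_ge0 ?exprn_ge0 ?ler0n.
(* The weight [c z ^+ 2] cancels the denominator in [key]. As [K] is at least [lam%:R ^+ 2 * rmin],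
   dividing by [K] then removes [lam] from the Dirichlet term and leaves it in the volume term
   only. *)
have S : K * N2 f <= 2 ^+ d * 4 * lam%:R ^+ 2 * l%:R ^+ 2 * (\sum_(z <- F) mu z * D z) + K * E.
  rewrite /K !mulr_suml mulr_sumr -big_split /= big_seq [leRHS]big_seq; apply: ler_sum => z zF.
  have e2 : coord (z - x0) i0 ^+ 2 = c z ^+ 2 by rewrite /c real_normK ?num_real.
  rewrite e2; case: (eqVneq (c z) 0) => [->|cz].
    rewrite expr0n /= mulr0 !mul0r addr0 !mulr_ge0 ?exprn_ge0 ?ler0n //.
  have w0 : 0 <= mu z * c z ^+ 2 by rewrite mulr_ge0 ?sqr_ge0.
  apply: le_trans (ler_wpM2l w0 (key z zF cz)) _.
  rewrite /E; apply: ler_of_eq.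
  have cc : c z ^+ 2 / c z ^+ 2 = 1 by rewrite mulfV // expf_neq0.
  transitivity (2 ^+ d * 4 * lam%:R ^+ 2 * l%:R ^+ 2 * (mu z * D z) * (c z ^+ 2 / c z ^+ 2) +
      mu z * c z ^+ 2 * (2 ^+ d * (l%:R ^+ 2 * A) + 2 / lam%:R / l%:R ^+ d)).
    by ring.
  by rewrite cc mulr1.
have K0 : 0 < K by apply: lt_le_trans hK; rewrite mulr_gt0 ?exprn_gt0.
have SD : \sum_(z <- F) mu z * D z <= 2 / mu x0 * Dform p f.
  rewrite mulrAC ler_pdivlMr // mulrC.
  by have := Dform_dominated f p0 pd uF; rewrite -/D mulrAC ler_pdivrMr //; rewrite (mulrC _ 2).
have Da r : D (a r) <= 2 / (rmin * mu x0) * Dform p f.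
  have := @Dform_dominated N p f [:: a r] p0 pd isT; rewrite big_seq1 -/(D (a r)) => h.
  rewrite mulrAC ler_pdivlMr ?mulr_gt0 //.
  have : rmin * D (a r) * mu x0 <= mu (a r) * D (a r) * mu x0.
    by rewrite ler_wpM2r ?(ltW mu_x0) // ler_wpM2r.
  move: h; set DD := Dform p f; set x := mu (a r) * D (a r); nra.
have AD : A <= d%:R * (2 / (rmin * mu x0) * Dform p f).
  apply: le_trans (ler_sum _ (fun r _ => Da r)) _.
  by rewrite sumr_const card_ord [leRHS]mulr_natl.
have DF0 := Dform_ge0 p0 f.
have NK : N2 f <= 2 ^+ d * 4 * l%:R ^+ 2 * ((\sum_(z <- F) mu z * D z) / rmin) + E.
  rewrite -(ler_pM2l K0); apply: (le_trans S); rewrite [leRHS]mulrDr lerD2r.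
  set Y := \sum_(z <- F) mu z * D z.
  have Y0 : 0 <= Y by apply: sumr_ge0 => z _; rewrite mulr_ge0.
  have -> : K * (2 ^+ d * 4 * l%:R ^+ 2 * (Y / rmin)) = (2 ^+ d * 4 * l%:R ^+ 2 * Y) * (K / rmin).
    by ring.
  have -> : 2 ^+ d * 4 * lam%:R ^+ 2 * l%:R ^+ 2 * Y =
     (2 ^+ d * 4 * l%:R ^+ 2 * Y) * lam%:R ^+ 2 by ring.
  by rewrite ler_wpM2l ?mulr_ge0 ?exprn_ge0 ?ler0n // ler_pdivlMr.
apply: (le_trans NK); rewrite /E addrA lerD2r /nash_const.
have r1 : (\sum_(z <- F) mu z * D z) / rmin <= 2 / (rmin * mu x0) * Dform p f.
  rewrite ler_pdivrMr //; apply: (le_trans SD); apply: ler_of_eq.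
  by rewrite invfM; field; rewrite !gt_eqF.
have B0 : 0 <= 2 ^+ d * l%:R ^+ 2 :> R by rewrite mulr_ge0 ?exprn_ge0 ?ler0n.
set W := 2 / (rmin * mu x0) * Dform p f in r1 AD.
have := ler_wpM2l B0 AD; have := ler_wpM2l B0 r1.
have -> : 2 ^+ d * (4 + d)%:R * 2 / (rmin * mu x0) * l%:R ^+ 2 * Dform p f =
    4 * (2 ^+ d * l%:R ^+ 2 * W) + 2 ^+ d * l%:R ^+ 2 * (d%:R * W).
  by rewrite /W natrD; ring.
set u1 := _ / rmin => h1 h2.
have -> : 2 ^+ d * 4 * l%:R ^+ 2 * u1 = 4 * (2 ^+ d * l%:R ^+ 2 * u1) by ring.
have -> : 2 ^+ d * (l%:R ^+ 2 * A) = 2 ^+ d * l%:R ^+ 2 * A by ring.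
lra.
Qed.

End NashLattice.

(** The size of torus required depends on the scale of the box; up to a given time only finitely
    many scales occur, and one size serves them all. *)
Lemma eventually_uniform (Pc : nat -> Prop) (Qc : nat -> nat -> Prop) :
  (forall l, Pc l -> exists N0, forall N, (N0 <= N)%N -> Qc l N) ->
  forall B, exists N0, forall l, (l <= B)%N -> Pc l -> forall N, (N0 <= N)%N -> Qc l N.
Proof.
move=> H; elim=> [|B [N0 hN0]].
  have [/H[N0 h]|nP] := pselect (Pc 0%N).
    by exists N0 => l; rewrite leqn0 => /eqP ->.
  by exists 0%N => l; rewrite leqn0 => /eqP -> /nP.
have [/H[N1 h1]|nP] := pselect (Pc B.+1).
  exists (maxn N0 N1) => l; rewrite leq_eqVlt => /orP[/eqP -> _ N hN|hl pl N hN].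
    by apply: h1; apply: leq_trans hN; apply: leq_maxr.
  by apply: hN0 => //; apply: leq_trans hN; apply: leq_maxl.
exists N0 => l; rewrite leq_eqVlt => /orP[/eqP -> /nP //|hl pl N hN].
exact: hN0.
Qed.

Section Decay.
Variables (R : realType) (d : nat) (mu : 'rV[int]_d -> R).
Variables (x0 : 'rV[int]_d) (a : 'I_d -> 'rV[int]_d) (rmin : R).
Hypotheses (mu_ge0 : forall z, 0 <= mu z) (mu_x0 : 0 < mu x0) (rmin_gt0 : 0 < rmin).
Hypothesis mu_a : forall r, rmin <= mu (a r).
Hypothesis basis_unit : basis_mx R x0 a \in unitmx.

(** This is [m] to the power d/2. *)
Definition sqd (m : nat) : R := Num.sqrt m%:R ^+ d.

Lemma sqd_gt0 m : (0 < m)%N -> 0 < sqd m.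
Proof. by move=> h; rewrite exprn_gt0 // sqrtr_gt0 ltr0n. Qed.

(** The constant [Cd] is fixed before [lam]: a second-moment sum of order [lam ^ 2] in one
    coordinate improves the bound by the factor [lam], at the price of a later starting time [m1].
    That time is uniform in [n], whereas the torus may depend on [n]. *)
Lemma pn_decay : exists2 Cd : R, 0 <= Cd & forall (i0 : 'I_d) F (lam : nat),
  uniq F -> (0 < lam)%N ->
  lam%:R ^+ 2 * rmin <= \sum_(z <- F) mu z * coord R x0 a (z - x0) i0 ^+ 2 ->
  exists m1, forall n, exists N0, forall N, (N0 <= N)%N ->
  forall p : 'rV['I_N.+2]_d -> R, (forall g, 0 <= p g) -> \sum_g p g = 1 ->
  dominates mu p -> forall m x, (m1 <= m <= n)%N -> pn p m x <= Cd / lam%:R / sqd m.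
Proof.
pose C := nash_const mu x0 rmin.
have C0 : 0 <= C by rewrite /C /nash_const !mulr_ge0 ?invr_ge0 ?mulr_ge0 ?exprn_ge0 ?ler0n ?(ltW rmin_gt0) ?mu_ge0.
pose s := Num.bound (2 ^+ d * C).
have Cs : 2 ^+ d * C <= 4 ^+ s.
  have h : 2 ^+ d * C < 2 ^+ s by apply: upper_nthrootP.
  apply: (le_trans (ltW h)); rewrite lerXn2r ?nnegrE ?ler0n //.
  by rewrite ler_nat.
(* The 6 is 3 times the 2 in [eps], where 3 is the 2 from [doubling] and 1 for the forgotten start.
   The power of 3 comes from m < 8 * 4^j, whose root is at most 3 * 2^j. *)
exists (6 * 2 ^+ (s.+1 * d) * 3 ^+ d); first by rewrite !mulr_ge0 ?exprn_ge0 ?ler0n.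
move=> i0 F lam uF lam0 hK.
have [l0 l00 nl] := nash_lattice mu_ge0 mu_x0 rmin_gt0 mu_a basis_unit uF lam0 hK.
pose eps : R := 2 / lam%:R.
have eps0 : 0 < eps by rewrite divr_gt0 ?ltr0n.
pose j0 := (s + l0)%N.
(* After [t] further doublings the starting value, at most [2 ^+ (j0 * d)], is below the [eps]
   term. *)
pose t := Num.bound (2 ^+ (j0 * d) / (eps * 2 ^+ (s.+1 * d))).
pose j1 := (j0 + t)%N.
have e20 : 0 < eps * 2 ^+ (s.+1 * d) by rewrite mulr_gt0 ?exprn_gt0 ?ltr0n.
exists (2 * 4 ^ j1)%N => n.
have [N0 hN0] := eventually_uniform nl (2 ^ n)%N.
exists N0 => N hN p p0 p1 pd m x /andP[m1 mn].
pose b j := N2 (pn p j).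
have bh : forall k k', (k <= k')%N -> b k' <= b k by move=> k k'; apply: N2_pn_homo.
have H : forall j k, (j0 <= j < n)%N -> b k <= C * (2 ^+ (j - s)) ^+ 2 * (b k - b k.+1)
     + eps / (2 ^+ (j - s)) ^+ d.
  move=> j k /andP[h1 h2].
  have hl : (l0 <= 2 ^ (j - s))%N.
    apply: (@leq_trans (2 ^ l0)%N); first exact/ltnW/ltn_expl.
    by rewrite leq_exp2l //; move: h1; rewrite /j0; clear; lia.
  have hB : (2 ^ (j - s) <= 2 ^ n)%N by rewrite leq_exp2l //; move: h2; clear; lia.
  have := hN0 _ hB hl N hN p (pn p k) p0 pd (pn_ge0 p0 k) (sum_pn p1 k).
  by rewrite -/C natrX (_ : Dform p (pn p k) = b k - b k.+1) // /b N2_pnS // opprB addrCA subrr addr0.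
have m0 : (0 < m./2)%N.
  have h4 : (0 < 4 ^ j1)%N by rewrite expn_gt0.
  by move: m1 h4; clear; lia.
pose j := trunc_log 4 m./2.
have /andP[jm mj] := trunc_log_bounds (isT : (1 < 4)%N) m0.
rewrite -/j in jm mj.
have j1j : (j1 <= j)%N.
  rewrite -ltnS -(@ltn_exp2l 4) //; apply: leq_ltn_trans mj.
  by move: m1; clear; lia.
have jn : (j <= n)%N.
  rewrite leqNgt; apply/negP => h.
  have hj : (j < 4 ^ j)%N by rewrite ltn_expl.
  by move: jm mn h hj; clear; lia.
have := @doubling R b d s C eps (fun k => N2_ge0 _) C0 (ltW eps0) bh Cs j0 n (leq_addr _ _) H j.
have jj : (j0 <= j <= n)%N by rewrite jn andbT; apply: leq_trans j1j; apply: leq_addr.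
move=> /(_ jj) hb.
have b1 : b (4 ^ j0)%N <= 1 by rewrite -(N2_pn0 p); apply: bh.
have hb2 : b (4 ^ j)%N * 2 ^+ (j * d) <= 3 * (eps * 2 ^+ (s.+1 * d)).
  apply: (le_trans hb).
  have : b (4 ^ j0)%N * 2 ^+ (j0 * d) / 2 ^+ (j - j0) <= eps * 2 ^+ (s.+1 * d).
    rewrite ler_pdivrMr ?exprn_gt0 //.
    apply: (@le_trans _ _ (2 ^+ (j0 * d))); first by rewrite ler_piMl ?exprn_ge0.
    rewrite -ler_pdivrMl // mulrC; apply: ltW; apply: upper_nthrootP.
    by rewrite -/t; move: j1j; rewrite /j1; clear; lia.
  by set A := _ / _; set B := eps * _; clear; lra.
have pb : pn p m x <= b (4 ^ j)%N.
  rewrite (_ : m = (m - (4 ^ j + 4 ^ j)) + (4 ^ j + 4 ^ j))%N; last first.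
    by move: jm; clear; lia.
  by apply: pn_sup_homo => // y; apply: pn_double_le.
apply: (le_trans pb).
have hs : Num.sqrt m%:R <= 3 * 2 ^+ j :> R.
  rewrite -[leRHS]ger0_norm ?mulr_ge0 ?exprn_ge0 // -sqrtr_sqr ler_wsqrtr //.
  rewrite exprMn -exprM mulnC exprM -!natrX -natrM ler_nat.
  by move: mj; rewrite expnS (_ : 2 ^ 2 = 4)%N //; clear; lia.
have m0' : (0 < m)%N by move: m0; clear; lia.
rewrite ler_pdivlMr ?sqd_gt0 //.
have h3 : sqd m <= 3 ^+ d * 2 ^+ (j * d).
  by rewrite exprM -exprMn lerXn2r ?nnegrE ?sqrtr_ge0 ?mulr_ge0 ?exprn_ge0.
apply: le_trans (ler_wpM2l (N2_ge0 _) h3) _.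
rewrite mulrCA; apply: le_trans (ler_wpM2l _ hb2) _; first by rewrite exprn_ge0.
by rewrite /eps; apply: ler_of_eq; ring.
Qed.

(** This is [pn_decay] with a single basis atom and [lam = 1]; the times up to [m1] are absorbed in
    the constant by [pn_le1]. *)
Lemma pn_bound (i0 : 'I_d) : exists2 C : R, 0 <= C & forall n, exists N0, forall N, (N0 <= N)%N ->
  forall p : 'rV['I_N.+2]_d -> R, (forall g, 0 <= p g) -> \sum_g p g = 1 ->
  dominates mu p -> forall m x, (0 < m <= n)%N -> pn p m x <= C / sqd m.
Proof.
have [Cd Cd0 H] := pn_decay.
have hK : 1%:R ^+ 2 * rmin <= \sum_(z <- [:: a i0]) mu z * coord R x0 a (z - x0) i0 ^+ 2.
  by rewrite big_seq1 coord_basis // eqxx !expr1n mulr1 mul1r.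
have [m1 Hm] := H i0 [:: a i0] 1%N isT isT hK.
exists (Num.max Cd (sqd m1)); first by rewrite le_max Cd0.
move=> n; have [N0 HN] := Hm n; exists N0 => N hN p p0 p1 pd m x /andP[m0 mn].
case: (leqP m1 m) => h.
  apply: le_trans (HN N hN p p0 p1 pd m x _) _; first by rewrite h.
  by rewrite divr1 ler_pM2r ?invr_gt0 ?sqd_gt0 // le_max lexx.
apply: (le_trans (pn_le1 p0 p1 m x)); rewrite ler_pdivlMr ?sqd_gt0 // mul1r le_max.
apply/orP; right; rewrite lerXn2r ?nnegrE ?sqrtr_ge0 // ler_wsqrtr // ler_nat.
exact: ltnW.
Qed.

End Decay.

(** * Return probabilities under drift *)

Section Drift.
Variables (R : realFieldType) (G : finZmodType) (p : G -> R).
Hypotheses (p_ge0 : forall g, 0 <= p g) (p_sum1 : \sum_g p g = 1).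
Variables (W : G -> R) (w sg2 : R).
Hypotheses (W_mean : \sum_g p g * W g = w) (W_sq : \sum_g p g * W g ^+ 2 <= sg2).

Lemma ExS n f : Ex p n.+1 f = \sum_g p g * Ex p n (fun s => f (g :: s)).
Proof. by []. Qed.

Lemma Ex_swap m n (f : seq G -> seq G -> R) :
  Ex p m (fun s1 => Ex p n (f s1)) = Ex p n (fun s2 => Ex p m (fun s1 => f s1 s2)).
Proof.
elim: m f => [//|m IH] f; rewrite ExS.
rewrite (eq_bigr (fun g => Ex p n (fun s2 => p g * Ex p m (fun s1 => f (g :: s1) s2)))); last first.
  by move=> g _; rewrite ExZ IH.
by rewrite -(Ex_sum p n _ _ (fun g s2 => p g * Ex p m (fun s1 => f (g :: s1) s2))).
Qed.

Lemma pn_Ex m x : pn p m x = Ex p m (fun s => (\sum_(g <- s) g == x)%:R).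
Proof.
elim: m x => [|m IH] x; first by rewrite /pn /Ex big_nil eq_sym.
transitivity (\sum_g p g * pn p m (x - g)) => //.
rewrite ExS; apply: eq_bigr => g _; rewrite IH; congr (_ * _).
by apply: eq_Ex => s _; rewrite big_cons eq_sym subr_eq eq_sym addrC.
Qed.

Definition Ws (s : seq G) : R := \sum_(g <- s) W g.

Lemma Ex_Ws n : Ex p n (fun s => Ws s - n%:R * w) = 0.
Proof.
elim: n => [|n IH]; first by rewrite /Ex /Ws big_nil mul0r subrr.
rewrite ExS.
rewrite (eq_bigr (fun g => p g * W g - p g * w)).
  by rewrite sumrB W_mean -mulr_suml p_sum1 mul1r subrr.
move=> g _; rewrite -mulrBr; congr (_ * _).
rewrite (eq_Ex p (f2 := fun s => (W g - w) + (Ws s - n%:R * w))).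
  by rewrite ExD Ex_cst // IH addr0.
by move=> s _; rewrite /Ws big_cons -natr1; ring.
Qed.

Lemma Ex_Ws_sq n : Ex p n (fun s => (Ws s - n%:R * w) ^+ 2) <= n%:R * sg2.
Proof.
elim: n => [|n IH]; first by rewrite /Ex /Ws big_nil !mul0r subrr expr0n.
rewrite ExS.
rewrite (eq_bigr (fun g => p g * (W g - w) ^+ 2 + p g * Ex p n (fun s => (Ws s - n%:R * w) ^+ 2))); last first.
  move=> g _; rewrite -mulrDr; congr (_ * _).
  rewrite (eq_Ex p (f2 := fun s => (W g - w) ^+ 2 +
     (2 * (W g - w) * (Ws s - n%:R * w) + (Ws s - n%:R * w) ^+ 2))).
    by rewrite !ExD Ex_cst // ExZ Ex_Ws mulr0 add0r.
  by move=> s _; rewrite /Ws big_cons -natr1; ring.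
rewrite big_split /= -mulr_suml p_sum1 mul1r -[n.+1%:R]natr1 mulrDl mul1r addrC lerD //.
apply: le_trans W_sq.
rewrite (eq_bigr (fun g => p g * W g ^+ 2 - 2 * w * (p g * W g) + w ^+ 2 * p g)); last first.
  by move=> g _; ring.
rewrite big_split sumrB /= -!mulr_sumr W_mean p_sum1.
have := sqr_ge0 w; rewrite !expr2; lra.
Qed.

(** A crude uncentred moment, used only for the wrap-around term, which vanishes as the torus
    grows. *)
Lemma Ex_Ws_sq2 n : Ex p n (fun s => Ws s ^+ 2) <= n%:R ^+ 2 * sg2.
Proof.
have h : forall m, Ex p m (fun s => \sum_(g <- s) W g ^+ 2) <= m%:R * sg2.
  elim=> [|m IH]; first by rewrite /Ex big_nil mul0r.
  rewrite ExS.
  rewrite (eq_bigr (fun g => p g * W g ^+ 2 + p g * Ex p m (fun s => \sum_(g <- s) W g ^+ 2))).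
    by rewrite big_split /= -mulr_suml p_sum1 mul1r -natr1 mulrDl mul1r addrC lerD.
  move=> g _; rewrite -mulrDr; congr (_ * _).
  by under eq_Ex do rewrite big_cons; rewrite ExD Ex_cst.
rewrite expr2 -mulrA; apply: le_trans (ler_wpM2l (ler0n _ n) (h n)).
rewrite -ExZ; apply: ler_Ex => // s hs; rewrite /Ws.
rewrite [in leLHS](big_nth 0) [in leRHS](big_nth 0) hs !big_mkord; exact: sqr_sum_le.
Qed.

Hypothesis w_neq0 : w != 0.

Lemma drift_prob n : (0 < n)%N ->
  Ex p n (fun s => ((w * Ws s <= 0)%R)%:R) <= sg2 / (n%:R * w ^+ 2).
Proof.
move=> n0; have nR : 0 < n%:R :> R by rewrite ltr0n.
have w2 : 0 < w ^+ 2 by rewrite exprn_even_gt0.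
rewrite ler_pdivlMr ?(mulr_gt0 nR w2) //.
have : Ex p n (fun s => (n%:R * w) ^+ 2 * ((w * Ws s <= 0)%R)%:R) <= n%:R * sg2.
  apply: le_trans (Ex_Ws_sq n); apply: ler_Ex => // s _.
  case: (leP (w * Ws s) 0) => h; last by rewrite mulr0 sqr_ge0.
  have : 0 <= Ws s ^+ 2 by apply: sqr_ge0.
  have h2 : n%:R * (w * Ws s) <= 0 by rewrite mulr_ge0_le0 ?(ltW nR).
  by move: h2; rewrite mulr1 !expr2; set a := n%:R; set b := Ws s; nra.
rewrite ExZ => h; rewrite -(ler_pM2l nR); apply: le_trans h.
by apply: ler_of_eq; ring.
Qed.

(* If the two halves return to 0 on the group, then either one of them moved against
   the drift, or the lifted displacement wrapped around and exceeds [NN]. *)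
Lemma return_drift a b (q NN : R) : (0 < a)%N -> (0 < b)%N -> 0 < NN ->
  (forall x, pn p a x <= q) -> (forall x, pn p b x <= q) ->
  (forall s, \sum_(g <- s) g = 0 -> `|Ws s| < NN -> Ws s = 0) ->
  pn p (a + b) 0 <= q * (sg2 / (a%:R * w ^+ 2)) + q * (sg2 / (b%:R * w ^+ 2)) +
     (a + b)%:R ^+ 2 * sg2 / NN ^+ 2.
Proof.
move=> a0 b0 N0 qa qb hN.
have q0 : 0 <= q by apply: le_trans (qa 0); apply: pn_ge0.
rewrite pn_Ex Ex_cat.
pose z (s1 s2 : seq G) : R := (\sum_(g <- s1 ++ s2) g == 0)%:R.
apply: (@le_trans _ _ (Ex p a (fun s1 => Ex p b (fun s2 =>
   z s1 s2 * ((w * Ws s1 <= 0)%R)%:R + z s1 s2 * ((w * Ws s2 <= 0)%R)%:R +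
   NN^-2 * Ws (s1 ++ s2) ^+ 2)))).
  apply: ler_Ex => // s1 _; apply: ler_Ex => // s2 _; rewrite -/(z s1 s2).
  have N2 : 0 <= NN^-2 * Ws (s1 ++ s2) ^+ 2 by rewrite mulr_ge0 ?sqr_ge0 ?invr_ge0 ?sqr_ge0.
  rewrite /z; case: eqP => [e|_]; last by rewrite !mul0r !add0r.
  rewrite !mul1r.
  case: (leP (w * Ws s1) 0) => h1; first by rewrite -addrA lerDl addr_ge0 ?ler0n.
  case: (leP (w * Ws s2) 0) => h2; first by rewrite add0r lerDl.
  rewrite !add0r.
  case: (ltP `|Ws (s1 ++ s2)| NN) => h3.
    have := hN _ e h3; rewrite {1}/Ws big_cat -/(Ws s1) -/(Ws s2) /= => h.
    have hp : 0 < w * (Ws s1 + Ws s2) by rewrite mulrDr addr_gt0.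
    by move: hp; rewrite h mulr0 ltxx.
  rewrite mulrC ler_pdivlMr ?exprn_gt0 // mul1r.
  by rewrite -[leRHS]real_normK ?num_real // lerXn2r ?nnegrE ?normr_ge0 ?(ltW N0).
rewrite (eq_Ex p (f2 := fun s1 => ((w * Ws s1 <= 0)%R)%:R * Ex p b (z s1) +
   Ex p b (fun s2 => z s1 s2 * ((w * Ws s2 <= 0)%R)%:R) +
   NN^-2 * Ex p b (fun s2 => Ws (s1 ++ s2) ^+ 2))); last first.
  by move=> s1 _; rewrite !ExD -!ExZ; congr (_ + _ + _); apply: eq_Ex => s2 _; rewrite mulrC.
rewrite !ExD !lerD //.
(* Given the first half, the second must end at one prescribed site, which has probability at most
   [q]. The next case exchanges the halves. *)
- apply: (@le_trans _ _ (Ex p a (fun s1 => q * ((w * Ws s1 <= 0)%R)%:R))).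
    apply: ler_Ex => // s1 _; rewrite mulrC ler_wpM2r ?ler0n //.
    apply: le_trans (qb (- \sum_(g <- s1) g)); rewrite pn_Ex.
    apply: ler_Ex => // s2 _; rewrite /z big_cat /= addrC addr_eq0 //.
  by rewrite ExZ ler_wpM2l // drift_prob.
- rewrite (Ex_swap a b (fun s1 s2 => z s1 s2 * ((w * Ws s2 <= 0)%R)%:R)).
  apply: (@le_trans _ _ (Ex p b (fun s2 => q * ((w * Ws s2 <= 0)%R)%:R))).
    apply: ler_Ex => // s2 _.
    rewrite (eq_Ex p (f2 := fun s1 => ((w * Ws s2 <= 0)%R)%:R * z s1 s2)); last by move=> *; rewrite mulrC.
    rewrite ExZ mulrC ler_wpM2r ?ler0n //.
    apply: le_trans (qa (- \sum_(g <- s2) g)); rewrite pn_Ex.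
    apply: ler_Ex => // s1 _; rewrite /z big_cat /= addr_eq0 //.
  by rewrite ExZ ler_wpM2l // drift_prob.
- rewrite ExZ -(Ex_cat p a b (fun s => Ws s ^+ 2)) mulrC ler_wpM2r ?invr_ge0 ?sqr_ge0 //.
  exact: Ex_Ws_sq2.
Qed.

End Drift.

Section Lift.
Variable N : nat.

(** The centred representative of a residue, which has the least absolute value in its class. *)
Definition clift (c : 'I_N.+2) : int := if (c.*2 <= N.+2)%N then c%:Z else c%:Z - N.+2%:Z.

Lemma cliftK c : (clift c)%:~R = c.
Proof.
have hN : (N.+2%:R : 'I_N.+2) = 0 by apply: val_inj; rewrite Zp_nat /= modnn.
rewrite /clift; case: ifP => _; rewrite ?intrB -?pmulrn ?hN ?subr0; exact: natr_Zp.
Qed.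

Lemma clift_half c : (`|clift c|.*2 <= N.+2)%N.
Proof. by rewrite /clift; case: ifP => h; have := ltn_ord c; lia. Qed.

Lemma clift_small (k : int) : (`|k|.*2 < N.+2)%N -> clift k%:~R = k.
Proof.
move=> h; apply/eqP; rewrite -subr_eq0; apply/eqP; apply: (@intr_Zp_eq0 N).
  by rewrite intrB cliftK subrr.
have := clift_half k%:~R; move: (clift _) => c; lia.
Qed.

Lemma clift_le (k : int) : (`|clift k%:~R| <= `|k|)%N.
Proof.
case: (ltnP `|k|.*2 N.+2) => h; first by rewrite clift_small.
by have := clift_half k%:~R; move: (clift _) => c; lia.
Qed.

End Lift.

(** * Asymptotics of the variance bound *)

Section Sums.
Variable R : realType.
Local Notation s m := (Num.sqrt (m%:R : R)).

Lemma sqrt_nat_sq m : s m ^+ 2 = m%:R.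
Proof. by rewrite sqr_sqrtr. Qed.

Lemma sqrt_nat_gt0 m : (0 < m)%N -> 0 < s m.
Proof. by move=> h; rewrite sqrtr_gt0 ltr0n. Qed.

Lemma sum_inv_sqrt k : \sum_(1 <= m < k.+1) (s m)^-1 <= 2 * s k.
Proof.
elim: k => [|k IH]; first by rewrite big_geq // mulr_ge0 ?sqrtr_ge0.
rewrite big_nat_recr //=; apply: (le_trans (lerD IH (lexx _))).
have h1 := sqrt_nat_gt0 (ltn0Sn k); have e1 := sqrt_nat_sq k.+1.
have e0 := sqrt_nat_sq k; have h0 := sqrtr_ge0 (k%:R : R).
rewrite -(ler_pM2l h1) mulrDr mulfV ?gt_eqF //.
set x := Num.sqrt k.+1%:R in e1 h1 *; set y := Num.sqrt k%:R in e0 h0 *.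
have e : x ^+ 2 = y ^+ 2 + 1 by rewrite e1 e0 natr1.
by move: e h1 h0; clear; have := sqr_ge0 (x - y); rewrite !expr2; nra.
Qed.

Lemma sum_inv k : (0 < k)%N -> \sum_(1 <= m < k.+1) (m%:R : R)^-1 <= 1 + ln k%:R.
Proof.
case: k => [//|k _]; elim: k => [|k IH].
  by rewrite big_nat1 invr1 ln1 addr0.
rewrite big_nat_recr //=; apply: (le_trans (lerD IH (lexx _))).
have k1 : 0 < k.+1%:R :> R by rewrite ltr0n.
have k2 : 0 < k.+2%:R :> R by rewrite ltr0n.
have h : ln (1 + - (k.+2%:R : R)^-1) <= - (k.+2%:R)^-1.
  by apply: le_ln1Dx; rewrite ltrN2 invf_lt1 // ltr1n.
have e : 1 - (k.+2%:R : R)^-1 = k.+1%:R / k.+2%:R.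
  have n2 : k.+2%:R != 0 :> R by rewrite gt_eqF.
  by rewrite -[X in X - _](mulfV n2) -[X in _ - X]mul1r -mulrBl -[k.+2 in LHS]add1n natrD addrAC subrr add0r.
move: h; rewrite e lnM ?posrE ?invr_gt0 // lnV ?posrE //.
by move: (ln k.+1%:R) (ln k.+2%:R) ((k.+2%:R)^-1) => A B C; clear; lra.
Qed.

Lemma sum_inv_32 k : (0 < k)%N -> \sum_(1 <= m < k.+1) (s m ^+ 3)^-1 <= 3 - 2 / s k.
Proof.
case: k => [//|k _]; elim: k => [|k IH].
  by rewrite big_nat1 sqrtr1 expr1n invr1; lra.
rewrite big_nat_recr //=; apply: (le_trans (lerD IH (lexx _))).
have h1 := sqrt_nat_gt0 (ltn0Sn k.+1); have e1 := sqrt_nat_sq k.+2.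
have h0 := sqrt_nat_gt0 (ltn0Sn k); have e0 := sqrt_nat_sq k.+1.
set x := Num.sqrt k.+2%:R in e1 h1 *; set y := Num.sqrt k.+1%:R in e0 h0 *.
have xy : y <= x by rewrite ler_wsqrtr // ler_nat.
have e : x ^+ 2 = y ^+ 2 + 1 by rewrite e1 e0 natr1.
suff : (x ^+ 3)^-1 <= 2 / y - 2 / x by lra.
have -> : 2 / y - 2 / x = 2 * (x - y) / (x * y) by field; rewrite !gt_eqF.
rewrite ler_pdivlMr ?mulr_gt0 // mulrC ler_pdivrMr ?exprn_gt0 //.
have h2 : 1 <= 2 * (x - y) * x.
  by move: e; rewrite !expr2; have := sqr_ge0 (x - y); rewrite expr2; nra.
apply: (@le_trans _ _ (1 * x ^+ 2)).
  by rewrite mul1r expr2 ler_pM2l.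
have -> : 2 * (x - y) * x ^+ 3 = 2 * (x - y) * x * x ^+ 2 by ring.
by rewrite ler_wpM2r ?sqr_ge0.
Qed.

Definition Hsum d k : R := \sum_(1 <= m < k.+1) (sqd R d m)^-1.
Definition Bsum d k : R :=
  \sum_(1 <= a < k.+1) \sum_(1 <= m < k.+1) (minn a m)%:R * ((sqd R d a)^-1 * (sqd R d m)^-1).

Lemma sqd2 m : sqd R 2 m = m%:R.
Proof. exact: sqrt_nat_sq. Qed.

Lemma min_le_sqrt a m : (minn a m)%:R <= s a * s m.
Proof.
rewrite -sqrtrM //; rewrite -[leLHS]ger0_norm // -sqrtr_sqr ler_wsqrtr //.
rewrite expr2 -!natrM ler_nat; exact: leq_mul (geq_minl _ _) (geq_minr _ _).
Qed.

Lemma Bsum_le_prod d k : Bsum d k <= (\sum_(1 <= m < k.+1) s m / sqd R d m) ^+ 2.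
Proof.
rewrite expr2 big_distrlr /=; apply: ler_sum => a _; apply: ler_sum => m _.
rewrite mulrACA ler_wpM2r ?min_le_sqrt //.
by rewrite mulr_ge0 // invr_ge0 exprn_ge0 ?sqrtr_ge0.
Qed.

Lemma Bsum1 k : Bsum 1 k <= k%:R ^+ 2.
Proof.
apply: (le_trans (Bsum_le_prod _ _)).
rewrite (eq_big_nat _ _ (F2 := fun=> 1)); last first.
  by move=> m /andP[m0 _]; rewrite /sqd expr1 mulfV // gt_eqF ?sqrt_nat_gt0.
by rewrite big_const_nat iter_addr addr0 subn1.
Qed.

Lemma Bsum2 k : Bsum 2 k <= 4 * k%:R.
Proof.
apply: (le_trans (Bsum_le_prod _ _)).
rewrite (eq_big_nat _ _ (F2 := fun m => (s m)^-1)); last first.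
  move=> m /andP[m0 _]; rewrite /sqd expr2 invfM mulrA mulfV ?mul1r //.
  by rewrite gt_eqF ?sqrt_nat_gt0.
have h := sum_inv_sqrt k.
apply: (@le_trans _ _ ((2 * s k) ^+ 2)).
  rewrite lerXn2r ?nnegrE ?mulr_ge0 ?sqrtr_ge0 //.
  by apply: sumr_ge0 => m _; rewrite invr_ge0 sqrtr_ge0.
by rewrite exprMn sqrt_nat_sq -natrX.
Qed.

(** For d = 3 the factorization in [Bsum_le_prod] would give the square of the logarithm. With the
    indices ordered instead, a^(-1/2) summed over a <= m is at most 2 sqrt(m), and 1/m is left for
    the outer sum. *)
Lemma Bsum3 k : (0 < k)%N -> Bsum 3 k <= 4 * (1 + ln k%:R).
Proof.
move=> k0.
pose w m := (sqd R 3 m)^-1.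
have w0 m : 0 <= w m by rewrite invr_ge0 exprn_ge0 ?sqrtr_ge0.
pose S := \sum_(1 <= m < k.+1) \sum_(1 <= a < k.+1) (a <= m)%N%:R * (a%:R * (w a * w m)).
have hS : S <= 2 * (1 + ln k%:R).
  apply: le_trans (ler_wpM2l (ler0n _ 2) (sum_inv k0)).
  rewrite mulr_sumr; apply: ler_sum_nat => m /andP[m0 mk].
  apply: (@le_trans _ _ (w m * \sum_(1 <= a < m.+1) (s a)^-1)).
    rewrite (big_cat_nat (n := m.+1)) //=.
    rewrite [X in _ + X]big_nat_cond [X in _ + X]big1 ?addr0; last first.
      by move=> a /andP[/andP[h _] _]; rewrite leqNgt h mul0r.
    rewrite mulr_sumr; apply: ler_sum_nat => a /andP[a0 am].
    have sa := sqrt_nat_gt0 a0.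
    have e : a%:R * w a = (s a)^-1.
      by rewrite /w /sqd -[X in X * _](sqrt_nat_sq a); field; rewrite gt_eqF.
    by rewrite -ltnS am mul1r mulrA mulrC e.
  apply: le_trans (ler_wpM2l (w0 m) (sum_inv_sqrt m)) _.
  have sm := sqrt_nat_gt0 m0.
  apply: ler_of_eq.
  rewrite -[in RHS](sqrt_nat_sq m) /w /sqd; field.
  by rewrite gt_eqF.
have : Bsum 3 k <= S + S.
  rewrite {2}/S exchange_big /= -big_split /=; apply: ler_sum => m _.
  rewrite -big_split /=; apply: ler_sum => a _.
  rewrite -/(w m) -/(w a).
  have -> : (a <= m)%N%:R * (a%:R * (w a * w m)) + (m <= a)%N%:R * (m%:R * (w m * w a)) =
     ((a <= m)%N%:R * a%:R + (m <= a)%N%:R * m%:R) * (w m * w a) by ring.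
  rewrite ler_wpM2r ?mulr_ge0 // -!natrM -natrD ler_nat.
  by case: (leqP a m); case: (leqP m a); lia.
by move: hS; clear; lra.
Qed.

End Sums.

Section Asymptotics.
Variable R : realType.

(** The sizes of the sums [mass] and [energy] when [Q m] and [u m] are of order m^(-d/2); [vnormE]
    recovers the normalization from them. *)
Definition mass_scale (d n : nat) : R :=
  if d == 1%N then Num.sqrt n%:R else if d == 2%N then ln n%:R else 1.
Definition energy_scale (d n : nat) : R :=
  if d == 1%N then n%:R ^+ 2 else if d == 2%N then n%:R else ln n%:R.

Lemma vnormE d al n : (d = 1 \/ d = 2 \/ d = 3)%N ->
  n%:R * (mass_scale d n ^+ (2 * al) * energy_scale d n) = vnorm d al.+2 n.
Proof.
case=> [->|[->|->]]; rewrite /mass_scale /energy_scale /vnorm /=.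
- by rewrite exprM sqrt_nat_sq -exprD -exprS addn2.
- rewrite mulrCA -expr2 mulrC; congr (_ * _).
  have -> : 2 * al.+2%:Z - 4 = (2 * al)%N%:Z by lia.
  by rewrite exprnP.
- by rewrite expr1n mul1r.
Qed.

Lemma ln_large (x : R) : exists2 n0, (0 < n0)%N & forall n, (n0 <= n)%N -> x <= ln n%:R.
Proof.
exists (Num.bound (expR x)).+1 => // n hn.
have h : expR x <= n%:R.
  apply: ltW; apply: (lt_le_trans (archi_boundP (expR_ge0 x))); rewrite ler_nat.
  exact: ltnW.
have n0 : 0 < n%:R :> R by rewrite ltr0n; apply: leq_trans hn.
by rewrite -[x]expRK ler_ln ?posrE ?expR_gt0.
Qed.

Lemma mass_scale_ge0 d n : (0 < n)%N -> 0 <= mass_scale d n.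
Proof.
move=> n0; rewrite /mass_scale; case: ifP => _; first exact: sqrtr_ge0.
by case: ifP => _ //; apply: ln_ge0; rewrite ler1n.
Qed.

Lemma mass_asym d (C : R) : (d = 1 \/ d = 2 \/ d = 3)%N -> 0 <= C ->
  exists2 c, 0 <= c & exists2 n0, (0 < n0)%N & forall n, (n0 <= n)%N ->
    1 + C * Hsum R d n <= c * mass_scale d n.
Proof.
move=> hd C0; case: hd => [->|[->|->]].
- exists (1 + 2 * C); first by rewrite addr_ge0 ?mulr_ge0.
  exists 1%N => // n n0; rewrite /mass_scale /=.
  have h : Hsum R 1 n <= 2 * Num.sqrt n%:R.
    rewrite /Hsum (eq_bigr (fun m => (Num.sqrt (m%:R : R))^-1)); last by move=> m _; rewrite /sqd expr1.
    exact: sum_inv_sqrt.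
  have s1 : 1 <= Num.sqrt (n%:R : R) by rewrite -[leLHS]sqrtr1 ler_wsqrtr // ler1n.
  have := ler_wpM2l C0 h; move: s1; move: (Num.sqrt _) (Hsum _ _ _) => a b; nra.
- exists (1 + 2 * C); first by rewrite addr_ge0 ?mulr_ge0.
  have [n0 n00 hn0] := ln_large 1; exists n0 => // n nn0; rewrite /mass_scale /=.
  have n1 : (0 < n)%N by apply: leq_trans nn0.
  have h : Hsum R 2 n <= 1 + ln n%:R.
    rewrite /Hsum (eq_bigr (fun m => (m%:R : R)^-1)); last by move=> m _; rewrite sqd2.
    exact: sum_inv.
  have := ler_wpM2l C0 h; have := hn0 n nn0; move: (ln _) (Hsum _ _ _) => a b; nra.
- exists (1 + 3 * C); first by rewrite addr_ge0 ?mulr_ge0.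
  exists 1%N => // n n0; rewrite /mass_scale /=.
  have h : Hsum R 3 n <= 3.
    apply: le_trans (sum_inv_32 R n0) _; rewrite gerBl mulr_ge0 ?invr_ge0 ?sqrtr_ge0 //.
  have := ler_wpM2l C0 h; move: (Hsum _ _ _) => b; nra.
Qed.

(** The early times, at which [u] is not yet small, contribute a multiple of [mass]; this makes
    their share negligible. *)
Lemma mass_energy_scale d (dl : R) : (d = 1 \/ d = 2 \/ d = 3)%N -> 0 < dl ->
  exists2 n0, (0 < n0)%N & forall n, (n0 <= n)%N -> mass_scale d n <= dl * energy_scale d n.
Proof.
move=> hd dl0; have id0 : 0 <= dl^-1 by rewrite invr_ge0 ltW.
case: hd => [->|[->|->]].
- exists (Num.bound (dl^-1)).+1 => // n hn; rewrite /mass_scale /energy_scale /=.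
  have n1 : (0 < n)%N by apply: leq_trans hn.
  have h : 1 <= dl * n%:R.
    rewrite -ler_pdivrMl // mulr1; apply: ltW; apply: (lt_le_trans (archi_boundP id0)).
    by rewrite ler_nat ltnW.
  have s1 : Num.sqrt (n%:R : R) <= n%:R.
    rewrite -[leRHS]ger0_norm // -sqrtr_sqr ler_wsqrtr // -natrX ler_nat.
    by rewrite expnS expn1 leq_pmull.
  apply: (le_trans s1); rewrite expr2 mulrA ler_peMl //.
- exists (Num.bound ((2 / dl) ^+ 2)).+1 => // n hn; rewrite /mass_scale /energy_scale /=.
  have n1 : (0 < n)%N by apply: leq_trans hn.
  have s0 := sqrt_nat_gt0 R n1.
  have e := sqrt_nat_sq R n.
  have h : 2 / dl <= Num.sqrt n%:R.
    rewrite -[leLHS]ger0_norm ?mulr_ge0 // -sqrtr_sqr ler_wsqrtr //.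
    apply: ltW; apply: (lt_le_trans (archi_boundP (sqr_ge0 _))).
    by rewrite ler_nat ltnW.
  have h2 : 2 <= dl * Num.sqrt n%:R by rewrite -ler_pdivrMl // mulrC.
  have l : ln (n%:R : R) <= 2 * Num.sqrt n%:R.
    rewrite -[X in ln X]e lnXn // mulr2n; have := ln_sublinear s0.
    by move: (ln _) => A; move: (Num.sqrt _) => B; lra.
  apply: (le_trans l); rewrite -[X in dl * X]e expr2 mulrA ler_wpM2r ?(ltW s0) //.
- have [n0 n00 hn0] := ln_large (dl^-1); exists n0 => // n nn0.
  by rewrite /mass_scale /energy_scale /= -ler_pdivrMl // mulr1 hn0.
Qed.

Lemma sums_asym d : (d = 1 \/ d = 2 \/ d = 3)%N ->
  exists2 n0, (0 < n0)%N & forall n, (n0 <= n)%N ->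
    Hsum R d (2 * n) <= 4 * energy_scale d n /\ Bsum R d (2 * n) <= 16 * energy_scale d n.
Proof.
case=> [->|[->|->]].
- exists 1%N => // n n0; rewrite /energy_scale /=; split.
    rewrite /Hsum (eq_bigr (fun m => (Num.sqrt (m%:R : R))^-1)); last by move=> m _; rewrite /sqd expr1.
    apply: (le_trans (sum_inv_sqrt _ _)).
    have s1 : Num.sqrt ((2 * n)%:R : R) <= 2 * n%:R ^+ 2.
      rewrite -[leRHS]ger0_norm ?mulr_ge0 ?exprn_ge0 // -sqrtr_sqr ler_wsqrtr //.
      rewrite -!natrX -natrM -natrX ler_nat; nia.
    by move: s1; move: (Num.sqrt _) => a; lra.
  apply: (le_trans (Bsum1 _ _)); rewrite natrM exprMn.
  by have := sqr_ge0 (n%:R : R); move: (n%:R ^+ 2) => a; rewrite -natrX; lra.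
- exists 1%N => // n n0; rewrite /energy_scale /=.
  have n1 : 1 <= n%:R :> R by rewrite ler1n.
  split.
    rewrite /Hsum (eq_bigr (fun m => (m%:R : R)^-1)); last by move=> m _; rewrite sqd2.
    have h2n : (0 < 2 * n)%N by lia.
    apply: (le_trans (sum_inv R h2n)).
    have := @ln_sublinear R (2 * n)%:R; rewrite ltr0n h2n => /(_ isT).
    rewrite natrM; move: (ln _) n1; move: (n%:R : R) => a b; lra.
  apply: (le_trans (Bsum2 _ _)); rewrite natrM; move: n1; move: (n%:R : R) => a; lra.
- have [n0 n00 hn0] := ln_large 1; exists n0 => // n nn0; rewrite /energy_scale /=.
  have n1 : (0 < n)%N by apply: leq_trans nn0.
  have h2n : (0 < 2 * n)%N by lia.
  have l1 := hn0 n nn0.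
  split.
    apply: (@le_trans _ _ 3).
      by apply: le_trans (sum_inv_32 R h2n) _; rewrite gerBl mulr_ge0 ?invr_ge0 ?sqrtr_ge0.
    by move: l1; move: (ln _) => a; lra.
  apply: (le_trans (Bsum3 R h2n)); rewrite natrM lnM ?posrE ?ltr0n //.
  have := @ln_sublinear R 2; rewrite ltr0n => /(_ isT).
  by move: l1; move: (ln n%:R) (ln 2) => a b; lra.
Qed.

(** Times m <= m1 use [u <= 1]: there are at most [m1.+1] of them, of weight at most [m1.+1],
    against the full sum of [Q]. Later times carry [eps]. There the term a = 0, where [Q] is 1,
    gives [Hsum], and for positive a and m the factor [(minn a m).+1] is at most twice [minn a m],
    which gives [Bsum]. *)
Lemma energy_split d n (C eps : R) m1 (u Q : nat -> R) : 0 <= C -> 0 <= eps ->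
  (forall m, 0 <= u m <= 1) ->
  (forall m, (m1 <= m <= 2 * n)%N -> u m <= eps / sqd R d m) ->
  Q 0%N = 1 -> (forall m, (0 < m)%N -> Q m = C / sqd R d m) ->
  \sum_(0 <= a < n.+1) \sum_(0 <= m < (2 * n).+1) (minn a m).+1%:R * (Q a * u m) <=
  (m1.+1 ^ 2)%:R * (\sum_(0 <= a < n.+1) Q a) + eps * Hsum R d (2 * n) + 2 * C * eps * Bsum R d (2 * n).
Proof.
move=> C0 eps0 u01 ueps Q0 QC.
have sq0 m : 0 <= (sqd R d m)^-1 by rewrite invr_ge0 exprn_ge0 ?sqrtr_ge0.
have Qge a : 0 <= Q a by case: a => [|a]; rewrite ?Q0 ?QC ?mulr_ge0.
pose v m := if (m <= m1)%N then 0 else eps * (sqd R d m)^-1.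
have v0 m : 0 <= v m by rewrite /v; case: ifP => // _; rewrite mulr_ge0.
have uv m : (m <= 2 * n)%N -> u m <= (m <= m1)%N%:R + v m.
  move=> hm; rewrite /v; case: leqP => h; first by rewrite addr0; have /andP[] := u01 m.
  by rewrite add0r ueps // hm andbT ltnW.
have first_le a : \sum_(0 <= m < (2 * n).+1) (minn a m).+1%:R * (m <= m1)%N%:R <= (m1.+1 ^ 2)%:R :> R.
  apply: (@le_trans _ _ (\sum_(0 <= m < (2 * n).+1) m1.+1%:R * (m < m1.+1)%N%:R)).
    apply: ler_sum => m _; rewrite ltnS; case: (leqP m m1) => h; rewrite ?mulr0 ?mulr1 //.
    by rewrite ler_nat ltnS; apply: leq_trans h; apply: geq_minr.
  rewrite -mulr_sumr expnS expn1 natrM ler_wpM2l //.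
  have H N M : \sum_(0 <= m < N) (m < M)%N%:R <= M%:R :> R.
    elim: M => [|M IH]; first by rewrite big1 // => m _; rewrite ltn0.
    rewrite -natr1; apply: (@le_trans _ _ (\sum_(0 <= m < N) ((m < M)%N%:R + (m == M)%:R))).
      apply: ler_sum => m _; rewrite ltnS leq_eqVlt -natrD ler_nat.
      by case: eqP => _; case: ltnP.
    rewrite big_split /= lerD //; case: N {IH} => [|N]; first by rewrite big_geq.
    exact: sum_nat_pick_le1.
  exact: H.
apply: (@le_trans _ _ (\sum_(0 <= a < n.+1) (Q a * (m1.+1 ^ 2)%:R +
   Q a * \sum_(0 <= m < (2 * n).+1) (minn a m).+1%:R * v m))).
  apply: ler_sum => a _; rewrite -mulrDr.
  apply: (@le_trans _ _ (Q a * \sum_(0 <= m < (2 * n).+1) (minn a m).+1%:R * u m)).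
    by rewrite mulr_sumr; apply: ler_sum => m _; rewrite mulrCA.
  rewrite ler_wpM2l //.
  apply: le_trans (lerD (first_le a) (lexx _)); rewrite -big_split /=.
  by apply: ler_sum_nat => m /andP[_ hm]; rewrite -mulrDr ler_wpM2l // uv.
rewrite big_split /= -mulr_suml mulrC -addrA lerD //.
have v00 : v 0%N = 0 by rewrite /v leq0n.
have vle m : v m <= eps * (sqd R d m)^-1.
  by rewrite /v; case: ifP => // _; rewrite mulr_ge0.
have drop0 (F : nat -> R) : \sum_(0 <= m < (2 * n).+1) F m * v m = \sum_(1 <= m < (2 * n).+1) F m * v m.
  by rewrite big_ltn // v00 mulr0 add0r.
rewrite big_ltn // lerD //.
  rewrite Q0 mul1r (drop0 (fun m => (minn 0 m).+1%:R)) /Hsum mulr_sumr.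
  by apply: ler_sum => m _; rewrite min0n mul1r.
rewrite /Bsum mulr_sumr.
apply: (@le_trans _ _ (\sum_(1 <= a < n.+1) 2 * C * eps * \sum_(1 <= m < (2 * n).+1)
   (minn a m)%:R * ((sqd R d a)^-1 * (sqd R d m)^-1))); last first.
  rewrite [leRHS](big_cat_nat (n := n.+1)) //=; last by lia.
  rewrite lerDl; apply: sumr_ge0 => a _; rewrite !mulr_ge0 //.
  by apply: sumr_ge0 => m _; rewrite !mulr_ge0.
apply: ler_sum_nat => a /andP[a0 an]; rewrite QC // (drop0 (fun m => (minn a m).+1%:R)).
rewrite !mulr_sumr; apply: ler_sum_nat => m /andP[m0 mn].
have h : (minn a m).+1%:R <= 2 * (minn a m)%:R :> R.
  by rewrite -natrM ler_nat; lia.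
apply: (@le_trans _ _ (C / sqd R d a * (2 * (minn a m)%:R * (eps * (sqd R d m)^-1)))).
  by rewrite ler_wpM2l ?mulr_ge0 // ler_pM.
by apply: ler_of_eq; ring.
Qed.

(** [K] precedes [eps] and [m1], and [n0] is uniform in [u] and [Q]; so [eps] can be chosen in terms
    of [K], and the torus after [n]. *)
Lemma energy_asym d al (C : R) : (d = 1 \/ d = 2 \/ d = 3)%N -> 0 <= C ->
  exists2 K, 0 <= K & forall eps m1, 0 < eps -> exists2 n0, (0 < n0)%N & forall n, (n0 <= n)%N ->
  forall u Q : nat -> R, (forall m, 0 <= u m <= 1) ->
  (forall m, (m1 <= m <= 2 * n)%N -> u m <= eps / sqd R d m) ->
  Q 0%N = 1 -> (forall m, (0 < m)%N -> Q m = C / sqd R d m) ->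
  n%:R * ((\sum_(0 <= a < n.+1) Q a) ^+ (2 * al) *
   \sum_(0 <= a < n.+1) \sum_(0 <= m < (2 * n).+1) (minn a m).+1%:R * (Q a * u m)) <=
  K * eps * vnorm d al.+2 n.
Proof.
move=> hd C0; have [c c0 [n1 n10 hn1]] := mass_asym hd C0.
exists (c ^+ (2 * al) * (5 + 32 * C)); first by rewrite mulr_ge0 ?exprn_ge0 ?addr_ge0 ?mulr_ge0.
move=> eps m1 eps0.
pose M : R := (m1.+1 ^ 2)%:R.
have Mc : 0 < M * c + 1 by rewrite ltr_wpDl // mulr_ge0.
have [n2 n20 hn2] := mass_energy_scale hd (divr_gt0 eps0 Mc).
have [n3 n30 hn3] := sums_asym hd.
exists (maxn n1 (maxn n2 n3)); first by rewrite leq_max n10.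
move=> n; rewrite !geq_max => /and3P[h1 h2 h3] u Q u01 ueps Q0 QC.
have n0 : (0 < n)%N by apply: leq_trans h1.
have massE : \sum_(0 <= a < n.+1) Q a = 1 + C * Hsum R d n.
  rewrite big_ltn // Q0 /Hsum mulr_sumr; congr (_ + _).
  by apply: eq_big_nat => a /andP[a0 _]; rewrite QC.
have mass_le : \sum_(0 <= a < n.+1) Q a <= c * mass_scale d n by rewrite massE hn1.
have ms0 := mass_scale_ge0 d n0.
have mass0 : 0 <= \sum_(0 <= a < n.+1) Q a.
  rewrite massE addr_ge0 // mulr_ge0 // /Hsum; apply: sumr_ge0 => m _.
  by rewrite invr_ge0 exprn_ge0 ?sqrtr_ge0.
have [H4 B16] := hn3 n h3.
have es0 : 0 <= energy_scale d n.
  have : 0 <= Hsum R d (2 * n).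
    by apply: sumr_ge0 => m _; rewrite invr_ge0 exprn_ge0 ?sqrtr_ge0.
  by move: H4; move: (Hsum _ _ _) (energy_scale _ _) => a b; lra.
have en := energy_split C0 (ltW eps0) u01 ueps Q0 QC.
have en2 : \sum_(0 <= a < n.+1) \sum_(0 <= m < (2 * n).+1) (minn a m).+1%:R * (Q a * u m) <=
    (5 + 32 * C) * eps * energy_scale d n.
  apply: (le_trans en); rewrite -/M.
  have M0 : 0 <= M by [].
  have q1 := ler_wpM2l M0 mass_le.
  have q2 : M * (c * mass_scale d n) <= eps * energy_scale d n.
    have Mc0 : 0 <= M * c by rewrite mulr_ge0.
    rewrite [M * (c * _)]mulrA; apply: le_trans (ler_wpM2l Mc0 (hn2 n h2)) _.
    rewrite [M * c * (_ * _)]mulrA ler_wpM2r // [M * c * (_ / _)]mulrA ler_pdivrMr //.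
    by rewrite mulrC ler_pM2l // lerDl.
  have q3 := ler_wpM2l (ltW eps0) H4.
  have q4 := ler_wpM2l (mulr_ge0 (mulr_ge0 (ler0n R 2) C0) (ltW eps0)) B16.
  have -> : (5 + 32 * C) * eps * energy_scale d n = eps * energy_scale d n +
     eps * (4 * energy_scale d n) + 2 * C * eps * (16 * energy_scale d n) by ring.
  by rewrite !lerD // (le_trans q1).
rewrite -vnormE // [leRHS]mulrCA ler_pM2l ?ltr0n //.
apply: (@le_trans _ _ ((c * mass_scale d n) ^+ (2 * al) * ((5 + 32 * C) * eps * energy_scale d n))).
  apply: ler_pM => //; first exact: exprn_ge0.
    apply: sumr_ge0 => a _; apply: sumr_ge0 => m _; have /andP[u0 _] := u01 m.
    rewrite !mulr_ge0 //; case: a => [|a]; rewrite ?Q0 ?QC //.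
    by rewrite mulr_ge0 // invr_ge0 exprn_ge0 ?sqrtr_ge0.
  by rewrite lerXn2r // nnegrE mulr_ge0.
by rewrite exprMn; apply: ler_of_eq; ring.
Qed.

End Asymptotics.

(** * Transfer from Z^d to the torus *)

Section BoundedExpectation.
Context {dT : measure_display} {T : measurableType dT} {R : realType} (P : probability T R).
Implicit Types f g : T -> R.

(** Bounded measurable functions, on which expectation is real-valued and additive; the functionals
    of finitely many steps used below belong to them. *)
Definition bmf f : Prop := measurable_fun setT f /\ exists K, forall w, `|f w| <= K.

Definition Er f : R := fine ('E_P[f])%E.

Lemma bmf_integrable f : bmf f -> P.-integrable setT (EFin \o f).
Proof.
move=> [mf [K hK]]; apply: measurable_bounded_integrable => //.
  by rewrite -ge0_fin_numE // fin_num_measure.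
exists K; split; first exact: num_real.
by move=> M KM w _ /=; apply: (le_trans (hK w)); apply: ltW.
Qed.

Lemma bmf_Lfun f : bmf f -> f \in Lfun P 1.
Proof. by move=> h; apply/Lfun1_integrable/bmf_integrable. Qed.

Lemma ErE f : bmf f -> ('E_P[f] = (Er f)%:E)%E.
Proof. by move=> h; rewrite fineK // expectation_fin_num // bmf_Lfun. Qed.

Lemma bmf_cst c : bmf (fun=> c).
Proof. by split; [exact: measurable_cst|exists `|c|]. Qed.

Lemma bmfD f g : bmf f -> bmf g -> bmf (fun w => f w + g w).
Proof.
move=> [mf [K hK]] [mg [L hL]]; split; first exact: measurable_funD.
by exists (K + L) => w; apply: (le_trans (ler_normD _ _)); apply: lerD.
Qed.

Lemma bmfM f g : bmf f -> bmf g -> bmf (fun w => f w * g w).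
Proof.
move=> [mf [K hK]] [mg [L hL]]; split; first exact: measurable_funM.
by exists (K * L) => w; rewrite normrM; apply: ler_pM.
Qed.

Lemma bmf_sum (I : Type) (r : seq I) (F : I -> T -> R) :
  (forall i, bmf (F i)) -> bmf (fun w => \sum_(i <- r) F i w).
Proof.
move=> h; elim: r => [|i r IH].
  by have := bmf_cst 0; congr bmf; apply/funext => w; rewrite big_nil.
by have := bmfD (h i) IH; congr bmf; apply/funext => w; rewrite big_cons.
Qed.

Lemma ErD f g : bmf f -> bmf g -> Er (fun w => f w + g w) = Er f + Er g.
Proof.
move=> hf hg; rewrite /Er -[fun w => _]/(f \+ g) expectationD ?bmf_Lfun //.
by rewrite fineD // expectation_fin_num // bmf_Lfun.
Qed.

Lemma Er_cst c : Er (fun=> c) = c.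
Proof. by rewrite /Er -[fun=> c]/(cst c) expectation_cst. Qed.

Lemma ErZ c f : bmf f -> Er (fun w => c * f w) = c * Er f.
Proof.
move=> hf; rewrite /Er.
have -> : (fun w => c * f w) = c \o* f by apply/funext => w /=; rewrite mulrC.
by rewrite expectationZl ?bmf_Lfun // fineM // expectation_fin_num // bmf_Lfun.
Qed.

Lemma Er_sum (I : Type) (r : seq I) (F : I -> T -> R) :
  (forall i, bmf (F i)) -> Er (fun w => \sum_(i <- r) F i w) = \sum_(i <- r) Er (F i).
Proof.
move=> h; elim: r => [|i r IH].
  rewrite big_nil -[RHS](Er_cst 0); congr Er; apply/funext => w; by rewrite big_nil.
rewrite big_cons -IH -ErD //; last exact: bmf_sum.
by congr Er; apply/funext => w; rewrite big_cons.
Qed.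

Lemma Er_ge0 f : (forall w, 0 <= f w) -> 0 <= Er f.
Proof. by move=> h; rewrite fine_ge0 // expectation_ge0. Qed.

Lemma ler_Er f g : bmf f -> bmf g -> (forall w, f w <= g w) -> Er f <= Er g.
Proof.
move=> hf hg h; rewrite -subr_ge0.
have hn : bmf (fun w => -1 * f w) by apply: bmfM => //; apply: bmf_cst.
have -> : Er g - Er f = Er (fun w => g w + -1 * f w) by rewrite ErD // ErZ // mulN1r.
by apply: Er_ge0 => w; rewrite mulN1r subr_ge0.
Qed.

Definition ind (A : set T) (w : T) : R := \1_A w.

Lemma bmf_ind A : measurable A -> bmf (ind A).
Proof.
move=> mA; split; first exact: measurable_indic.
by exists 1 => w; rewrite /ind indicE; case: (_ \in _); rewrite ?normr1 ?normr0.
Qed.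

Lemma Er_ind A : measurable A -> Er (ind A) = fine (P A).
Proof. by move=> mA; rewrite /Er expectation_indic. Qed.

Lemma varianceEr f : bmf f -> ('V_P[f] = (Er (fun w => f w ^+ 2) - Er f ^+ 2)%:E)%E.
Proof.
move=> hf; have hf2 := bmfM hf hf.
have hff : bmf (f * f)%R := hf2.
by rewrite /variance covarianceE ?bmf_Lfun // (ErE hf) (ErE hff) -EFinM -EFinB.
Qed.

End BoundedExpectation.

Section DiscreteVariables.
Context {dT : measure_display} {T : measurableType dT} {R : realType} (P : probability T R).

Definition fibers_measurable (S : Type) (Z : T -> S) : Prop :=
  forall s, measurable (Z @^-1` [set s]).

(** Any preimage is a countable union of fibres, so [S] carries no sigma-algebra of its own. *)
Lemma fibers_preimage (S : countType) (Z : T -> S) (A : set S) :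
  fibers_measurable Z -> measurable (Z @^-1` A).
Proof.
move=> hZ.
have -> : Z @^-1` A = \bigcup_s (if s \in A then Z @^-1` [set s] else set0).
  apply/seteqP; split => [w Aw|w [s _]] /=.
    by exists (Z w) => //; rewrite mem_set.
  by case: ifP => // /set_mem As /= ->.
apply: countable_bigcupT_measurable; first exact: countableP.
by move=> s; case: ifP => _; [exact: hZ|exact: measurable0].
Qed.

Lemma fibers_comp (S : countType) (S' : Type) (Z : T -> S) (h : S -> S') :
  fibers_measurable Z -> fibers_measurable (h \o Z).
Proof. by move=> hZ s; apply: (fibers_preimage (h @^-1` [set s]) hZ). Qed.

Lemma fibers_bmf (S : countType) (Z : T -> S) (f : S -> R) K :
  fibers_measurable Z -> (forall w, `|f (Z w)| <= K) -> bmf (fun w => f (Z w)).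
Proof.
move=> hZ hK; split; last by exists K.
by move=> _ B mB; rewrite setTI; apply: (fibers_preimage (f @^-1` B) hZ).
Qed.

Lemma Er_finite_range (S : eqType) (Z : T -> S) (l : seq S) (f : S -> R) :
  fibers_measurable Z -> uniq l -> (forall w, Z w \in l) ->
  Er P (fun w => f (Z w)) = \sum_(s <- l) f s * fine (P (Z @^-1` [set s])).
Proof.
move=> hZ ul hl.
have -> : (fun w => f (Z w)) = (fun w => \sum_(s <- l) f s * ind (Z @^-1` [set s]) w).
  apply/funext => w; rewrite (bigD1_seq (Z w)) //= big1 => [|s sZ].
    by rewrite addr0 /ind indicE mem_set // mulr1.
  rewrite /ind indicE memNset ?mulr0 //= => e; by move: sZ; rewrite e eqxx.
rewrite Er_sum; last by move=> s; apply: bmfM; [exact: bmf_cst|exact: bmf_ind].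
by apply: eq_bigr => s _; rewrite ErZ ?Er_ind //; exact: bmf_ind.
Qed.

End DiscreteVariables.

Section AllSeqs.
Variable G : finType.

Fixpoint allseqs (n : nat) : seq (seq G) :=
  if n is n'.+1 then [seq g :: s | g <- enum G, s <- allseqs n'] else [:: [::]].

Lemma mem_allseqs n s : (s \in allseqs n) = (size s == n).
Proof.
elim: n s => [|n IH] [|g s] //=; first by apply/negP => /allpairsP[[g s] [_ _]].
apply/allpairsP/eqP => [[[g' s'] /= [_ h [_ ->]]]|[e]].
  by move: h; rewrite IH => /eqP ->.
by exists (g, s); rewrite /= mem_enum IH e.
Qed.

Lemma allseqs_uniq n : uniq (allseqs n).
Proof.
elim: n => [//|n IH] /=; apply: allpairs_uniq => //; first exact: enum_uniq.
by move=> [g s] [g' s'] _ _ /= [-> ->].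
Qed.

End AllSeqs.

Lemma Ex_sum_allseqs (R : realFieldType) (G : finZmodType) (p : G -> R) n f :
  Ex p n f = \sum_(s <- allseqs G n) f s * \prod_(g <- s) p g.
Proof.
elim: n f => [|n IH] f; first by rewrite big_seq1 big_nil mulr1.
rewrite ExS /= big_allpairs_dep big_enum /=; apply: eq_bigr => g _.
by rewrite IH mulr_sumr; apply: eq_bigr => s _; rewrite big_cons mulrCA.
Qed.

Section Law.
Context {dT : measure_display} {T : measurableType dT} {R : realType} (P : probability T R).
Variables (d : nat) (X : nat -> T -> 'rV[int]_d).
Hypothesis X_iid : iid P X.

Lemma X_fibers j : fibers_measurable (X j).
Proof. exact: X_iid.1. Qed.

Lemma fibers_map (S : eqType) (Y : nat -> T -> S) (l : seq nat) :
  (forall j, fibers_measurable (Y j)) -> fibers_measurable (fun w => [seq Y j w | j <- l]).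
Proof.
move=> hY; elim: l => [|j l IH] s /=.
  case: s => [|z s]; last by rewrite (_ : _ @^-1` _ = set0) //; apply/seteqP; split.
  by rewrite (_ : _ @^-1` _ = setT) //; apply/seteqP; split.
case: s => [|z s]; first by rewrite (_ : _ @^-1` _ = set0) //; apply/seteqP; split.
rewrite (_ : _ @^-1` _ = (Y j @^-1` [set z]) `&` ((fun w => [seq Y j w | j <- l]) @^-1` [set s])).
  by apply: measurableI => //; exact: hY.
by apply/seteqP; split => [w /= [-> ->]|w /= [-> ->]].
Qed.

Definition mu (z : 'rV[int]_d) : R := fine (P (X 0%N @^-1` [set z])).
Definition pN (N : nat) (g : 'rV['I_N.+2]_d) : R :=
  fine (P (X 0%N @^-1` [set z | tproj N z = g])).
Arguments pN : clear implicits.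

Lemma mu_ge0 z : 0 <= mu z.
Proof. by rewrite fine_ge0. Qed.

Lemma pN_ge0 N g : 0 <= pN N g.
Proof. by rewrite fine_ge0. Qed.

Lemma Er_tproj N (h : 'rV['I_N.+2]_d -> R) :
  Er P (fun w => h (tproj N (X 0%N w))) = \sum_g pN N g * h g.
Proof.
rewrite (@Er_finite_range _ _ _ P _ (fun w => tproj N (X 0%N w)) (enum 'rV['I_N.+2]_d) h).
- by rewrite big_enum /=; apply: eq_bigr => g _; rewrite mulrC.
- exact: (fibers_comp (@tproj N d) (X_fibers 0)).
- exact: enum_uniq.
- by move=> w; rewrite mem_enum.
Qed.

Lemma pN_sum1 N : \sum_g pN N g = 1.
Proof.
rewrite -[RHS](Er_cst P 1) (@Er_tproj N (fun=> 1)).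
by apply: eq_bigr => g _; rewrite mulr1.
Qed.

Lemma sum_mu_le (F : seq 'rV[int]_d) (A : set 'rV[int]_d) : uniq F ->
  (forall z, z \in F -> A z) -> \sum_(z <- F) mu z <= fine (P (X 0%N @^-1` A)).
Proof.
move=> uF FA; have mA := fibers_preimage A (X_fibers 0).
rewrite -Er_ind //.
rewrite (eq_bigr (fun z => Er P (ind (X 0%N @^-1` [set z])))); last first.
  by move=> z _; rewrite Er_ind //; exact: X_fibers.
rewrite -Er_sum; last by move=> z; apply: bmf_ind; exact: X_fibers.
apply: ler_Er.
- by apply: bmf_sum => z; apply: bmf_ind; exact: X_fibers.
- exact: bmf_ind.
move=> w; case: (boolP (X 0%N w \in F)) => h.
  rewrite (bigD1_seq (X 0%N w)) //= big1 => [|z hz].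
    have e1 : w \in X 0%N @^-1` [set X 0%N w] by apply/mem_set.
    have e2 : w \in X 0%N @^-1` A by apply/mem_set; exact: FA.
    by rewrite addr0 /ind !indicE e1 e2.
  by rewrite /ind indicE memNset //= => e; move: hz; rewrite e eqxx.
rewrite big_seq big1 ?ler0n // => z hz.
by rewrite /ind indicE memNset //= => e; move: h; rewrite e hz.
Qed.

Lemma pN_dominates N : dominates mu (pN N).
Proof.
move=> F g uF; rewrite -big_filter; apply: sum_mu_le; first exact: filter_uniq.
by move=> z; rewrite mem_filter => /andP[/eqP].
Qed.

Lemma sum_mu_le1 F : uniq F -> \sum_(z <- F) mu z <= 1.
Proof.
move=> uF; apply: (le_trans (@sum_mu_le F setT uF _)) => //.
by rewrite preimage_setT probability_setT.
Qed.

Definition steps N n (w : T) := [seq tproj N (X j w) | j <- iota 1 n].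

Lemma steps_fibers N n : fibers_measurable (steps N n).
Proof.
apply: (@fibers_map _ (fun j w => tproj N (X j w))) => j.
exact: (fibers_comp (@tproj N d) (X_fibers j)).
Qed.

Lemma steps_prob N n s : size s = n ->
  fine (P (steps N n @^-1` [set s])) = \prod_(g <- s) pN N g.
Proof.
move=> sn; have [_ [ind_X id_X]] := X_iid.
pose A j := [set z | tproj N z = nth 0 s j.-1].
have -> : steps N n @^-1` [set s] = \bigcap_(j in [set` iota 1 n]) (X j @^-1` A j).
  apply/seteqP; split => [w /= e j /= hj|w /= h].
    rewrite /A /= -e (nth_map 0%N) ?size_iota; last by move: hj; rewrite mem_iota; lia.
    by rewrite nth_iota; [congr (tproj N (X _ w))|]; move: hj; rewrite mem_iota; lia.
  apply: (@eq_from_nth _ 0); rewrite size_map size_iota // => j hj.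
  rewrite (nth_map 0%N) ?size_iota // nth_iota //.
  have := h (1 + j)%N; rewrite /A /= add1n /=; apply.
  by rewrite /= mem_iota; lia.
rewrite ind_X ?iota_uniq //.
rewrite (eq_bigr (fun j => (pN N (nth 0 s j.-1))%:E)); last first.
  move=> j _; rewrite id_X /pN fineK // fin_num_measure //.
  exact: (fibers_preimage _ (X_fibers 0)).
rewrite prodEFin /= -sn [RHS](big_nth 0) -[iota 1 _]/(iota (1 + 0) _) iotaDl big_map.
by rewrite /index_iota subn0.
Qed.

Lemma Er_steps N n f : Er P (fun w => f (steps N n w)) = Ex (pN N) n f.
Proof.
rewrite (@Er_finite_range _ _ _ P _ (steps N n) (allseqs _ n) f).
- rewrite Ex_sum_allseqs; apply: eq_big_seq => s.
  by rewrite mem_allseqs => /eqP sn; rewrite steps_prob.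
- exact: steps_fibers.
- exact: allseqs_uniq.
- by move=> w; rewrite mem_allseqs size_map size_iota.
Qed.

End Law.

Arguments mu {dT T R} P {d} X z.
Arguments pN {dT T R} P {d} X N g.
Arguments steps {dT T d} X N n w.

Section PathwiseComparison.
Variables (T : Type) (d : nat) (X : nat -> T -> 'rV[int]_d).

Lemma pos_steps N n w t : (t <= n)%N ->
  pos 0 [seq tproj N (X j w) | j <- iota 1 n] t = tproj N (walk X t w).
Proof.
move=> tn; rewrite /pos add0r -map_take take_iota (minn_idPl tn) big_map.
by rewrite /walk raddf_sum /index_iota subn1.
Qed.

(** As long as the torus identifies no two visited sites, each of them keeps its local time; the
    unvisited points contribute 0 because [al] is positive. *)
Lemma self_intersectionE (R : realType) al n w N : (0 < al)%N ->
  {in [seq walk X j w | j <- iota 1 n] &, injective (@tproj N d)} ->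
  self_intersection_lt X al n w =
  LG R n al [seq tproj N (X j w) | j <- iota 1 n].
Proof.
move=> al0 inj; set v := [seq walk X j w | j <- iota 1 n] in inj *.
pose h g := (\sum_(1 <= t < n.+1) (tproj N (walk X t w) == g))%N.
have hE g : visits R n (pos 0 [seq tproj N (X j w) | j <- iota 1 n]) g = (h g)%:R.
  rewrite visits_natE; congr _%:R; apply: eq_big_nat => t /andP[_ tn].
  by rewrite pos_steps.
rewrite /LG /self_intersection_lt -/v.
under [RHS]eq_bigr do rewrite hE -natrX.
rewrite -natr_sum; congr _%:R.
pose l := map (@tproj N d) (undup v).
have ul : uniq l.
  rewrite map_inj_in_uniq ?undup_uniq // => x y; rewrite !mem_undup; exact: inj.
have h0 g : g \notin l -> (h g ^ al = 0)%N.
  move=> gl; rewrite (_ : h g = 0%N) ?exp0n //.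
  rewrite /h big_nat_cond big1 // => t /andP[/andP[t0 tn] _].
  case: eqP => // e; move: gl; rewrite -e map_f // mem_undup; apply: map_f.
  by rewrite mem_iota; lia.
rewrite (bigID (mem l)) /= [X in (_ + X)%N]big1 ?addn0 => [|g /h0 //].
rewrite -big_uniq //= big_map; apply: eq_big_seq => x.
rewrite mem_undup => xv; congr (_ ^ _)%N; apply: eq_big_nat => t /andP[t0 tn].
congr nat_of_bool; apply/eqP/eqP => [-> //|e]; apply: inj => //.
by apply: map_f; rewrite mem_iota; lia.
Qed.

Definition small (M : nat) (z : 'rV[int]_d) : bool := [forall i, (`|z ord0 i| <= M)%N].

Lemma walk_inj n M N w : (n * M <= N)%N ->
  (forall j, (0 < j <= n)%N -> small M (X j w)) ->
  {in [seq walk X j w | j <- iota 1 n] &, injective (@tproj N d)}.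
Proof.
move=> hN hs.
have key a b : (a <= b <= n)%N -> tproj N (walk X a w) = tproj N (walk X b w) ->
    walk X a w = walk X b w.
  move=> /andP[ab bn] e; apply/esym/eqP; rewrite -subr_eq0; apply/eqP.
  apply: (@tproj_eq0 N); first by rewrite raddfB /= e subrr.
  move=> i; rewrite /walk (big_cat_nat (n := a.+1)) //= addrAC subrr add0r summxE.
  apply: (@leq_ltn_trans N) => //; apply: leq_trans hN.
  rewrite -lez_nat abszE; apply: le_trans (ler_norm_sum _ _ _) _.
  apply: (@le_trans _ _ (\sum_(a.+1 <= j < b.+1) M%:Z)).
    apply: ler_sum_nat => j /andP[j1 j2].
    by have /forallP/(_ i) := hs j (ltac:(lia)); rewrite -lez_nat abszE.
  rewrite big_const_nat iter_addr addr0 -mulr_natl -[M%:Z]/(M%:Z) -natz -natrM -!natz ler_nat.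
  by rewrite leq_mul2r; apply/orP; right; lia.
move=> _ _ /mapP[a + ->] /mapP[b + ->]; rewrite !mem_iota => ha hb e.
case: (leqP a b) => ab; first by apply: key => //; lia.
by apply/esym/key => //; lia.
Qed.

End PathwiseComparison.

Lemma LG_le (R : realFieldType) (G : finZmodType) n al (s : seq G) : (0 < al)%N ->
  0 <= LG R n al s <= n%:R ^+ al.
Proof.
move=> al0; apply/andP; split.
  by apply: sumr_ge0 => x _; rewrite exprn_ge0 ?visits_ge0.
have e : al = al.-1.+1 by lia.
rewrite /LG e.
apply: (@le_trans _ _ (\sum_x n%:R ^+ al.-1 * visits R n (pos 0 s) x)).
  apply: ler_sum => x _; rewrite exprSr ler_wpM2r ?visits_ge0 //.
  rewrite lerXn2r ?nnegrE ?visits_ge0 // -[leRHS](sum_visits R n (pos 0 s)).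
  by rewrite (bigD1 x) //= lerDl sumr_ge0 // => y _; rewrite visits_ge0.
by rewrite -mulr_sumr sum_visits exprSr.
Qed.

Section VarianceTransfer.
Context {dT : measure_display} {T : measurableType dT} {R : realType} (P : probability T R).
Variables (d : nat) (X : nat -> T -> 'rV[int]_d).
Hypothesis X_iid : iid P X.

Lemma large_prob (dl : R) : 0 < dl -> exists M0, forall M, (M0 <= M)%N ->
  fine (P (X 0%N @^-1` [set z | ~~ small M z])) <= dl.
Proof.
move=> dl0.
pose F M := X 0%N @^-1` [set z | ~~ small M z].
have mF M : measurable (F M) by apply: (fibers_preimage _ (X_fibers X_iid 0)).
have F0 : \bigcap_M F M = set0.
  apply/seteqP; split => // w h.
  have := h (\max_i `|X 0%N w ord0 i|)%N I; rewrite /F /= => /negP; apply.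
  by apply/forallP => i; apply: leq_bigmax.
have dec : nonincreasing_seq F.
  move=> a b ab; apply/subsetPset => w; rewrite /F /=; apply: contra => /forallP h.
  by apply/forallP => i; apply: leq_trans (h i) ab.
have := @nonincreasing_cvg_mu _ T R P F _ mF _ dec; rewrite F0 measure0 => h.
have {}h : P \o F @ \oo --> 0%E.
  by apply: h; [rewrite -ge0_fin_numE // fin_num_measure|exact: measurable0].
move/fine_cvgP : h => [_ /cvgrPdist_le /(_ _ dl0) [M0 _ hM]].
exists M0 => M /hM /=; rewrite sub0r normrN; apply: le_trans.
exact: ler_norm.
Qed.

Definition path_steps n (w : T) := [seq X j w | j <- iota 1 n].

(** The functional factors through the list of its first [n] steps, which lives in a countable type;
    this gives measurability. *)
Lemma self_intersection_path (al n : nat) w :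
  self_intersection_lt X al n w =
  self_intersection_lt (fun j s => nth 0 s j.-1) al n (path_steps n w) :> R.
Proof.
have wE j : (j <= n)%N -> walk X j w = walk (fun j s => nth 0 s j.-1) j (path_steps n w).
  move=> jn; apply: eq_big_nat => i /andP[i0 ij].
  rewrite (nth_map 0%N) ?size_iota; last lia.
  by rewrite nth_iota; [congr (X _ w); lia|lia].
rewrite /self_intersection_lt.
have -> : [seq walk X j w | j <- iota 1 n] =
   [seq walk (fun j s => nth 0 s j.-1) j (path_steps n w) | j <- iota 1 n].
  by apply/eq_in_map => j; rewrite mem_iota => hj; apply: wE; lia.
congr _%:R; apply: eq_bigr => x _; congr (_ ^ _)%N.
by apply: eq_big_nat => j /andP[_ jn]; rewrite wE.
Qed.

(** Both functionals lie between 0 and n^al. They agree unless one of the first [n] steps has a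
    coordinate larger than [M], since otherwise the walk cannot wrap around a torus of size at least
    n M; and for fixed [n] that event is made improbable by a large [M]. *)
Lemma variance_transfer al n (eta : R) : (0 < al)%N -> 0 < eta ->
  exists N0, forall N, (N0 <= N)%N ->
  ('V_P[self_intersection_lt X al n] <= (VarG (pN P X N) n (LG R n al) + eta)%:E)%E.
Proof.
move=> al0 eta0.
pose K : R := n%:R ^+ al.
have K0 : 0 <= K by rewrite exprn_ge0.
(* One [K ^+ 2] comes from the second moments and two from the squares of the means; [n%:R] is the
   union bound over the steps, and the 1 keeps [c] positive. *)
pose c := 3 * K ^+ 2 * n%:R + 1.
have c0 : 0 < c by rewrite ltr_wpDl // !mulr_ge0 ?sqr_ge0.
have [M hM] := large_prob (divr_gt0 eta0 c0).
exists (n * M)%N => N hN.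
pose bad j := X j @^-1` [set z | ~~ small M z].
have mbad j : measurable (bad j) by apply: (fibers_preimage _ (X_fibers X_iid j)).
pose I w : R := \sum_(j <- iota 1 n) ind (bad j) w.
have I0 w : 0 <= I w by apply: sumr_ge0 => j _; rewrite /ind indicE ler0n.
have bI : bmf I by apply: bmf_sum => j; apply: bmf_ind.
have EI : Er P I <= n%:R * (eta / c).
  rewrite Er_sum; last by move=> j; apply: bmf_ind.
  apply: (@le_trans _ _ (\sum_(j <- iota 1 n) eta / c)).
    apply: ler_sum => j _; rewrite Er_ind // /bad X_iid.2.2; exact: hM.
  by rewrite big_const_seq count_predT size_iota iter_addr addr0 mulr_natl.
have EI0 : 0 <= Er P I by apply: Er_ge0.
pose L w : R := self_intersection_lt X al n w.
pose L' w : R := LG R n al (steps X N n w).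
have L'01 w : 0 <= L' w <= K by apply: LG_le.
have L01 w : 0 <= L w <= K.
  have [N1 hN1] := tproj_inj_on [seq walk X j w | j <- iota 1 n].
  by rewrite /L (self_intersectionE R al0 (hN1 N1 (leqnn _))); apply: LG_le.
have same w : I w < 1 -> L w = L' w.
  move=> Iw; apply: self_intersectionE => //; apply: (walk_inj hN) => j hj.
  apply/negPn/negP => nb; move: Iw; rewrite ltNge => /negP; apply.
  rewrite /I (bigD1_seq j) ?iota_uniq //=; last by rewrite mem_iota; lia.
  rewrite /ind indicE mem_set // lerDl; apply: sumr_ge0 => i _.
  by rewrite /ind indicE ler0n.
have bL : bmf L.
  have -> : L = (fun w => self_intersection_lt (fun j s => nth 0 s j.-1) al n (path_steps n w)).
    by apply/funext => w; rewrite /L self_intersection_path.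
  apply: (@fibers_bmf _ _ _ _ (path_steps n) _ K).
    by apply: fibers_map; exact: (X_fibers X_iid).
  move=> w; rewrite -self_intersection_path; have /andP[h1 h2] := L01 w.
  by rewrite ger0_norm.
have bL' : bmf L'.
  apply: (@fibers_bmf _ _ _ _ (steps X N n) (LG R n al) K).
    exact: (steps_fibers X_iid).
  by move=> w; have /andP[h1 h2] := L'01 w; rewrite ger0_norm.
have bKI k : bmf (fun w => k * I w) by apply: bmfM => //; apply: bmf_cst.
have h1 : Er P (fun w => L w ^+ 2) <= Er P (fun w => L' w ^+ 2) + K ^+ 2 * Er P I.
  rewrite -ErZ // -ErD //; last exact: bmfM.
  apply: ler_Er; [exact: bmfM|by apply: bmfD => //; exact: bmfM|].
  move=> w; case: (ltP (I w) 1) => h; first by rewrite same // lerDl mulr_ge0 ?sqr_ge0.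
  have /andP[l1 l2] := L01 w.
  apply: (@le_trans _ _ (K ^+ 2)); first by rewrite lerXn2r ?nnegrE.
  by rewrite -[leLHS]add0r lerD ?sqr_ge0 // ler_peMr ?sqr_ge0.
have h2 : Er P L' - K * Er P I <= Er P L.
  rewrite lerBlDr -ErZ // -ErD //.
  apply: ler_Er => //; first exact: bmfD.
  move=> w; case: (ltP (I w) 1) => h; first by rewrite same // lerDl mulr_ge0.
  have /andP[l1 l2] := L'01 w; have /andP[l3 l4] := L01 w.
  by apply: (le_trans l2); rewrite -[leLHS]add0r lerD // ler_peMr.
have eL' : 0 <= Er P L' <= K.
  apply/andP; split; first by apply: Er_ge0 => w; have /andP[] := L'01 w.
  rewrite -(Er_cst P K); apply: ler_Er => //; first exact: bmf_cst.
  by move=> w; have /andP[] := L'01 w.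
have eL : 0 <= Er P L <= K.
  apply/andP; split; first by apply: Er_ge0 => w; have /andP[] := L01 w.
  rewrite -(Er_cst P K); apply: ler_Er => //; first exact: bmf_cst.
  by move=> w; have /andP[] := L01 w.
rewrite (varianceEr P bL) lee_fin /VarG.
rewrite -(@Er_steps _ _ _ P _ _ X_iid N n (LG R n al)) -(@Er_steps _ _ _ P _ _ X_iid N n (fun s => LG R n al s ^+ 2)).
rewrite -/L'.
have h3 : Er P L' ^+ 2 - Er P L ^+ 2 <= 2 * K * (K * Er P I).
  rewrite subr_sqr; move: h2 eL' eL; move: (Er P L') (Er P L) => a b h2 /andP[a0 a1] /andP[b0 b1].
  have KI : 0 <= K * Er P I by rewrite mulr_ge0.
  apply: (@le_trans _ _ (K * Er P I * (a + b))).
    by rewrite ler_wpM2r ?addr_ge0 //; lra.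
  by rewrite mulrC ler_wpM2r //; lra.
have h4 : 3 * K ^+ 2 * Er P I <= eta.
  apply: (@le_trans _ _ (3 * K ^+ 2 * (n%:R * (eta / c)))).
    by rewrite ler_wpM2l ?mulr_ge0 ?sqr_ge0.
  have -> : 3 * K ^+ 2 * (n%:R * (eta / c)) = eta * (3 * K ^+ 2 * n%:R) / c by ring.
  by rewrite ler_pdivrMr // ler_pM2l // lerDl.
move: h1 h3 h4; set a := Er P (fun w => L w ^+ 2); set b := Er P (fun w => L' w ^+ 2).
rewrite -/L'; move: (Er P L ^+ 2) (Er P L' ^+ 2) (Er P I) => q r i.
rewrite !expr2; nra.
Qed.

End VarianceTransfer.

(** * Moments of the step *)

Section Atoms.
Context {dT : measure_display} {T : measurableType dT} {R : realType} (P : probability T R).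
Variables (d : nat) (X : nat -> T -> 'rV[int]_d).
Hypothesis X_iid : iid P X.

Lemma mu_eq0 z : (mu P X z <= 0) = (P (X 0%N @^-1` [set z]) == 0%E).
Proof.
have h : P (X 0%N @^-1` [set z]) \is a fin_num by apply: fin_num_measure; apply: (X_fibers X_iid).
by rewrite -[P _](fineK h) eqe -/(mu P X z) eq_le (mu_ge0 P X) andbT.
Qed.

Lemma mu_le1 z : mu P X z <= 1.
Proof. by have := @sum_mu_le1 _ _ _ P _ X X_iid [:: z] isT; rewrite big_seq1. Qed.

(** If no two atoms differ by [z], splitting the event according to the value of the second step
    covers it by countably many negligible sets. *)
Lemma support_diff z : Defs.support P (fun w => X 1%N w - X 2%N w) z ->
  exists ab : 'rV[int]_d * 'rV[int]_d,
    [/\ z = ab.1 - ab.2, 0 < mu P X ab.1 & 0 < mu P X ab.2].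
Proof.
rewrite /Defs.support /= => Pz.
have [//|nex] := pselect (exists ab : 'rV[int]_d * 'rV[int]_d,
    [/\ z = ab.1 - ab.2, 0 < mu P X ab.1 & 0 < mu P X ab.2]); exfalso.
have [_ [_ idX]] := X_iid.
pose F k : set T := if unpickle k is Some b
  then (X 1%N @^-1` [set z + b]) `&` (X 2%N @^-1` [set b]) else set0.
have atom j y : ~ 0 < mu P X y -> P.-negligible (X j @^-1` [set y]).
  move=> /negP; rewrite -leNgt mu_eq0 => /eqP e.
  apply/negligibleP; first exact: (X_fibers X_iid).
  exact: etrans (idX j [set y]) e.
have FN k : P.-negligible (F k).
  rewrite /F; case: (unpickle k) => [b|]; last exact: negligible_set0.
  have [h1|h1] := pselect (0 < mu P X (z + b)); last first.
    by apply: negligibleS (atom 1%N _ h1) => w [].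
  have [h2|h2] := pselect (0 < mu P X b); last first.
    by apply: negligibleS (atom 2%N _ h2) => w [].
  by exfalso; apply: nex; exists (z + b, b); rewrite /= addrK.
have sub : (fun w => X 1%N w - X 2%N w) @^-1` [set z] `<=` \bigcup_k F k.
  move=> w /= e; exists (pickle (X 2%N w)) => //.
  by rewrite /F pickleK; split => //=; rewrite -e subrK.
have mE : measurable ((fun w => X 1%N w - X 2%N w) @^-1` [set z]).
  exact: (fibers_preimage [set s | nth 0 s 0 - nth 0 s 1 = z]
    (fibers_map [:: 1; 2]%N (X_fibers X_iid))).
have /(negligibleP P mE) e := negligibleS sub (negligible_bigcup FN).
by move: (lt_eqF Pz); rewrite eq_sym => /eqP; apply.
Qed.

(** A point of the support of the difference is (y - x0) - (y' - x0) with atoms y and y'. So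
    finitely many vectors y - x0 span the space, and [d] of them form a basis. *)
Lemma mu_basis : (0 < d)%N -> genuinely_d_dim P X ->
  exists (x0 : 'rV[int]_d) (a : 'I_d -> 'rV[int]_d) (rmin : R),
    [/\ 0 < mu P X x0, 0 < rmin, (forall r, rmin <= mu P X (a r))
      & basis_mx R x0 a \in unitmx].
Proof.
move=> d0 gen.
have /boolp.choice[ab hab] : forall z, exists ab : 'rV[int]_d * 'rV[int]_d,
    Defs.support P (fun w => X 1%N w - X 2%N w) z ->
    [/\ z = ab.1 - ab.2, 0 < mu P X ab.1 & 0 < mu P X ab.2].
  move=> z; have [/support_diff[ab h]|n] := pselect (Defs.support P (fun w => X 1%N w - X 2%N w) z).
    by exists ab.
  by exists (0, 0) => /n.
have /boolp.choice[S hS] : forall j : 'I_d, exists S : seq 'rV[int]_d,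
    (forall z, z \in S -> Defs.support P (fun w => X 1%N w - X 2%N w) z) /\
    exists c : seq R, delta_mx ord0 j = \sum_(i < size S) c`_i *: toR (nth 0 S i).
  by move=> j; have [s [c [h1 h2]]] := gen (delta_mx ord0 j); exists s; split=> //; exists c.
pose x0 := (ab (nth 0 (S (Ordinal d0)) 0)).1.
have x0P : 0 < mu P X x0.
  have [h1 [c h2]] := hS (Ordinal d0); case: (hab (nth 0 (S (Ordinal d0)) 0)) => //.
  apply: h1; apply: mem_nth; rewrite lt0n; apply/eqP => e.
  move: h2; case: (S _) e => // _; rewrite big_ord0 => /matrixP/(_ ord0 (Ordinal d0)).
  by rewrite !mxE !eqxx => /eqP; rewrite oner_eq0.
pose A := flatten [seq [seq (ab z).1 | z <- S j] ++ [seq (ab z).2 | z <- S j] | j <- enum 'I_d].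
have Apos y : y \in A -> 0 < mu P X y.
  move=> /flattenP[s /mapP[j _ ->]]; rewrite mem_cat => /orP[] /mapP[z zS ->];
  by case: (hab z ((hS j).1 z zS)).
pose M : 'M[R]_(size A, d) := \matrix_k toR (nth 0 A k - x0).
have subM y : y \in A -> (@toR R d (y - x0) <= M)%MS.
  move=> yA; have iA : (index y A < size A)%N by rewrite index_mem.
  by apply: (eq_row_sub (Ordinal iA)); rewrite rowK /= nth_index.
have fullM : row_full M.
  rewrite -sub1mx; apply/row_subP => j; rewrite row1.
  have [h1 [c ->]] := hS j; apply: summx_sub => i _; apply: scalemx_sub.
  set z := nth 0 _ _.
  have zS : z \in S j by apply: mem_nth.
  have [e _ _] := hab z (h1 z zS).
  have -> : toR z = toR ((ab z).1 - x0) - toR ((ab z).2 - x0) :> 'rV[R]_d.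
    by rewrite -toRB opprB addrA subrK -e.
  have inA y : y \in [seq (ab z).1 | z <- S j] ++ [seq (ab z).2 | z <- S j] -> y \in A.
    move=> yj; apply/flattenP; exists ([seq (ab z).1 | z <- S j] ++ [seq (ab z).2 | z <- S j]) => //.
    by apply/mapP; exists j; rewrite ?mem_enum.
  apply: addmx_sub; rewrite ?eqmx_opp; apply/subM/inA; rewrite mem_cat.
    by rewrite (map_f (fun z => (ab z).1) zS).
  by rewrite (map_f (fun z => (ab z).2) zS) orbT.
pose a r := nth 0 A (fullrankfun fullM r).
have aP r : 0 < mu P X (a r) by apply/Apos/mem_nth.
(* The masses are at most 1, so their product is a positive lower bound for each. *)
exists x0, a, (\prod_r mu P X (a r)); split => //.
- by apply: prodr_gt0 => r _.
- move=> r; rewrite (bigD1 r) //= ler_piMr ?(ltW (aP r)) // prodr_ile1 // => i _.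
  by rewrite (ltW (aP i)) mu_le1.
- have -> : basis_mx R x0 a = rowsub (fullrankfun fullM) M.
    by apply/matrixP => r j; rewrite !mxE.
  exact: fullrowsub_unit.
Qed.

(** Truncation along the enumeration [pickle] of Z^d, then monotone convergence. *)
Lemma expectation_le_finite_sums (f : 'rV[int]_d -> R) K : (forall z, 0 <= f z) ->
  (forall F, uniq F -> \sum_(z <- F) mu P X z * f z <= K) ->
  ('E_P[fun w => f (X 0%N w)] <= K%:E)%E.
Proof.
move=> f0 hF.
pose g n (z : 'rV[int]_d) : R := if (pickle z < n)%N then f z else 0.
have g0 n z : 0 <= g n z by rewrite /g; case: ifP.
have mg n : measurable_fun setT (fun w => (g n (X 0%N w))%:E).
  apply/measurable_EFinP => _ B mB; rewrite setTI.
  exact: (fibers_preimage (g n @^-1` B) (X_fibers X_iid 0)).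
have hg n : (\int[P]_w (g n (X 0%N w))%:E <= K%:E)%E.
  pose F := pmap (@pickle_inv 'rV[int]_d) (iota 0 n).
  have memF z : (z \in F) = (pickle z < n)%N.
    rewrite mem_pmap; apply/mapP/idP => [[k]|h].
      by rewrite mem_iota add0n /= => kn /esym e; have := @pickle_invK 'rV[int]_d k; rewrite /ocancel e /= => ->.
    by exists (pickle z); rewrite ?pickleK_inv // mem_iota.
  have uF : uniq F.
    apply: (@pmap_uniq _ _ _ (@pickle 'rV[int]_d)); last exact: iota_uniq.
    by move=> k; apply: pickle_invK.
  pose G w : R := \sum_(z <- F) f z * ind (X 0%N @^-1` [set z]) w.
  have bG : bmf G by apply: bmf_sum => z; apply: bmfM; [exact: bmf_cst|apply: bmf_ind; exact: (X_fibers X_iid)].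
  have -> : (fun w => (g n (X 0%N w))%:E) = (fun w => (G w)%:E).
    apply/funext => w; congr _%:E; rewrite /G /g -memF; case: ifPn => h.
      rewrite (bigD1_seq (X 0%N w)) //= big1 => [|z hz].
        by rewrite addr0 /ind indicE mem_set // mulr1.
      by rewrite /ind indicE memNset ?mulr0 //= => e; move: hz; rewrite e eqxx.
    rewrite big_seq big1 // => z hz; rewrite /ind indicE memNset ?mulr0 //= => e.
    by move: h; rewrite e hz.
  have := ErE P bG; rewrite unlock => ->; rewrite lee_fin.
  rewrite Er_sum; last by move=> z; apply: bmfM; [exact: bmf_cst|apply: bmf_ind; exact: (X_fibers X_iid)].
  apply: le_trans (hF F uF); apply: ler_sum => z _.
  by rewrite ErZ ?Er_ind // 1?mulrC //; try apply: bmf_ind; apply: (X_fibers X_iid).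
have gm w : {homo (fun n => (g n (X 0%N w))%:E) : n m / (n <= m)%N >-> (n <= m)%E}.
  move=> n m nm; rewrite lee_fin /g; case: ifP => h; last by case: ifP.
  by rewrite (leq_trans h nm).
have cv := cvg_monotone_convergence (mu := P) measurableT mg (fun n x _ => g0 n _) (fun w _ => gm w).
have limg w : limn (fun n => (g n (X 0%N w))%:E) = (f (X 0%N w))%:E.
  apply: cvg_lim => //; apply: cvg_near_cst.
  by exists (pickle (X 0%N w)).+1 => // n /= hn; rewrite /g hn.
rewrite unlock.
have -> : (\int[P]_w (EFin \o (fun w => f (X 0%N w))) w = \int[P]_w limn (fun n => (g n (X 0%N w))%:E))%E.
  by apply: eq_integral => w _; rewrite limg.
rewrite -(cvg_lim _ cv) //; apply: lime_le; first by apply/cvg_ex; eexists; exact: cv.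
by apply: nearW => n.
Qed.

(** If all finite sums in all coordinates stayed below [B], the second moment would be finite,
    because a vector depends linearly on its coordinates. *)
Lemma large_coord (x0 : 'rV[int]_d) (a : 'I_d -> 'rV[int]_d) (B : R) :
  basis_mx R x0 a \in unitmx -> ~ ('E_P[fun w => sqnorm (X 0%N w)] < +oo)%E ->
  exists i0 : 'I_d, exists2 F, uniq F &
    B <= \sum_(z <- F) mu P X z * coord R x0 a (z - x0) i0 ^+ 2.
Proof.
move=> Mu inf.
have [//|nex] := pselect (exists i0 : 'I_d, exists2 F, uniq F &
    B <= \sum_(z <- F) mu P X z * coord R x0 a (z - x0) i0 ^+ 2).
exfalso; apply: inf.
have small_sum (i0 : 'I_d) F : uniq F ->
    \sum_(z <- F) mu P X z * coord R x0 a (z - x0) i0 ^+ 2 <= B.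
  move=> uF; rewrite leNgt; apply/negP => h; apply: nex; exists i0, F => //; exact: ltW.
pose M := basis_mx R x0 a.
pose V := \sum_i \sum_r d%:R * M r i ^+ 2.
have V0 i : 0 <= \sum_r d%:R * M r i ^+ 2 by apply: sumr_ge0 => r _; rewrite mulr_ge0 ?sqr_ge0.
have sq0 z : 0 <= sqnorm z :> R by apply: sumr_ge0 => i _; rewrite sqr_ge0.
have bnd z : sqnorm z <= 2 * sqnorm x0 + 2 * V * \sum_r coord R x0 a (z - x0) r ^+ 2.
  pose c := coord R x0 a (z - x0).
  have zi i : ((z ord0 i)%:~R : R) = (x0 ord0 i)%:~R + \sum_r c r * M r i.
    have /rowP/(_ i) := toR_coord Mu (z - x0); rewrite toRB !mxE => e.
    have {}e : (z ord0 i)%:~R - (x0 ord0 i)%:~R = \sum_r c r * M r i :> R.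
      by rewrite e; apply: eq_bigr => r _; rewrite mxE.
    by rewrite -e addrC subrK.
  apply: (@le_trans _ _ (\sum_i (2 * (x0 ord0 i)%:~R ^+ 2 +
      2 * ((\sum_r d%:R * M r i ^+ 2) * \sum_r c r ^+ 2)))).
    apply: ler_sum => i _; rewrite zi.
    have h : (\sum_r c r * M r i) ^+ 2 <= (\sum_r d%:R * M r i ^+ 2) * \sum_r c r ^+ 2.
      apply: (@le_trans _ _ (d%:R * \sum_r (c r * M r i) ^+ 2)); first exact: sqr_sum_le.
      rewrite mulr_sumr mulr_suml; apply: ler_sum => r _; rewrite exprMn [leLHS]mulrCA [leLHS]mulrC.
      apply: ler_wpM2l; first by rewrite mulr_ge0 ?sqr_ge0.
      rewrite (bigD1 r) //= lerDl.
      by apply: sumr_ge0 => r' _; rewrite sqr_ge0.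
    move: h; set s := \sum_r c r * _; set t := _ * _; set x := _%:~R => h.
    have : 0 <= (x - s) ^+ 2 by apply: sqr_ge0.
    by rewrite !expr2 in h *; nra.
  rewrite big_split /= -!mulr_sumr lerD2l -mulrA -mulr_suml; exact: lexx.
have V1 : 0 <= V by apply: sumr_ge0.
apply: (@le_lt_trans _ _ (2 * sqnorm x0 + 2 * V * (d%:R * B))%:E); last exact: ltry.
apply: expectation_le_finite_sums => // F uF.
apply: (@le_trans _ _ (\sum_(z <- F) (mu P X z * (2 * sqnorm x0) +
     2 * V * \sum_r mu P X z * coord R x0 a (z - x0) r ^+ 2))).
  apply: ler_sum => z _; rewrite -mulr_sumr [2 * V * _]mulrCA -mulrDr.
  exact: (ler_wpM2l (mu_ge0 P X z) (bnd z)).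
rewrite big_split /= -mulr_suml -mulr_sumr lerD //.
  by rewrite ler_piMl ?mulr_ge0 // sum_mu_le1.
rewrite ler_wpM2l ?mulr_ge0 // exchange_big /=.
apply: (@le_trans _ _ (\sum_(r < d) B)); first by apply: ler_sum => r _; exact: small_sum.
by rewrite sumr_const card_ord mulr_natl.
Qed.

End Atoms.

Section MeanDrift.
Context {dT : measure_display} {T : measurableType dT} {R : realType} (P : probability T R).

Lemma Er_lin (f g h : T -> R) c : f \in Lfun P 1 -> g \in Lfun P 1 -> h \in Lfun P 1 ->
  Er P (fun w => c * f w + g w - h w) = c * Er P f + Er P g - Er P h.
Proof.
move=> hf hg hh; rewrite /Er.
have fc : c \o* f \in Lfun P 1 by apply: Lfun_scale.
have -> : (fun w => c * f w + g w - h w) = ((c \o* f) \+ g) \- h.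
  by apply/funext => w /=; rewrite (mulrC c).
have sg : (c \o* f) \+ g \in Lfun P 1
  by move/Lfun1_integrable : fc => fc; move/Lfun1_integrable : hg => hg;
    apply/Lfun1_integrable; exact: (integrableD measurableT fc hg).
rewrite expectationB // expectationD // expectationZl //.
rewrite fineB ?fineD ?fineM ?fin_numM ?fin_numD ?expectation_fin_num //.
by rewrite -expectationZl // expectation_fin_num.
Qed.

Variables (d : nat) (X : nat -> T -> 'rV[int]_d).
Hypothesis X_iid : iid P X.
Hypothesis sq_fin : ('E_P[fun w => sqnorm (X 0%N w)] < +oo)%E.

Lemma Lfun_dominated (f : 'rV[int]_d -> R) : (forall z, `|f z| <= sqnorm z) ->
  (fun w => f (X 0%N w)) \in Lfun P 1.
Proof.
move=> hf; have mX (g : 'rV[int]_d -> R) : measurable_fun setT (EFin \o (fun w => g (X 0%N w))).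
  apply/measurable_EFinP => _ B mB; rewrite setTI.
  exact: (fibers_preimage (g @^-1` B) (X_fibers X_iid 0)).
have sq0 (z : 'rV[int]_d) : 0 <= sqnorm z :> R by apply: sumr_ge0 => i _; rewrite sqr_ge0.
apply/Lfun1_integrable; apply: (le_integrable measurableT (g := EFin \o (fun w => sqnorm (X 0%N w)))).
- exact: mX.
- by move=> w _ /=; rewrite lee_fin (ger0_norm (sq0 _)).
apply/integrableP; split; first exact: mX.
move: sq_fin; rewrite unlock; congr (_ < _)%E; apply: eq_integral => w _ /=.
by rewrite ger0_norm.
Qed.

Variable i : 'I_d.
Let Y w : R := (X 0%N w ord0 i)%:~R.

Lemma sqr_coord_le (z : 'rV[int]_d) : (z ord0 i)%:~R ^+ 2 <= sqnorm z :> R.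
Proof.
rewrite /sqnorm (bigD1 i) //= lerDl; apply: sumr_ge0 => j _; exact: sqr_ge0.
Qed.

Lemma Lfun_coord : Y \in Lfun P 1.
Proof.
apply: (@Lfun_dominated (fun z => (z ord0 i)%:~R)) => z; apply: le_trans (sqr_coord_le z).
rewrite -intr_norm -rmorphXn ler_int; move: (z ord0 i) => k; nia.
Qed.

Lemma Lfun_coord_sq : (fun w => Y w ^+ 2) \in Lfun P 1.
Proof.
apply: (@Lfun_dominated (fun z => (z ord0 i)%:~R ^+ 2)) => z.
by rewrite ger0_norm ?sqr_ge0 // sqr_coord_le.
Qed.

Let sg2 := Er P (fun w => Y w ^+ 2).
Let W N (g : 'rV['I_N.+2]_d) : R := (clift (g ord0 i))%:~R.

Lemma W_tproj N z : W (tproj N z) = (clift ((z ord0 i)%:~R : 'I_N.+2))%:~R.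
Proof. by rewrite /W mxE. Qed.

Lemma bmf_W N (f : R -> R) : bmf (fun w => f (W (tproj N (X 0%N w)))).
Proof.
apply: (@fibers_bmf _ _ _ _ (fun w => tproj N (X 0%N w)) (fun g => f (W g))
  (\sum_g `|f (W (g : 'rV['I_N.+2]_d))|)).
  exact: (fibers_comp (@tproj N d) (X_fibers X_iid 0)).
by move=> w; rewrite (bigD1 (tproj N (X 0%N w))) //= lerDl; apply: sumr_ge0.
Qed.

Lemma torus_second_moment N : \sum_g pN P X N g * W g ^+ 2 <= sg2.
Proof.
rewrite -(@Er_tproj _ _ _ P _ X X_iid N (fun g => W g ^+ 2)) /sg2 /Er.
apply: fine_le.
- exact/expectation_fin_num/bmf_Lfun/(bmf_W N (fun x => x ^+ 2)).
- exact/expectation_fin_num/Lfun_coord_sq.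
apply: expectation_le.
- by have [] := bmf_W N (fun x => x ^+ 2).
- move=> _ B mB; rewrite setTI.
  exact: (fibers_preimage ((fun z : 'rV[int]_d => (z ord0 i)%:~R ^+ 2) @^-1` B) (X_fibers X_iid 0)).
- by move=> w; rewrite sqr_ge0.
- by move=> w; rewrite sqr_ge0.
apply/aeW => w; rewrite W_tproj /Y -!rmorphXn ler_int.
by have := clift_le N (X 0%N w ord0 i); move: (clift _) => c; nia.
Qed.

(** The two numbers agree unless 2 |k| >= N + 2. In that case they differ by at most 2 |k|, which
    the same inequality bounds by 4 k^2 / (N + 2). *)
Lemma clift_dist N (k : int) :
  `|(clift (k%:~R : 'I_N.+2))%:~R - k%:~R : R| <= 4 / N.+2%:R * k%:~R ^+ 2.
Proof.
have N0 : 0 < N.+2%:R :> R by [].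
case: (ltnP `|k|.*2 N.+2) => h; first by rewrite clift_small // subrr normr0 mulr_ge0 ?sqr_ge0 ?divr_ge0.
rewrite mulrAC ler_pdivlMr // -intrB -intr_norm -rmorphXn.
rewrite -[N.+2%:R]/(N.+2%:~R) -[4]/(4%:~R) -!intrM ler_int.
by have := clift_le N k; move: (clift _) => c; nia.
Qed.

(** The finite second moment makes the drift of the lift converge to the mean of the step, so a
    nonzero mean persists on large tori. *)
Lemma torus_mean N : `|\sum_g pN P X N g * W g - Er P Y| <= 4 / N.+2%:R * sg2.
Proof.
rewrite -(@Er_tproj _ _ _ P _ X X_iid N (@W N)).
have LW : (fun w => W (tproj N (X 0%N w))) \in Lfun P 1 := bmf_Lfun P (bmf_W N id).
have h1 : 0 <= Er P (fun w => 4 / N.+2%:R * Y w ^+ 2 + Y w - W (tproj N (X 0%N w))).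
  apply: Er_ge0 => w; have := clift_dist N (X 0%N w ord0 i).
  by rewrite W_tproj -/(Y w) ler_norml => /andP[_]; rewrite lerBlDr subr_ge0.
have h2 : 0 <= Er P (fun w => 4 / N.+2%:R * Y w ^+ 2 + W (tproj N (X 0%N w)) - Y w).
  apply: Er_ge0 => w; have := clift_dist N (X 0%N w ord0 i).
  rewrite W_tproj -/(Y w) ler_norml => /andP[+ _]; rewrite lerNl opprB lerBlDr subr_ge0 //.
move: h1 h2; rewrite !Er_lin ?Lfun_coord ?Lfun_coord_sq // -/sg2.
move: (4 / _ * _) (Er P Y) (Er P _) => x y z h1 h2.
by rewrite ler_norml; apply/andP; split; lra.
Qed.

(** The lifted displacement of a closed path on the torus is a multiple of N + 2. *)
Lemma W_return N (s : seq 'rV['I_N.+2]_d) :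
  \sum_(g <- s) g = 0 -> `|Ws (@W N) s| < N.+2%:R -> Ws (@W N) s = 0.
Proof.
move=> s0; pose k : int := \sum_(g <- s) clift (g ord0 i).
have -> : Ws (@W N) s = k%:~R by rewrite /Ws /k rmorph_sum.
rewrite -intr_norm -[N.+2%:R]/(N.+2%:~R) ltr_int => h.
rewrite (@intr_Zp_eq0 N k) //.
rewrite /k rmorph_sum /= (eq_bigr (fun g : 'rV['I_N.+2]_d => g ord0 i)); last by move=> g _; rewrite cliftK.
by have /rowP/(_ i) := s0; rewrite summxE mxE.
Qed.

Lemma sqd_half m : (1 < m)%N -> sqd R d m <= 2 ^+ d * sqd R d m./2.
Proof.
move=> m1; rewrite /sqd -exprMn lerXn2r ?nnegrE ?mulr_ge0 ?sqrtr_ge0 //.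
rewrite -[2]ger0_norm // -sqrtr_sqr -sqrtrM ?sqr_ge0 // ler_wsqrtr //.
by rewrite -natrX -natrM ler_nat; lia.
Qed.

Lemma drift_decay (C eps : R) : Er P Y != 0 -> 0 <= C -> 0 < eps ->
  (forall n, exists N0, forall N, (N0 <= N)%N -> forall m x, (0 < m <= n)%N ->
     pn (pN P X N) m x <= C / sqd R d m) ->
  exists m1, forall n, exists N0, forall N, (N0 <= N)%N -> forall m, (m1 <= m <= n)%N ->
     pn (pN P X N) m 0 <= eps / sqd R d m.
Proof.
set v := Er P Y => v0 C0 eps0 hC.
have s0 : 0 <= sg2 by apply: Er_ge0 => w; rewrite sqr_ge0.
have v2 : 0 < v ^+ 2 by rewrite exprn_even_gt0.
have av : 0 < `|v| by rewrite normr_gt0.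
(* The 24 is 2 * 3 * 4: there are two halves, each of length at least m / 3, and [v ^+ 2] is at most
   four times [w ^+ 2]. The factor [2 ^+ d] compares [sqd] at m and at m / 2. *)
pose A := C * 2 ^+ d * 24 * sg2 / v ^+ 2.
have A0 : 0 <= A by rewrite !mulr_ge0 ?exprn_ge0 ?invr_ge0 ?(ltW v2).
pose m1 := (Num.truncn (2 * A / eps)).+3.
exists m1 => n.
have [N1 hN1] := hC n.
pose B := n%:R ^+ 2 * sg2 * 2 * sqd R d n / eps.
(* The three thresholds yield the heat kernel bound, a torus drift [w] within half of [v], and a
   negligible wrap-around term. *)
exists (maxn N1 (maxn (Num.truncn (8 * sg2 / `|v|)).+1 (Num.truncn B).+1)) => N.
rewrite !geq_max => /and3P[hN h2 h3] m /andP[m1m mn].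
have m_gt1 : (1 < m)%N by apply: leq_trans m1m.
pose w := \sum_g pN P X N g * W g.
have NN : 0 < N.+2%:R :> R by [].
have dist : `|w - v| <= `|v| / 2.
  apply: (le_trans (torus_mean N)); rewrite mulrAC ler_pdivrMr //.
  have : 8 * sg2 / `|v| <= N.+2%:R.
    apply: ltW; apply: (lt_le_trans (truncnS_gt _)); rewrite ler_nat.
    by apply: (leq_trans h2); rewrite -addn2 leq_addr.
  by rewrite ler_pdivrMr //; move: N.+2%:R => q; lra.
have w2 : v ^+ 2 / 4 <= w ^+ 2.
  have : `|v| / 2 <= `|w|.
    have := ler_distD w v 0; rewrite !subr0 distrC; move: dist; lra.
  move=> h; rewrite -[w ^+ 2]real_normK ?num_real // -[v ^+ 2]real_normK ?num_real //.
  by move: h av; move: `|v| `|w| => p q h p0; rewrite !expr2; nra.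
have wn0 : w != 0.
  apply/eqP => e; move: w2; rewrite e expr0n /= leNgt => /negP; apply.
  by rewrite divr_gt0.
pose a := m./2; pose b := (m - a)%N.
have [a0 ab abm a3] : [/\ 0 < a, a <= b, (a + b)%N = m & m <= 3 * a]%N.
  by rewrite /b /a; move: m_gt1; clear; split; lia.
have [am bm] : (a <= n /\ 0 < b <= n)%N by move: a0 ab abm mn; clear; lia.
have sm : 0 < sqd R d m by apply/sqd_gt0/ltnW.
have sa : 0 < sqd R d a by apply: sqd_gt0.
pose q := C / sqd R d a.
have q0 : 0 <= q by rewrite divr_ge0 ?(ltW sa).
have qa x : pn (pN P X N) a x <= q by apply: hN1 => //; rewrite a0.
have qb x : pn (pN P X N) b x <= q.
  apply: (le_trans (hN1 N hN b x _)) => //.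
  rewrite ler_wpM2l // lef_pV2 ?posrE ?sqd_gt0 //; last exact: leq_trans a0 ab.
  by rewrite lerXn2r ?nnegrE ?sqrtr_ge0 // ler_wsqrtr // ler_nat.
have qm : q <= C * 2 ^+ d / sqd R d m.
  rewrite /q -mulrA ler_wpM2l // ler_pdivlMr // ler_pdivrMl // mulrC.
  exact: sqd_half.
have := return_drift (pN_ge0 P X (N := N)) (pN_sum1 X_iid N) (erefl w) (torus_second_moment N) wn0 a0
  (leq_trans a0 ab) NN qa qb (@W_return N).
rewrite abm => /le_trans; apply.
have mR : 0 < m%:R :> R by rewrite ltr0n ltnW.
have term c : (a <= c)%N -> sg2 / (c%:R * w ^+ 2) <= 12 * sg2 / (m%:R * v ^+ 2).
  move=> ac; have cR : m%:R <= 3 * c%:R :> R by rewrite -natrM ler_nat (leq_trans a3) // leq_mul2l.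
  have c0 : 0 < c%:R :> R by rewrite ltr0n (leq_trans a0).
  have w20 : 0 < w ^+ 2 by rewrite exprn_even_gt0.
  rewrite ler_pdivrMr ?(mulr_gt0 c0 w20) // mulrAC ler_pdivlMr ?(mulr_gt0 mR v2) //.
  rewrite [12 * sg2]mulrC -[leRHS]mulrA ler_wpM2l //.
  have : m%:R * v ^+ 2 <= (3 * c%:R) * (4 * w ^+ 2).
    apply: ler_pM; rewrite ?(ltW mR) ?(ltW v2) //; move: w2; lra.
  by move=> h; apply: (le_trans h); apply: ler_of_eq; ring.
have T12 : q * (sg2 / (a%:R * w ^+ 2)) + q * (sg2 / (b%:R * w ^+ 2)) <= eps / 2 / sqd R d m.
  rewrite -mulrDr.
  apply: (@le_trans _ _ (q * (24 * sg2 / (m%:R * v ^+ 2)))).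
    rewrite ler_wpM2l //; have := term a (leqnn _); have := term b ab.
    set t1 := 12 * sg2 / _; set t2 := sg2 / (b%:R * _); set t3 := sg2 / (a%:R * _).
    have -> : 24 * sg2 / (m%:R * v ^+ 2) = 2 * t1 by rewrite /t1; ring.
    lra.
  apply: (@le_trans _ _ (C * 2 ^+ d / sqd R d m * (24 * sg2 / (m%:R * v ^+ 2)))).
    apply: ler_wpM2r => //; apply: divr_ge0; first by rewrite mulr_ge0.
    exact/ltW/mulr_gt0.
  have -> : C * 2 ^+ d / sqd R d m * (24 * sg2 / (m%:R * v ^+ 2)) = A / m%:R / sqd R d m.
    by rewrite /A invfM; ring.
  rewrite ler_pM2r ?invr_gt0 // ler_pdivrMr //.
  have : 2 * A / eps <= m%:R.
    apply: ltW; apply: (lt_le_trans (truncnS_gt _)); rewrite ler_nat.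
    by apply: leq_trans m1m; rewrite /m1 -addn3 -addn1 leq_add2l.
  by rewrite ler_pdivrMr //; move: m%:R => q'; lra.
have T3 : m%:R ^+ 2 * sg2 / N.+2%:R ^+ 2 <= eps / 2 / sqd R d m.
  rewrite ler_pdivlMr // mulrAC ler_pdivrMr ?exprn_gt0 //.
  have : B <= N.+2%:R ^+ 2.
    apply: ltW; apply: (lt_le_trans (truncnS_gt _)).
    by rewrite -natrX ler_nat; apply: (leq_trans h3); clear; nia.
  rewrite /B ler_pdivrMr // => hB.
  have h4 : m%:R ^+ 2 * sg2 * sqd R d m <= n%:R ^+ 2 * sg2 * sqd R d n.
    apply: ler_pM => //; [by rewrite mulr_ge0 ?sqr_ge0|exact: ltW| |].
      by rewrite ler_wpM2r // lerXn2r ?nnegrE // ler_nat.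
    by rewrite lerXn2r ?nnegrE ?sqrtr_ge0 // ler_wsqrtr // ler_nat.
  move: h4 hB; set z := N.+2%:R ^+ 2; set y1 := _ * sqd R d m; rewrite [_ * 2 * _]mulrAC.
  set y2 := n%:R ^+ 2 * _ * _; lra.
have -> : eps / sqd R d m = eps / 2 / sqd R d m + eps / 2 / sqd R d m.
  by rewrite -mulrDl -splitr.
exact: lerD.
Qed.

End MeanDrift.

(** * From the variance bound to the theorem *)

Lemma vnorm_gt0 (R : realType) d alpha n : (1 < n)%N -> 0 < vnorm d alpha n :> R.
Proof.
move=> n1; have n0 : 0 < n%:R :> R by rewrite ltr0n ltnW.
have l0 : 0 < ln n%:R :> R by rewrite ln_gt0 // ltr1n.
rewrite /vnorm; case: ifP => _; first by rewrite exprn_gt0.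
by case: ifP => _; rewrite mulr_gt0 // ?exprn_gt0 // exprz_gt0.
Qed.

Lemma limn_einf_le0 (R : realType) (V : nat -> \bar R) (v : nat -> R) :
  (forall n, (1 < n)%N -> 0 < v n) ->
  (forall c, 0 < c -> exists n0, forall n, (n0 <= n)%N -> (V n <= (c * v n)%:E)%E) ->
  ~ (0 < limn_einf (fun n => V n * ((v n)^-1)%:E))%E.
Proof.
move=> v0 hV; set u := fun n => _ => l0.
have le_c c : 0 < c -> (limn_einf u <= c%:E)%E.
  move=> c0; rewrite limn_einf_lim; apply: lime_le; first exact: is_cvg_einfs.
  have [n0 hn] := hV c c0.
  exists (maxn n0 2) => // n /=; rewrite geq_max => /andP[h1 h2].
  apply: (@le_trans _ _ (u n)).
    by apply: ereal_inf_lbound; exists n => /=.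
  have vn := v0 n h2.
  have : (u n <= (c * v n)%:E * ((v n)^-1)%:E)%E.
    by apply: lee_wpmul2r; [rewrite lee_fin invr_ge0 ltW|exact: hn].
  by move/le_trans; apply; rewrite -EFinM mulfK ?gt_eqF.
have l1 := le_c 1 ltr01; move: le_c l0 l1; case: (limn_einf u) => [r||] // le_c l0 _.
rewrite lte_fin in l0.
by have := le_c (r / 2) (divr_gt0 l0 (ltr0n _ 2)); rewrite lee_fin; lra.
Qed.

Section VarianceBound.
Context {dT : measure_display} {T : measurableType dT} {R : realType} (P : probability T R).
Variables (d : nat) (X : nat -> T -> 'rV[int]_d).
Hypotheses (d_le3 : d = 1%N \/ d = 2%N \/ d = 3%N) (X_iid : iid P X).

(** The torus may depend on the time horizon [n], since it resembles Z^d only up to its size; the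
    constant may not, and neither may [m1] in [fast_return]. *)
Definition heat_kernel_bound (C : R) : Prop := forall n, exists N0, forall N, (N0 <= N)%N ->
  forall m x, (0 < m <= n)%N -> pn (pN P X N) m x <= C / sqd R d m.

Definition fast_return (eps : R) : Prop := exists m1, forall n, exists N0, forall N, (N0 <= N)%N ->
  forall m, (m1 <= m <= n)%N -> pn (pN P X N) m 0 <= eps / sqd R d m.

(** The choices are made in the order [eps], [m1], [n], and the torus last. For [alpha = 1] the
    torus functional is the constant [n], and only the transfer error is left. *)
Lemma variance_small C alpha : (0 < alpha)%N -> 0 <= C -> heat_kernel_bound C ->
  (forall eps, 0 < eps -> fast_return eps) ->
  forall c, 0 < c -> exists n0, forall n, (n0 <= n)%N ->
    ('V_P[self_intersection_lt X alpha n] <= (c * vnorm d alpha n)%:E)%E.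
Proof.
move=> al0 C0 hC hf c c0.
case: alpha al0 => [//|[|al]] al0.
  exists 2%N => n n2.
  have [N /(_ N (leqnn _))] := variance_transfer X_iid n al0 (mulr_gt0 c0 (vnorm_gt0 R d 1 n2)).
  by rewrite VarG_LG1 ?add0r //; apply: pN_sum1.
have [CA [CA0 hA]] := VarG_LG_le R al.
have [K K0 hK] := energy_asym al d_le3 C0.
have D0 : 0 < 2 * (CA * K + 1) by rewrite mulr_gt0 // ltr_wpDl // mulr_ge0.
(* This makes [CA * K * eps] at most half of [c]; the other half is spent on the transfer error. *)
pose eps := c / (2 * (CA * K + 1)).
have eps0 : 0 < eps by rewrite divr_gt0.
have [m1 hm1] := hf eps eps0.
have [n0 n00 hn0] := hK eps m1 eps0.
exists (maxn n0 2) => n; rewrite geq_max => /andP[hn n2].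
have v0 := vnorm_gt0 R d al.+2 n2.
have [N1 h1] := hC n; have [N2 h2] := hm1 (2 * n)%N.
have [N3 h3] := variance_transfer X_iid n al0 (mulr_gt0 (divr_gt0 c0 (ltr0n R 2)) v0).
pose N := maxn N1 (maxn N2 N3).
have {}h1 := h1 N (leq_maxl _ _).
have {}h2 := h2 N (leq_trans (leq_maxl _ _) (leq_maxr _ _)).
apply: (le_trans (h3 N (leq_trans (leq_maxr _ _) (leq_maxr _ _)))); rewrite lee_fin.
pose Q m : R := if m is 0 then 1 else C / sqd R d m.
have p0 := pN_ge0 P X (N := N); have p1 := pN_sum1 X_iid N.
have hQ m x : (m <= n)%N -> pn (pN P X N) m x <= Q m.
  case: m => [|m] mn; first exact: pn_le1.
  by apply: h1; rewrite mn.
have hV := hA _ _ n Q p0 p1 hQ.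
have hE : n%:R * (mass n Q ^+ (2 * al) * energy (pN P X N) n Q) <= K * eps * vnorm d al.+2 n.
  apply: (hn0 n hn (fun m => pn (pN P X N) m 0) Q) => //.
    by move=> m; rewrite pn_ge0 // pn_le1.
  by move=> [|m].
have := ler_wpM2l CA0 hE; move/(le_trans hV) => {}hV.
have he : CA * K * eps <= c / 2.
  rewrite /eps mulrA ler_pdivrMr //.
  have -> : c / 2 * (2 * (CA * K + 1)) = c * (CA * K + 1) by field.
  by rewrite mulrC ler_pM2l // lerDl.
have := ler_wpM2r (ltW v0) he; move: hV; set x := VarG _ _ _; set v := vnorm _ _ _.
have -> : CA * (K * eps * v) = CA * K * eps * v by ring.
move: (CA * K * eps * v) => y; rewrite [c * v](_ : _ = c / 2 * v + c / 2 * v); last by field.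
by move: (c / 2 * v) => z; lra.
Qed.

End VarianceBound.



Theorem theorem2 (R : realType) (dT : measure_display) (T : measurableType dT)
  (P : probability T R) (d alpha : nat) (X : nat -> T -> 'rV[int]_d) :
  (d = 1%N \/ d = 2%N \/ d = 3%N) ->
  (0 < alpha)%N ->
  iid P X ->
  genuinely_d_dim P X ->
  (0 < limn_einf (fun n : nat =>
      ('V_P[self_intersection_lt X alpha n] * ((vnorm d alpha n)^-1)%:E)%E))%E ->
  (expectation P (fun w => sqnorm (X 0%N w)) < +oo)%E /\
  (forall i : 'I_d, expectation P (fun w => ((X 0%N w) ord0 i)%:~R) = 0%E).
Proof.
move=> d3 al0 X_iid gen linf.
have d0 : (0 < d)%N by case: d3 => [->|[->|->]].
have [x0 [a [rmin [mu_x0 rmin0 mu_a basis_unit]]]] := mu_basis X_iid d0 gen.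
have mu0 := mu_ge0 P X.
have [C C0 hC] := pn_bound mu0 mu_x0 rmin0 mu_a basis_unit (Ordinal d0).
have hk : heat_kernel_bound P X C.
  move=> n; have [N0 hN] := hC n; exists N0 => N h m x hm.
  by apply: hN => //; [exact: pN_ge0|exact: pN_sum1|exact: pN_dominates].
have slow : ~ (forall eps, 0 < eps -> fast_return P X eps).
  move=> hf; move: linf; apply: limn_einf_le0; first by move=> n; apply: vnorm_gt0.
  exact: (variance_small d3 X_iid al0 C0 hk hf).
have sq_fin : ('E_P[fun w => sqnorm (X 0%N w)] < +oo)%E.
  have [//|inf] := pselect ('E_P[fun w => sqnorm (X 0%N w)] < +oo)%E.
  exfalso; apply: slow => eps eps0.
  have [Cd Cd0 hd] := pn_decay mu0 mu_x0 rmin0 mu_a basis_unit.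
  (* This brings [Cd / lam%:R] below [eps]. The infinite second moment supplies the sum of order
     [lam ^ 2] that [pn_decay] asks for. *)
  pose lam := (Num.truncn (Cd / eps)).+1.
  have [i0 [F uF hF]] := large_coord X_iid (lam%:R ^+ 2 * rmin) basis_unit inf.
  have [m1 hm] := hd i0 F lam uF isT hF.
  exists m1 => n; have [N0 hN] := hm n; exists N0 => N h m hm1.
  apply: (le_trans (hN N h _ _ _ _ m 0 hm1)).
  - exact: pN_ge0.
  - exact: pN_sum1.
  - exact: pN_dominates.
  rewrite ler_wpM2r ?invr_ge0 ?exprn_ge0 ?sqrtr_ge0 // ler_pdivrMr // mulrC -ler_pdivrMr //.
  exact/ltW/truncnS_gt.
split=> // i; have LY := Lfun_coord X_iid sq_fin i.
apply/eqP/negPn/negP => nz; apply: slow => eps eps0.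
apply: (drift_decay X_iid sq_fin (i := i) _ C0 eps0) => //.
by apply: contra nz => /eqP e; rewrite -(fineK (expectation_fin_num LY)) -[fine _]/(Er P _) e.
Qed.
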